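(* Let $1\le d\le n^2-2$. For operator $d$-systems $\mathcal{S}\le M_n$ with associated quantum graphs $\mathcal{G}$: $\mathrm{Qut}(\mathcal{S}\le M_n)$ is generically trivial if and only if $\mathrm{Qut}(\mathcal{G})$ is generically trivial.
   Context: $M_n$ is the algebra of $n\times n$ complex matrices. For a compact quantum group $\mathrm{G}$, $\mathcal{O}(\mathrm{G})$ is its CQG algebra; quantum subgroups correspond to quotient CQG algebras; $\mathrm{G}$ is trivial if $\mathcal{O}(\mathrm{G})=\mathbb{C}$. $\mathrm{Qut}(M_n,\tau)$ is the universal compact quantum group acting on $M_n$ by a trace-preserving unital $*$-homomorphic coaction $\alpha:M_n\to M_n\otimes\mathcal{O}(\mathrm{Qut}(M_n,\tau))$ (independent of the scaling of the trace $\tau$). An operator system $\mathcal{S}\le M_n$ is a unital self-adjoint complex subspace; an operator $d$-system is one of dimension $d+1$. Its associated quantum graph $\mathcal{G}=(M_n,\tau,A)$, $\tau=n\,\mathrm{Tr}$, has quantum adjacency matrix $A(x)=\sum_iX_ixX_i^*$, where $(X_i)$ is any basis of $\mathcal{S}$ orthonormal for $\langle x\mid y\rangle=\frac1n\mathrm{Tr}(x^*y)$. $\mathrm{Qut}(\mathcal{S}\le M_n)$ is the largest quantum subgroup of $\mathrm{Qut}(M_n,\tau)$ preserving $\mathcal{S}$ (i.e. $\alpha(\mathcal{S})\subseteq\mathcal{S}\otimes\mathcal{O}$). $\mathrm{Qut}(\mathcal{G})$ is the quantum subgroup of $\mathrm{Qut}(M_n,\tau)$ obtained by imposing $\alpha\circ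 A=(A\otimes\mathrm{id})\circ\alpha$. A property of operator $d$-systems $\mathcal{S}=\mathbb{C}1+\mathcal{W}$ (or of the associated quantum graphs) holds generically if it holds for $\mathcal{W}$ ranging over a non-empty open set in the real Zariski topology on the Grassmannian $\mathbb{G}_{sa}(d,M_n)$ of $d$-dimensional self-adjoint complex subspaces of $M_n$. *)

(* Defs.v *)
From HB Require Import structures.
From mathcomp Require Import all_boot all_order all_algebra.
From mathcomp Require Import sesquilinear.
From mathcomp Require Import reals complex.
From mathcomp Require Import mpoly.
Set Implicit Arguments.
Unset Strict Implicit.
Unset Printing Implicit Defensive.
Import Order.TTheory GRing.Theory Num.Theory.
Local Open Scope ring_scope.
Local Open Scope complex_scope.

(** * Algebraic tensors

    A sequence [[:: (a_1, b_1); ...; (a_m, b_m)]] stands for the tensor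
    [\sum_k a_k (x) b_k].  By the universal property of the tensor product, two
    sequences stand for the same tensor iff no bilinear map into any vector
    space separates them. *)
Definition tens_eq (K : fieldType) (A B : lmodType K) (s t : seq (A * B)) : Prop :=
  forall (V : lmodType K) (f : {bilinear A -> B -> V}),
    \sum_(p <- s) f p.1 p.2 = \sum_(p <- t) f p.1 p.2.

Definition trilinear (K : fieldType) (A B C V : lmodType K)
    (f : A -> B -> C -> V) : Prop :=
  [/\ forall b c, linear (fun a => f a b c),
      forall a c, linear (fun b => f a b c)
    & forall a b, linear (fun c => f a b c)].

(** Triples [(a, b, c)] are parsed as [((a, b), c)]. *)
Definition tens3_eq (K : fieldType) (A B C : lmodType K)
    (s t : seq (A * B * C)) : Prop :=
  forall (V : lmodType K) (f : A -> B -> C -> V), trilinear f ->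
    \sum_(p <- s) f p.1.1 p.1.2 p.2 = \sum_(p <- t) f p.1.1 p.1.2 p.2.

(** * CQG algebras *)

Record is_star (R : realType) (A : algType R[i]) (star : A -> A) : Prop := {
  starK : involutive star;
  star_semilinear : forall (c : R[i]) (a b : A),
    star (c *: a + b) = c^* *: star a + star b;
  starM : forall a b : A, star (a * b) = star b * star a
}.

(** [comul] picks a representative of the comultiplication, which is only
    meaningful, and only required to be a coassociative unital *-homomorphism,
    up to equality of tensors. *)
Record is_hopf_star (R : realType) (A : algType R[i]) (star : A -> A)
    (comul : A -> seq (A * A)) (counit : {lrmorphism A -> R[i]^o})
    (antipode : {linear A -> A}) : Prop := {
  hopf_star_star : is_star star;
  comul_linear : forall (c : R[i]) (a b : A),
    tens_eq (comul (c *: a + b))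
            ([seq (c *: p.1, p.2) | p <- comul a] ++ comul b);
  comul1 : tens_eq (comul 1) [:: (1, 1)];
  comulM : forall a b : A,
    tens_eq (comul (a * b))
            [seq (p.1 * q.1, p.2 * q.2) | p <- comul a, q <- comul b];
  comul_star : forall a : A,
    tens_eq (comul (star a)) [seq (star p.1, star p.2) | p <- comul a];
  comulA : forall a : A,
    tens3_eq [seq (q.1, q.2, p.2) | p <- comul a, q <- comul p.1]
             [seq (p.1, q.1, q.2) | p <- comul a, q <- comul p.2];
  counitl : forall a : A, \sum_(p <- comul a) counit p.1 *: p.2 = a;
  counitr : forall a : A, \sum_(p <- comul a) counit p.2 *: p.1 = a;
  antipodel : forall a : A,
    \sum_(p <- comul a) antipode p.1 * p.2 = (counit a)%:A;
  antipoder : forall a : A,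
    \sum_(p <- comul a) p.1 * antipode p.2 = (counit a)%:A
}.

Definition star_mx (A : Type) (star : A -> A) (m n : nat) (y : 'M[A]_(m, n)) :
    'M[A]_(n, m) :=
  \matrix_(i, j) star (y j i).

Definition is_unitary_corep (R : realType) (A : algType R[i]) (star : A -> A)
    (comul : A -> seq (A * A)) (counit : A -> R[i]) (k : nat) (u : 'M[A]_k) : Prop :=
  [/\ forall i j, tens_eq (comul (u i j)) [seq (u i l, u l j) | l <- enum 'I_k],
      forall i j, counit (u i j) = (i == j)%:R,
      u *m star_mx star u = 1%:M
    & star_mx star u *m u = 1%:M].

Definition spanned_by_unitary_coeffs (R : realType) (A : algType R[i])
    (star : A -> A) (comul : A -> seq (A * A)) (counit : A -> R[i]) : Prop :=
  forall a : A, exists2 s : seq (R[i] * A),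
    (forall p, p \in s -> exists (k : nat) (u : 'M[A]_k) (i j : 'I_k),
       is_unitary_corep star comul counit u /\ p.2 = u i j)
    & a = \sum_(p <- s) p.1 *: p.2.

Record cqgAlg (R : realType) : Type := CQGAlg {
  cqg_alg :> algType R[i];
  cqg_star : cqg_alg -> cqg_alg;
  cqg_comul : cqg_alg -> seq (cqg_alg * cqg_alg);
  cqg_counit : {lrmorphism cqg_alg -> R[i]^o};
  cqg_antipode : {linear cqg_alg -> cqg_alg};
  cqg_hopf : is_hopf_star cqg_star cqg_comul cqg_counit cqg_antipode;
  cqg_span : spanned_by_unitary_coeffs cqg_star cqg_comul cqg_counit
}.

Record cqg_morphism (R : realType) (H K : cqgAlg R) (f : {lrmorphism H -> K}) :
    Prop := {
  cqg_morph_star : forall a : H, f (cqg_star a) = cqg_star (f a);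
  cqg_morph_comul : forall a : H,
    tens_eq (cqg_comul (f a)) [seq (f p.1, f p.2) | p <- cqg_comul a];
  cqg_morph_counit : forall a : H, cqg_counit K (f a) = cqg_counit H a
}.

Definition cqg_trivial (R : realType) (H : cqgAlg R) : Prop :=
  forall a : H, exists c : R[i], a = c%:A.

(** A quantum subgroup of the compact quantum group with CQG algebra [Q]:
    a quotient CQG algebra [H], with quotient map [pi]. *)
Definition quantum_subgroup (R : realType) (Q H : cqgAlg R)
    (pi : {lrmorphism Q -> H}) : Prop :=
  cqg_morphism pi /\ (forall b : H, exists a : Q, pi a = b).

(** * Coactions on [M_n]

    [M_n (x) A] is identified with the algebra ['M[A]_n]; the elementary tensor
    [x (x) a] is the matrix with entries [x i j *: a]. *)
Definition mx_tens (R : realType) (A : algType R[i]) (n : nat)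
    (x : 'M[R[i]]_n) (a : A) : 'M[A]_n :=
  \matrix_(i, j) (x i j *: a).

(** [f (x) id], for [f] a linear endomorphism of [M_n]. *)
Definition amplify (R : realType) (A : algType R[i]) (n : nat)
    (f : 'M[R[i]]_n -> 'M[R[i]]_n) (y : 'M[A]_n) : 'M[A]_n :=
  \sum_i \sum_j mx_tens (f (delta_mx i j)) (y i j).

(** [phi (x) id], for [phi] a linear functional on [M_n]. *)
Definition slice (R : realType) (A : algType R[i]) (n : nat)
    (phi : 'M[R[i]]_n -> R[i]) (y : 'M[A]_n) : A :=
  \sum_i \sum_j phi (delta_mx i j) *: y i j.

Definition adjmx (R : realType) (m n : nat) (x : 'M[R[i]]_(m, n)) : 'M[R[i]]_(n, m) :=
  star_mx Num.conj x.

Definition tau (R : realType) (n : nat) (x : 'M[R[i]]_n) : R[i] := n%:R * \tr x.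

(** In [action_coassoc], [(alpha (x) id) (alpha x)] is computed from
    [alpha x = \sum_(k, l) e_(k, l) (x) (alpha x) k l]. *)
Record is_action (R : realType) (n : nat) (H : cqgAlg R)
    (alpha : 'M[R[i]]_n -> 'M[H]_n) : Prop := {
  action_linear : forall (c : R[i]) (x y : 'M[R[i]]_n),
    alpha (c *: x + y) = map_mx ( *:%R c) (alpha x) + alpha y;
  action1 : alpha 1%:M = 1%:M;
  actionM : forall x y : 'M[R[i]]_n, alpha (x *m y) = alpha x *m alpha y;
  action_star : forall x : 'M[R[i]]_n,
    alpha (adjmx x) = star_mx (@cqg_star R H) (alpha x);
  action_coassoc : forall (x : 'M[R[i]]_n) (i j : 'I_n),
    tens_eq (cqg_comul (alpha x i j))
            [seq (alpha (delta_mx kl.1 kl.2) i j, alpha x kl.1 kl.2)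
            | kl <- enum {: 'I_n * 'I_n}];
  action_counit : forall x : 'M[R[i]]_n, map_mx (cqg_counit H) (alpha x) = x;
  action_trace : forall x : 'M[R[i]]_n, slice (@tau R n) (alpha x) = (tau x)%:A
}.

(** [(Q, alpha)] is [Qut(M_n, tau)] with its universal action. *)
Definition is_Qut (R : realType) (n : nat) (Q : cqgAlg R)
    (alpha : 'M[R[i]]_n -> 'M[Q]_n) : Prop :=
  is_action alpha /\
  forall (H : cqgAlg R) (beta : 'M[R[i]]_n -> 'M[H]_n), is_action beta ->
    exists f : {lrmorphism Q -> H},
      [/\ cqg_morphism f,
          forall x, map_mx f (alpha x) = beta x
        & forall g : {lrmorphism Q -> H}, cqg_morphism g ->
            (forall x, map_mx g (alpha x) = beta x) -> g =1 f].

(** [(H, pi)] is the largest quantum subgroup of [(Q, alpha)] whose restricted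
    action [(id (x) pi) \o alpha] satisfies [P]. *)
Definition largest_quantum_subgroup (R : realType) (n : nat) (Q : cqgAlg R)
    (alpha : 'M[R[i]]_n -> 'M[Q]_n)
    (P : forall K : cqgAlg R, ('M[R[i]]_n -> 'M[K]_n) -> Prop)
    (H : cqgAlg R) (pi : {lrmorphism Q -> H}) : Prop :=
  [/\ quantum_subgroup pi,
      P H (fun x => map_mx pi (alpha x))
    & forall (K : cqgAlg R) (rho : {lrmorphism Q -> K}),
        quantum_subgroup rho -> P K (fun x => map_mx rho (alpha x)) ->
        exists2 f : {lrmorphism H -> K}, cqg_morphism f & forall a, rho a = f (pi a)].

(** * Operator systems and quantum graphs *)

Definition self_adjoint_space (R : realType) (n : nat) (W : {vspace 'M[R[i]]_n}) : Prop :=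
  forall x, x \in W -> adjmx x \in W.

Definition operator_system (R : realType) (n : nat) (S : {vspace 'M[R[i]]_n}) : Prop :=
  1%:M \in S /\ self_adjoint_space S.

Definition operator_dsystem (R : realType) (n d : nat) (S : {vspace 'M[R[i]]_n}) : Prop :=
  operator_system S /\ \dim S = d.+1.

Definition mx_inner (R : realType) (n : nat) (x y : 'M[R[i]]_n) : R[i] :=
  n%:R^-1 * \tr (adjmx x *m y).

(** [A] is the quantum adjacency matrix of the quantum graph [(M_n, tau, A)]
    associated with [S]; it does not depend on the orthonormal basis. *)
Definition is_quantum_adjacency (R : realType) (n : nat) (S : {vspace 'M[R[i]]_n})
    (A : 'M[R[i]]_n -> 'M[R[i]]_n) : Prop :=
  exists X : (\dim S).-tuple 'M[R[i]]_n,
    [/\ basis_of S X,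
        forall i j, mx_inner (tnth X i) (tnth X j) = (i == j)%:R
      & forall x, A x = \sum_i tnth X i *m x *m adjmx (tnth X i)].

(** [alpha(S)] is contained in [S (x) O]. *)
Definition preserves_space (R : realType) (n : nat) (S : {vspace 'M[R[i]]_n})
    (H : cqgAlg R) (alpha : 'M[R[i]]_n -> 'M[H]_n) : Prop :=
  forall x, x \in S -> exists2 s : seq ('M[R[i]]_n * H),
    (forall p, p \in s -> p.1 \in S)
    & alpha x = \sum_(p <- s) mx_tens p.1 p.2.

Definition preserves_adjacency (R : realType) (n : nat)
    (A : 'M[R[i]]_n -> 'M[R[i]]_n)
    (H : cqgAlg R) (alpha : 'M[R[i]]_n -> 'M[H]_n) : Prop :=
  forall x, alpha (A x) = amplify A (alpha x).

(** [Qut(S <= M_n)] is trivial; [(Q, alpha)] is meant to be [Qut(M_n, tau)]. *)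
Definition Qut_system_trivial (R : realType) (n : nat) (Q : cqgAlg R)
    (alpha : 'M[R[i]]_n -> 'M[Q]_n) (S : {vspace 'M[R[i]]_n}) : Prop :=
  exists (H : cqgAlg R) (pi : {lrmorphism Q -> H}),
    largest_quantum_subgroup alpha (preserves_space S) pi /\ cqg_trivial H.

(** [Qut(G)] is trivial, for the quantum graph [G] associated with [S]. *)
Definition Qut_graph_trivial (R : realType) (n : nat) (Q : cqgAlg R)
    (alpha : 'M[R[i]]_n -> 'M[Q]_n) (S : {vspace 'M[R[i]]_n}) : Prop :=
  exists2 A : 'M[R[i]]_n -> 'M[R[i]]_n, is_quantum_adjacency S A &
  exists (H : cqgAlg R) (pi : {lrmorphism Q -> H}),
    largest_quantum_subgroup alpha (preserves_adjacency A) pi /\ cqg_trivial H.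

(** * Genericity *)

Definition grassmannian_sa (R : realType) (n d : nat) (W : {vspace 'M[R[i]]_n}) : Prop :=
  self_adjoint_space W /\ \dim W = d.

Definition real_coord_index (n d : nat) : finType := ('I_d * 'I_n * 'I_n * bool)%type.

(** Real and imaginary parts of the entries of a [d]-tuple of matrices. *)
Definition real_coords (R : realType) (n d : nat) (X : d.-tuple 'M[R[i]]_n)
    (k : 'I_#|real_coord_index n d|) : R :=
  let: (l, i, j, b) := enum_val k in
  if b then complex.Im (tnth X l i j) else complex.Re (tnth X l i j).

(** A self-adjoint subspace of dimension [d] has a basis of [d] self-adjoint
    matrices, unique up to the action of GL_d(R): the Grassmannian is the
    quotient by GL_d(R) of the (real Zariski open) set of linearly independent
    [d]-tuples of self-adjoint matrices, with the quotient topology.  So [U] is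
    open iff, in terms of such tuples, it is the complement of the common zero
    set of a family [F] of real polynomials. *)
Definition zariski_open_sa (R : realType) (n d : nat)
    (U : {vspace 'M[R[i]]_n} -> Prop) : Prop :=
  exists F : {mpoly R[#|real_coord_index n d|]} -> Prop,
  forall X : d.-tuple 'M[R[i]]_n,
    (forall l, adjmx (tnth X l) = tnth X l) -> free X ->
    (U <<X>>%VS <-> exists2 p, F p & p.@[real_coords X] != 0).

Definition generically (R : realType) (n d : nat)
    (P : {vspace 'M[R[i]]_n} -> Prop) : Prop :=
  exists U : {vspace 'M[R[i]]_n} -> Prop,
    [/\ zariski_open_sa d U,
        exists2 W, grassmannian_sa d W & U W
      & forall W, grassmannian_sa d W -> U W ->
          operator_dsystem d (<[1%:M]> + W)%VS /\ P (<[1%:M]> + W)%VS].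

(* Main.v *)
(** Let [A] be the adjacency matrix of [S].  If a trace-preserving action
    preserves [A], its fixed points form a unital algebra closed under [A].  The
    same holds if it preserves [S]: trace preservation identifies the antipode
    with a transpose, so that the orthogonal projection onto [S] is equivariant
    and the tensor [\sum_(b, k) e_(b, k) (x) e_(k, b)] is invariant, and [A] is
    a contraction of the two.  Hence both quantum groups are trivial as soon as
    the algebra generated by [1] under [A] is all of [M_n] ("rigidity"), a real
    Zariski open condition because [A] is rational in the coordinates of a basis.

    For [2 <= d <= n^2 - 3] rigid systems exist.  It suffices to treat
    [d <= (n^2 - 1) / 2], since [S] may be replaced by [C1 + S^perp], whose
    adjacency matrix is [x |-> tr(x) 1 - A(x) + x] up to constants.  Take the span
    of [1], two real symmetric matrices [Z1], [Z2] such that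
    [Z1^2 / |Z1|^2 + Z2^2 / |Z2|^2] is diagonal, and Hermitian units orthogonal to
    them: then [A(1)] is diagonal, its entries are distinct by construction, so
    the [e_(i, i)] are generated, and the off-diagonal entries of the [A(e_(k, k))]
    connect all the indices.  So both sides of the equivalence hold.

    For [d = 1] and [d = n^2 - 2] (in particular for [n = 2]) both sides fail: [S]
    or its orthogonal is determined by one normal matrix, and conjugation by a
    nonscalar unitary involution commuting with it is an action of [Z/2] preserving
    [S] and [A]. *)
From HB Require Import structures.
Require Import Defs.
From mathcomp Require Import all_boot all_order all_algebra.
From mathcomp Require Import sesquilinear spectral ssrAC.
From mathcomp Require Import reals complex.
From mathcomp Require Import mpoly.
From mathcomp Require Import zify ring lra.
Set Implicit Arguments.
Unset Strict Implicit.
Unset Printing Implicit Defensive.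
Import Order.TTheory GRing.Theory Num.Theory.
Local Open Scope ring_scope.
Local Open Scope complex_scope.

(** Openness forces a polynomial form of rigidity: for a fixed choice of n^2 words, generation of
    M_n is implied by the non-vanishing of the determinant of their values, and the denominators of
    the projection are cleared by a Gram determinant, which only rescales the adjacency operator and
    so does not change the generated algebra. The examples are arranged so that the choice of
    Hermitian units hardly matters. With the normalisation of [adj_of], each unit adds 1/2 to two
    diagonal entries of A(1), so entries that are distinct and less than 1/2 apart before units are
    adjoined stay distinct; and it contributes nothing off the diagonal of A(e_kk), so the
    connections between indices survive. Hence one pair Z1, Z2 per n serves all d. The restriction
    to d <= (n^2 - 1) / 2 reflects the supply of units: n(n - 1)/2 imaginary ones are orthogonal to
    every real symmetric matrix, but a real one is only available where Z1 and Z2 both vanish. *)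

Lemma tens_eq_bilinear (K : fieldType) (A B V : lmodType K) (s t : seq (A * B))
    (f : A -> B -> V) :
  bilinear_for *:%R *:%R f -> tens_eq s t ->
  \sum_(p <- s) f p.1 p.2 = \sum_(p <- t) f p.1 p.2.
Proof.
move=> bf st.
pose M := bilinear_isBilinear.Build K A B V *:%R *:%R f bf.
pose g : {bilinear A -> B -> V} := HB.pack f M.
exact: (st V g).
Qed.

(** * CQG morphisms and the trivial quantum group *)

Section TrivialQuantumGroup.
Variable R : realType.
Local Notation C := (R[i]).

Definition C_star (a : C^o) : C^o := (a : C)^*.
Definition C_comul (a : C^o) : seq (C^o * C^o) := [:: (a, 1)].
Definition C_counit : {lrmorphism C^o -> C^o} := idfun.
Definition C_antipode : {linear C^o -> C^o} := idfun.

Lemma C_is_star : is_star C_star.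
Proof.
split; rewrite /C_star.
- exact: conjcK.
- move=> c a b; rewrite -[c *: a]/((c : C) * a) rmorphD rmorphM; exact: erefl.
- by move=> a b; rewrite rmorphM mulrC.
Qed.

Lemma C_star1 : C_star 1 = 1.
Proof. exact: conjc1. Qed.

Lemma C_is_hopf : is_hopf_star C_star C_comul C_counit C_antipode.
Proof.
split; rewrite /C_comul.
- exact: C_is_star.
- by move=> c a b V f; rewrite /= !big_cons !big_nil !addr0 linearPl linearZl_LR.
- by [].
- by move=> a b V f; rewrite /= !big_seq1 /= mulr1.
- by move=> a V f; rewrite /= !big_seq1; exact: (congr1 (f (C_star a)) (esym C_star1)).
- by move=> a V f _; rewrite /= !big_seq1.
- by move=> a; rewrite big_seq1 /= -[_ *: _]/(_ * _) mulr1.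
- by move=> a; rewrite big_seq1 /= scale1r.
- by move=> a; rewrite big_seq1 /= mulr1 -[_ *: _]/(_ * _) mulr1.
- by move=> a; rewrite big_seq1 /= mulr1 -[_ *: _]/(_ * _) mulr1.
Qed.

Lemma C_span : spanned_by_unitary_coeffs C_star C_comul C_counit.
Proof.
move=> a; exists [:: (a, 1)]; last first.
  by rewrite big_seq1 /= -[_ *: _]/(_ * _) mulr1.
move=> p; rewrite inE => /eqP -> /=.
exists 1%N, 1%:M, ord0, ord0; split; last by rewrite mxE eqxx.
have star1 : star_mx C_star (1%:M : 'M[C^o]_1) = 1%:M.
  by apply/matrixP=> i j; rewrite !mxE !ord1 eqxx C_star1.
split; rewrite ?star1 ?mulmx1 //.
- move=> i j V f; rewrite !ord1 big_map big_enum /= big_ord1 mxE eqxx.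
  by rewrite /C_comul big_seq1.
- by move=> i j; rewrite mxE.
Qed.

Definition C_cqg : cqgAlg R := CQGAlg C_is_hopf C_span.

Lemma C_cqg_trivial : cqg_trivial C_cqg.
Proof. by move=> a; exists a; rewrite -[_ *: _]/(_ * _) mulr1. Qed.

End TrivialQuantumGroup.

Section CqgMorphisms.
Variable R : realType.
Local Notation C := (R[i]).
Implicit Types H K L : cqgAlg R.

Lemma cqg_star0 H : cqg_star (0 : H) = 0.
Proof.
have := starK (hopf_star_star (cqg_hopf H)) 0.
have E := star_semilinear (hopf_star_star (cqg_hopf H)) (-1) 0 0.
by move: E; rewrite scaler0 addr0 rmorphN1 scaleN1r addNr.
Qed.

Lemma cqg_starZ H (c : C) (a : H) : cqg_star (c *: a) = c^* *: cqg_star a.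
Proof.
by rewrite -[c *: a]addr0 (star_semilinear (hopf_star_star (cqg_hopf H))) cqg_star0 addr0.
Qed.

Lemma cqg_star1 H : cqg_star (1 : H) = 1.
Proof.
have st := hopf_star_star (cqg_hopf H).
by rewrite -[LHS]mul1r -{1}(starK st 1) -(starM st) mul1r (starK st).
Qed.

Lemma cqg_comul_scalar H (c : C) :
  tens_eq (cqg_comul (c%:A : H)) [:: (c%:A, 1)].
Proof.
move=> V f; have hh := cqg_hopf H.
(* The axiom [comul_linear] speaks only of combinations [c *: a + b], and [comul] is known at 1;
   this writes the scalar in that form. *)
have -> : c%:A = (c - 1) *: 1 + 1 :> H by rewrite scalerBl scale1r subrK.
rewrite (comul_linear hh) big_cat /= big_map /=.
under eq_bigr do rewrite linearZl_LR.
by rewrite -scaler_sumr (comul1 hh) !big_seq1 /= linearPl.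
Qed.

Lemma cqg_counit_scalar H (c : C) : cqg_counit H c%:A = c.
Proof.
rewrite (linearZ_LR (cqg_counit H) c 1) (rmorph1 (cqg_counit H)).
exact: mulr1.
Qed.

Lemma cqg_morph_comp H K L (f : {lrmorphism H -> K}) (g : {lrmorphism K -> L}) :
  cqg_morphism f -> cqg_morphism g -> cqg_morphism (g \o f).
Proof.
move=> [fs fc fe] [gs gc ge]; split => a /=.
- by rewrite fs gs.
- move=> V h; rewrite (gc (f a)) !big_map /=.
  rewrite -[RHS](big_map (fun p => (f p.1, f p.2)) xpredT (fun p => h (g p.1) (g p.2))).
  have bl : bilinear_for *:%R *:%R (fun x y => h (g x) (g y)).
    split=> [u c x y|u c x y]; first by rewrite linearP linearPl.
    by rewrite linearP linearPr.
  exact: (tens_eq_bilinear bl (fc a)).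
- by rewrite ge fe.
Qed.

Definition unit_map K (c : C^o) : K := (c : C)%:A.

Fact unit_map_zmod K : zmod_morphism (@unit_map K).
Proof. by move=> a b; rewrite /unit_map scalerBl. Qed.
Fact unit_map_monoid K : monoid_morphism (@unit_map K).
Proof.
split; first by rewrite /unit_map scale1r.
by move=> a b; rewrite /unit_map -scalerAl mul1r scalerA.
Qed.
Fact unit_map_scalable K : scalable (@unit_map K).
Proof. by move=> a b; rewrite /unit_map scalerA. Qed.
HB.instance Definition _ K := GRing.isZmodMorphism.Build _ _ (@unit_map K) (@unit_map_zmod K).
HB.instance Definition _ K := GRing.isMonoidMorphism.Build _ _ (@unit_map K) (@unit_map_monoid K).
HB.instance Definition _ K := GRing.isScalable.Build _ _ _ _ (@unit_map K) (@unit_map_scalable K).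

Definition unit_morphism K : {lrmorphism C_cqg R -> K} := @unit_map K.

Lemma unit_morphism_cqg K : cqg_morphism (unit_morphism K).
Proof.
split=> a /=.
- by rewrite /unit_map cqg_starZ cqg_star1.
- by move=> V f; rewrite (cqg_comul_scalar a) /= !big_seq1 /= /unit_map scale1r.
- exact: cqg_counit_scalar.
Qed.

End CqgMorphisms.

(** * Actions *)

Section Actions.
Variables (R : realType) (n : nat).
Local Notation C := (R[i]).
Local Notation M := 'M[C]_n.
Implicit Types H K : cqgAlg R.

Lemma mx_tensM K (x y : M) (a b : K) :
  mx_tens x a *m mx_tens y b = mx_tens (x *m y) (a * b).
Proof.
apply/matrixP=> i j; rewrite !mxE scaler_suml; apply: eq_bigr => k _.
by rewrite !mxE -scalerAl -scalerAr scalerA.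
Qed.

Lemma mx_tensDl K (x y : M) (a : K) : mx_tens (x + y) a = mx_tens x a + mx_tens y a.
Proof. by apply/matrixP=> i j; rewrite !mxE scalerDl. Qed.

Lemma mx_tensZl K (c : C) (x : M) (a : K) :
  mx_tens (c *: x) a = map_mx ( *:%R c) (mx_tens x a).
Proof. by apply/matrixP=> i j; rewrite !mxE scalerA. Qed.

Lemma mx_tens_id K : mx_tens (1%:M : M) (1 : K) = 1%:M.
Proof. by apply/matrixP=> i j; rewrite !mxE; case: eqP => _; rewrite ?scale1r ?scale0r. Qed.

Lemma delta_mxE (i j k l : 'I_n) :
  (delta_mx i j : M) k l = (i == k)%:R * (j == l)%:R.
Proof. by rewrite mxE -natrM mulnb (eq_sym k) (eq_sym l). Qed.

Lemma tau_delta (i j : 'I_n) : tau (delta_mx i j : M) = (i == j)%:R * n%:R.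
Proof.
rewrite /tau mulrC; congr (_ * _); rewrite /mxtrace (bigD1 i) //= big1 => [|k ki].
  by rewrite delta_mxE eqxx mul1r addr0 eq_sym.
by rewrite delta_mxE (eq_sym i) (negPf ki) mul0r.
Qed.

Lemma slice_tau K (y : 'M[K]_n) : slice (@tau R n) y = n%:R *: \sum_i y i i.
Proof.
rewrite /slice scaler_sumr; apply: eq_bigr => i _.
rewrite (bigD1 i) //= big1 => [|j ji]; rewrite tau_delta.
  by rewrite eqxx mul1r addr0.
by rewrite eq_sym (negPf ji) mul0r scale0r.
Qed.

Lemma trivial_is_action K : is_action (fun x : M => mx_tens x (1 : K)).
Proof.
split.
- by move=> c x y; rewrite mx_tensDl mx_tensZl.
- exact: mx_tens_id.
- by move=> x y; rewrite mx_tensM mulr1.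
- by move=> x; apply/matrixP=> i j; rewrite !mxE cqg_starZ cqg_star1.
- move=> x i j V f; rewrite mxE (cqg_comul_scalar (x i j)) big_seq1 big_map big_enum /=.
  rewrite (bigD1 (i, j)) //= big1 => [|[k l] /= kl].
    by rewrite addr0 !mxE !eqxx scale1r linearZl_LR linearZr_LR.
  rewrite !mxE /=; have -> : (i == k) && (j == l) = false; last first.
    by rewrite scale0r linear0l.
  by apply/negbTE; apply: contraNN kl => /andP[/eqP-> /eqP->].
- by move=> x; apply/matrixP=> i j; rewrite !mxE cqg_counit_scalar.
- move=> x; rewrite slice_tau /tau -scalerA; congr (_ *: _).
  by rewrite /mxtrace scaler_suml; apply: eq_bigr => i _; rewrite mxE.
Qed.

Lemma push_is_action H K (alpha : M -> 'M[H]_n) (f : {lrmorphism H -> K}) :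
  is_action alpha -> cqg_morphism f -> is_action (fun x => map_mx f (alpha x)).
Proof.
move=> ac [fs fc fe]; split.
- by move=> c x y; rewrite (action_linear ac); apply/matrixP=> i j; rewrite !mxE linearP.
- by rewrite (action1 ac) map_mx1.
- by move=> x y; rewrite (actionM ac) map_mxM.
- by move=> x; rewrite (action_star ac); apply/matrixP=> i j; rewrite !mxE fs.
- move=> x i j V g; rewrite !mxE (fc (alpha x i j)) big_map [RHS]big_map /=.
  have bl : bilinear_for *:%R *:%R (fun x y => g (f x) (f y)).
    split=> [u c y z|u c y z]; first by rewrite linearP linearPl.
    by rewrite linearP linearPr.
  rewrite (tens_eq_bilinear bl (action_coassoc ac x i j)) big_map /=.
  by apply: eq_bigr => -[k l] _ /=; rewrite !mxE.
- move=> x; rewrite -[RHS](action_counit ac x).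
  by apply/matrixP=> i j; rewrite !mxE fe.
- move=> x; rewrite slice_tau; have := congr1 f (action_trace ac x).
  rewrite slice_tau linearZ linear_sum linearZ /= rmorph1 => <-.
  by congr (_ *: _); apply: eq_bigr => i _; rewrite mxE.
Qed.

(** The universal property gives [pi] from the trivial action. If the restriction of the action
    along [rho] satisfies P, it is trivial, so [rho] and the composite of [pi] with the unit map
    induce the same action, and the uniqueness clause identifies them. *)
Lemma largest_trivial (Q : cqgAlg R) (alpha : M -> 'M[Q]_n)
    (P : forall K : cqgAlg R, (M -> 'M[K]_n) -> Prop) :
  is_Qut alpha ->
  (forall (K : cqgAlg R) (b c : M -> 'M[K]_n), b =1 c -> P K b -> P K c) ->
  P (C_cqg R) (fun x => mx_tens x 1) ->
  (forall (K : cqgAlg R) (beta : M -> 'M[K]_n), is_action beta -> P K beta ->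
     forall x, beta x = mx_tens x 1) ->
  exists (H : cqgAlg R) (pi : {lrmorphism Q -> H}),
    largest_quantum_subgroup alpha P pi /\ cqg_trivial H.
Proof.
move=> [ac univ] Pext PC Ptriv.
have [pi [pim pia _]] := univ _ _ (trivial_is_action (C_cqg R)).
exists (C_cqg R), pi; split; last exact: C_cqg_trivial.
split.
- split=> // b; exists ((b : C)%:A).
  by rewrite linearZ rmorph1; exact: mulr1.
- by apply: (Pext _ _ _ _ PC) => x; rewrite pia.
- move=> K rho [rhom _] /(Ptriv _ _ (push_is_action ac rhom)) rhoa.
  exists (unit_morphism K); first exact: unit_morphism_cqg.
  have [g [_ _ gu]] := univ _ _ (trivial_is_action K).
  have E := cqg_morph_comp pim (unit_morphism_cqg K).
  move=> a; rewrite (gu rho) // -(gu _ E) // => x.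
  rewrite -[RHS](_ : map_mx (unit_morphism K) (map_mx pi (alpha x)) = _).
    by apply/matrixP=> i j; rewrite !mxE.
  rewrite pia; apply/matrixP=> i j; rewrite !mxE /= /unit_map.
  by congr (_ *: _); exact: mulr1.
Qed.

End Actions.

(** * Orthogonal projections and adjacency operators *)

Section Projections.
Variables (R : realType) (n : nat).
Local Notation C := (R[i]).
Local Notation M := 'M[C]_n.

Lemma linear_mxE (P : M -> M) : linear P -> forall w p q,
  P w p q = \sum_i \sum_j w i j * P (delta_mx i j) p q.
Proof.
move=> linP w p q.
pose L : {linear M -> M} := HB.pack P (GRing.isLinear.Build C M M _ P linP).
rewrite -[P]/(L : M -> M) {1}[w]matrix_sum_delta linear_sum summxE.
apply: eq_bigr => i _; rewrite linear_sum summxE.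
by apply: eq_bigr => j _; rewrite linearZ mxE.
Qed.

(** Specified instead of constructed: by [proj_uniq], an orthonormal basis, a Gram matrix, or
    conjugation by a symmetry of S must all lead to the same map. *)
Record is_proj (S : {vspace M}) (P : M -> M) : Prop := {
  proj_linear : linear P;
  proj_mem : forall y, P y \in S;
  proj_orth : forall x y, x \in S -> \tr (adjmx x *m (y - P y)) = 0
}.

(** The quantum adjacency matrix divided by n (see [quantum_adjacency_adj_of]), written without a
    basis of S: the invariant tensor of all e_bk (x) e_kb, with P applied to its first leg and x
    inserted in between. *)
Definition adj_of (P : M -> M) (x : M) : M :=
  \sum_b \sum_k P (delta_mx b k) *m x *m delta_mx k b.

Lemma adjmxE m p (x : 'M[C]_(m, p)) i j : adjmx x i j = (x j i)^*.
Proof. by rewrite mxE. Qed.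

Lemma adjmxK m p (x : 'M[C]_(m, p)) : adjmx (adjmx x) = x.
Proof. by apply/matrixP=> i j; rewrite !adjmxE conjcK. Qed.

Lemma adjmxD m p (x y : 'M[C]_(m, p)) : adjmx (x + y) = adjmx x + adjmx y.
Proof. by apply/matrixP=> i j; rewrite !(adjmxE, mxE) rmorphD. Qed.

Lemma adjmxZ m p c (x : 'M[C]_(m, p)) : adjmx (c *: x) = (c^*)%C *: adjmx x.
Proof. by apply/matrixP=> i j; rewrite !(adjmxE, mxE) rmorphM. Qed.

Lemma adjmx0 m p : adjmx (0 : 'M[C]_(m, p)) = 0.
Proof. by apply/matrixP=> i j; rewrite !(adjmxE, mxE) conjc0. Qed.

Lemma adjmxN m p (x : 'M[C]_(m, p)) : adjmx (- x) = - adjmx x.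
Proof. by apply/matrixP=> i j; rewrite !(adjmxE, mxE) rmorphN. Qed.

Lemma adjmxB m p (x y : 'M[C]_(m, p)) : adjmx (x - y) = adjmx x - adjmx y.
Proof. by rewrite adjmxD adjmxN. Qed.

Lemma adjmxM m p q (x : 'M[C]_(m, p)) (y : 'M[C]_(p, q)) :
  adjmx (x *m y) = adjmx y *m adjmx x.
Proof.
apply/matrixP=> i j; rewrite !(adjmxE, mxE) rmorph_sum; apply: eq_bigr => k _.
by rewrite !adjmxE rmorphM mulrC.
Qed.

Lemma adjmx1 : adjmx (1%:M : M) = 1%:M.
Proof.
apply/matrixP=> i j; rewrite adjmxE !mxE eq_sym.
by case: eqP => _; rewrite ?conjc0 ?conjc1.
Qed.

Lemma adjmx_delta i j : adjmx (delta_mx i j : M) = delta_mx j i.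
Proof. by apply/matrixP=> k l; rewrite adjmxE !mxE andbC; case: (_ && _); rewrite ?conjc0 ?conjc1. Qed.

Lemma adjmx_sum m p I r (P : pred I) (F : I -> 'M[C]_(m, p)) :
  adjmx (\sum_(i <- r | P i) F i) = \sum_(i <- r | P i) adjmx (F i).
Proof. exact: (big_morph _ (@adjmxD m p) (@adjmx0 m p)). Qed.

Lemma mxtrace_adj (x : M) : \tr (adjmx x) = (\tr x)^*.
Proof. by rewrite /mxtrace rmorph_sum; apply: eq_bigr => i _; rewrite adjmxE. Qed.

Lemma mxtrace_deltaM (x : M) i j : \tr (delta_mx i j *m x) = x j i.
Proof.
rewrite /mxtrace (bigD1 i) //= big1 => [|k ki]; rewrite mxE (bigD1 j) //= big1.
- by rewrite delta_mxE !eqxx !mul1r !addr0.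
- by move=> k kj; rewrite delta_mxE [j == k]eq_sym (negPf kj) mulr0 mul0r.
- by rewrite delta_mxE [i == k]eq_sym (negPf ki) !mul0r add0r.
- by move=> l _; rewrite delta_mxE [i == k]eq_sym (negPf ki) !mul0r.
Qed.

Lemma mxtrace_Mdelta (x : M) i j : \tr (x *m delta_mx i j) = x j i.
Proof. by rewrite mxtrace_mulC mxtrace_deltaM. Qed.

Lemma mulmx_deltaE (x : M) (k b i j : 'I_n) : (x *m delta_mx k b) i j = x i k * (b == j)%:R.
Proof.
rewrite mxE (bigD1 k) //= big1 => [|l lk]; first by rewrite delta_mxE eqxx mul1r addr0.
by rewrite delta_mxE [k == l]eq_sym (negPf lk) mul0r mulr0.
Qed.

Lemma adj_ofE P x i j :
  adj_of P x i j = \sum_k (P (delta_mx j k) *m x) i k.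
Proof.
rewrite /adj_of summxE (bigD1 j) //= [X in _ + X]big1 ?addr0 => [|b bj]; rewrite summxE.
  by apply: eq_bigr => k _; rewrite mulmx_deltaE eqxx mulr1.
by rewrite big1 // => k _; rewrite mulmx_deltaE (negPf bj) mulr0.
Qed.

Lemma mxtrace_adj_self0 (x : M) : \tr (adjmx x *m x) = 0 -> x = 0.
Proof.
rewrite /mxtrace; under eq_bigr do rewrite mxE.
have ge0 i j : 0 <= adjmx x i j * x j i by rewrite adjmxE mulrC; exact: mul_conjC_ge0.
move=> /eqP; rewrite psumr_eq0 => [|i _]; last by rewrite sumr_ge0.
move=> /allP h; apply/matrixP=> j i; rewrite mxE.
have := h i (mem_index_enum i); rewrite psumr_eq0 //= => /allP /(_ j (mem_index_enum j)).
by rewrite adjmxE mulrC -[_^*]/(Num.conj _) mul_conjC_eq0 => /eqP.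
Qed.

Lemma proj_uniq S P P' : is_proj S P -> is_proj S P' -> P =1 P'.
Proof.
move=> [_ m1 o1] [_ m2 o2] y; apply/eqP; rewrite -subr_eq0; apply/eqP.
apply: mxtrace_adj_self0; set z := P y - P' y.
have zS : z \in S by rewrite rpredB.
have {2}-> : z = (y - P' y) - (y - P y) by rewrite opprB addrC addrA subrK.
by rewrite mulmxBr linearB /= o1 ?o2 ?subr0.
Qed.

(* Words witness membership in the generated algebra by expressions that are
   polynomial in the operator. *)
Inductive word :=
  | Wone
  | Wop of word
  | Wmul of word & word
  | Wlin of C & word & word.

Fixpoint eval (T : M -> M) (w : word) : M :=
  match w with
  | Wone => 1%:M
  | Wop w => T (eval T w)
  | Wmul w1 w2 => eval T w1 *m eval T w2
  | Wlin c w1 w2 => c *: eval T w1 + eval T w2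
  end.

Definition gen (T : M -> M) (x : M) : Prop := exists w, eval T w = x.

Lemma gen_min (T : M -> M) (F : M -> Prop) :
  F 1%:M -> (forall x, F x -> F (T x)) ->
  (forall x y, F x -> F y -> F (x *m y)) ->
  (forall c x y, F x -> F y -> F (c *: x + y)) ->
  forall x, gen T x -> F x.
Proof.
move=> F1 FT FM FL x [w <-]; elim: w => [|w ?|w1 ? w2 ?|c w1 ? w2 ?] //=.
- exact: FT.
- exact: FM.
- exact: FL.
Qed.

Lemma gen1 T : gen T 1%:M. Proof. by exists Wone. Qed.

Lemma genT T x : gen T x -> gen T (T x).
Proof. by move=> [w <-]; exists (Wop w). Qed.

Lemma genM T x y : gen T x -> gen T y -> gen T (x *m y).
Proof. by move=> [w <-] [v <-]; exists (Wmul w v). Qed.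

Lemma gen_lin T c x y : gen T x -> gen T y -> gen T (c *: x + y).
Proof. by move=> [w <-] [v <-]; exists (Wlin c w v). Qed.

Lemma gen0 T : gen T 0.
Proof. by rewrite -(addNr 1%:M) -scaleN1r; apply: gen_lin; apply: gen1. Qed.

Lemma genZ T c x : gen T x -> gen T (c *: x).
Proof. by move=> gx; rewrite -[_ *: _]addr0; apply: gen_lin gx (gen0 T). Qed.

Lemma genD T x y : gen T x -> gen T y -> gen T (x + y).
Proof. by rewrite -{2}[x]scale1r; apply: gen_lin. Qed.

Lemma gen_sum T I r (P : pred I) (F : I -> M) :
  (forall i, P i -> gen T (F i)) -> gen T (\sum_(i <- r | P i) F i).
Proof. by move=> gF; apply: big_ind gF; [exact: gen0 | exact: genD]. Qed.

Lemma gen_scaled T T' c :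
  (forall x, T' x = c *: T x) -> forall x, gen T' x -> gen T x.
Proof.
move=> TT'; apply: gen_min; [exact: gen1| |exact: genM|exact: gen_lin].
by move=> x gx; rewrite TT'; apply: genZ; apply: genT.
Qed.

End Projections.

(** * Fixed points of an action *)

Section Fixed.
Variables (R : realType) (n : nat) (K : cqgAlg R).
Local Notation C := (R[i]).
Local Notation M := 'M[C]_n.
Variable beta : M -> 'M[K]_n.
Hypothesis ac : is_action beta.
Local Notation kappa := (cqg_antipode K).

Definition fixed_mx (x : M) : Prop := beta x = mx_tens x 1.

Lemma fixed_mx1 : fixed_mx 1%:M.
Proof. by rewrite /fixed_mx (action1 ac) mx_tens_id. Qed.

Lemma fixed_mxM x y : fixed_mx x -> fixed_mx y -> fixed_mx (x *m y).
Proof. by rewrite /fixed_mx (actionM ac) => -> ->; rewrite mx_tensM mulr1. Qed.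

Lemma fixed_mx_lin c x y : fixed_mx x -> fixed_mx y -> fixed_mx (c *: x + y).
Proof.
by rewrite /fixed_mx (action_linear ac) => -> ->; rewrite mx_tensDl mx_tensZl.
Qed.

Lemma beta_lin c x y i j : beta (c *: x + y) i j = c *: beta x i j + beta y i j.
Proof. by rewrite (action_linear ac) !mxE. Qed.

Lemma beta0 i j : beta 0 i j = 0.
Proof.
have := beta_lin (-1) 0 0 i j; rewrite scaler0 addr0 => h.
by rewrite h scaleN1r addNr.
Qed.

Lemma beta_sum I r (P : pred I) (c : I -> C) (x : I -> M) i j :
  beta (\sum_(k <- r | P k) c k *: x k) i j
  = \sum_(k <- r | P k) c k *: beta (x k) i j.
Proof.
elim: r => [|k r IH]; first by rewrite !big_nil beta0.
by rewrite !big_cons; case: ifP; rewrite // beta_lin IH.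
Qed.

Lemma beta_sum1 I r (P : pred I) (x : I -> M) i j :
  beta (\sum_(k <- r | P k) x k) i j = \sum_(k <- r | P k) beta (x k) i j.
Proof.
transitivity (beta (\sum_(k <- r | P k) 1 *: x k) i j).
  by under [in RHS]eq_bigr do rewrite scale1r.
by rewrite beta_sum; under eq_bigr do rewrite scale1r.
Qed.

Lemma beta_tr (y : M) k l :
  (y l k)%:A = \sum_i \sum_j beta y i j * beta (delta_mx k l) j i.
Proof.
have n0 : n%:R != 0 :> C by rewrite pnatr_eq0 -lt0n (leq_ltn_trans _ (ltn_ord k)).
apply: (scalerI n0); have := action_trace ac (y *m delta_mx k l).
rewrite slice_tau /tau mxtrace_Mdelta -scalerA => <-; congr (_ *: _).
by apply: eq_bigr => i _; rewrite (actionM ac) mxE.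
Qed.

(** The antipode axiom for [beta x i j], whose coproduct is given by coassociativity of the action
    and whose counit is [x i j]. *)
Lemma beta_antipode (x : M) i j :
  \sum_k \sum_l beta (delta_mx k l) i j * kappa (beta x k l) = (x i j)%:A.
Proof.
have bl : bilinear_for *:%R *:%R (fun a b : K => a * kappa b).
  split=> [u c a b|u c a b]; first by rewrite mulrDl -scalerAl.
  by rewrite linearP mulrDr -scalerAr.
have := tens_eq_bilinear bl (action_coassoc ac x i j).
rewrite (antipoder (cqg_hopf K)) big_map big_enum /=.
have -> : cqg_counit K (beta x i j) = x i j.
  by have := congr1 (fun y : M => y i j) (action_counit ac x); rewrite mxE.
by move=> ->; rewrite pair_big.
Qed.

(* Trace preservation turns the antipode into the transpose of the action. *)
Lemma antipode_transpose (x y : M) :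
  \sum_k \sum_l y l k *: kappa (beta x k l) = \sum_i \sum_j x j i *: beta y i j.
Proof.
transitivity (\sum_k \sum_l \sum_i \sum_j
    beta y i j * (beta (delta_mx k l) j i * kappa (beta x k l))).
  apply: eq_bigr => k _; apply: eq_bigr => l _.
  rewrite -[X in _ *: X = _]mul1r scalerAl beta_tr mulr_suml; apply: eq_bigr => i _.
  by rewrite mulr_suml; apply: eq_bigr => j _; rewrite mulrA.
under eq_bigr do rewrite exchange_big /=.
rewrite exchange_big; apply: eq_bigr => i _ /=.
under eq_bigr do rewrite exchange_big /=.
rewrite exchange_big; apply: eq_bigr => j _ /=.
under eq_bigr do rewrite -mulr_sumr.
by rewrite -mulr_sumr beta_antipode -scalerAr mulr1.
Qed.

Lemma antipode_delta (k b r s : 'I_n) :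
  kappa (beta (delta_mx s r) b k) = beta (delta_mx k b) r s.
Proof.
have := antipode_transpose (delta_mx s r) (delta_mx k b).
rewrite (bigD1 b) //= (bigD1 k) //= delta_mxE !eqxx mul1r scale1r.
rewrite [X in _ + X + _]big1 => [|l lk]; last first.
  by rewrite delta_mxE eq_sym (negPf lk) mul0r scale0r.
rewrite [X in _ + _ + X]big1 => [|b' bb']; last first.
  by apply: big1 => l _; rewrite delta_mxE [b == _]eq_sym (negPf bb') mulr0 scale0r.
rewrite !addr0 => ->.
rewrite (bigD1 r) //= (bigD1 s) //= delta_mxE !eqxx mul1r scale1r.
rewrite big1 => [|l lk]; last by rewrite delta_mxE [s == _]eq_sym (negPf lk) mul0r scale0r.
rewrite big1 ?addr0 // => b' bb'.
by apply: big1 => l _; rewrite delta_mxE [r == _]eq_sym (negPf bb') mulr0 scale0r.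
Qed.

(* The tensor [\sum_(b, k) e_(b, k) (x) e_(k, b)] is invariant. *)
Lemma beta_flip p q r s :
  \sum_b \sum_k beta (delta_mx b k) p q * beta (delta_mx k b) r s
  = ((p == s) && (q == r))%:R.
Proof.
under eq_bigr do under eq_bigr do rewrite -[X in _ * X]antipode_delta.
by rewrite beta_antipode mxE; case: (_ && _); rewrite ?scale1r ?scale0r.
Qed.

Section PreservedSpace.
Variables (S : {vspace M}) (P : M -> M).
Hypotheses (Ssa : self_adjoint_space S) (pP : is_proj S P).
Hypothesis Spres : preserves_space S beta.

Lemma proj_id x : x \in S -> P x = x.
Proof.
move=> xS; apply/eqP; rewrite eq_sym -subr_eq0; apply/eqP/mxtrace_adj_self0.
by apply: (proj_orth pP); rewrite rpredB // (proj_mem pP).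
Qed.

(** P is self-adjoint for the trace inner product, so it moves from z to the matrix unit that reads
    off the entry. *)
Lemma proj_coef p q z : P z p q = \tr (adjmx (P (delta_mx p q)) *m z).
Proof.
have h y x := @proj_orth _ _ _ _ pP x y.
have /eqP := h z _ (proj_mem pP (delta_mx p q)).
rewrite mulmxBr linearB /= subr_eq0 => /eqP ->.
have /eqP := h (delta_mx p q) _ (proj_mem pP z).
rewrite mulmxBr linearB /= subr_eq0 => /eqP /(congr1 conjc).
rewrite -!mxtrace_adj !adjmxM !adjmxK => <-.
by rewrite adjmx_delta mxtrace_deltaM.
Qed.

(** Split y into P y and a part u orthogonal to S. On P y the claim follows from the invariance of
    S. For u, [antipode_transpose] turns the pairing of [beta u] with an element of S into the
    antipode of a pairing of u with some [beta v], v in S; this vanishes because [beta v] has its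
    matrix legs in S. *)
Lemma amplify_proj y : amplify P (beta y) = beta (P y).
Proof.
have linP := proj_linear pP.
apply/matrixP=> p q.
have ampE z : amplify P (beta z) p q = \sum_i \sum_j P (delta_mx i j) p q *: beta z i j.
  rewrite /amplify summxE; apply: eq_bigr => i _; rewrite summxE.
  by apply: eq_bigr => j _; rewrite mxE.
have ker u : (forall x, x \in S -> \tr (adjmx x *m u) = 0) ->
    \sum_i \sum_j P (delta_mx i j) p q *: beta u i j = 0.
  move=> uS; pose v := adjmx (P (delta_mx p q)).
  have vS : v \in S by apply: Ssa; apply: proj_mem pP _.
  under eq_bigr do under eq_bigr do rewrite proj_coef mxtrace_Mdelta.
  rewrite -antipode_transpose; have [s sS ->] := Spres vS.
  under eq_bigr do under eq_bigr do rewrite -linearZ /=.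
  under eq_bigr do rewrite -linear_sum /=.
  rewrite -linear_sum /=.
  rewrite [X in kappa X](_ : _ = 0) ?linear0 //.
  under eq_bigr do under eq_bigr do rewrite summxE scaler_sumr.
  under eq_bigr do rewrite exchange_big /=.
  rewrite exchange_big big1_seq //= => -[w a] /sS /= wS.
  transitivity (\tr (u *m w) *: a); last first.
    by rewrite mxtrace_mulC -[w]adjmxK uS ?scale0r //; apply: Ssa.
  rewrite /mxtrace scaler_suml exchange_big; apply: eq_bigr => l _.
  by rewrite mxE scaler_suml; apply: eq_bigr => k _; rewrite mxE scalerA.
rewrite ampE.
have E i j : beta y i j = beta (y - P y) i j + beta (P y) i j.
  by rewrite -{1}[y](subrK (P y)) -[y - P y]scale1r beta_lin !scale1r.
under eq_bigr do under eq_bigr do rewrite E scalerDr.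
under eq_bigr do rewrite big_split /=.
rewrite big_split /= ker ?add0r; last by move=> x xS; apply: proj_orth pP _ _ xS.
have [s sS ->] := Spres (proj_mem pP y).
under eq_bigr do under eq_bigr do rewrite summxE scaler_sumr.
under eq_bigr do rewrite exchange_big /=.
rewrite exchange_big summxE; apply: eq_big_seq => -[w a] /sS /= wS.
rewrite mxE -[in RHS](proj_id wS) (linear_mxE linP) scaler_suml.
apply: eq_bigr => i _; rewrite scaler_suml; apply: eq_bigr => j _.
by rewrite mxE scalerA mulrC.
Qed.

Lemma fixed_adj_of c : fixed_mx c -> fixed_mx (adj_of P c).
Proof.
have linP := proj_linear pP.
rewrite /fixed_mx => fc; apply/matrixP=> i j.
transitivity (\sum_b \sum_k \sum_m \sum_l \sum_p \sum_q
   (P (delta_mx p q) i l * c l m) *: (beta (delta_mx b k) p q * beta (delta_mx k b) m j)).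
  rewrite /adj_of beta_sum1; apply: eq_bigr => b _.
  rewrite beta_sum1; apply: eq_bigr => k _.
  rewrite !(actionM ac) mxE; apply: eq_bigr => m _.
  rewrite mxE mulr_suml; apply: eq_bigr => l _.
  rewrite fc mxE -amplify_proj /amplify summxE !mulr_suml; apply: eq_bigr => p _.
  rewrite summxE !mulr_suml; apply: eq_bigr => q _.
  by rewrite mxE -scalerAr mulr1 scalerA -scalerAl mulrC.
(* By [beta_flip] the sum over b and k collapses to Kronecker deltas. *)
transitivity (\sum_m \sum_l \sum_p \sum_q
   (P (delta_mx p q) i l * c l m) *: ((p == j) && (q == m))%:R : K).
  under eq_bigr do rewrite exchange_big /=.
  rewrite exchange_big; apply: eq_bigr => m _ /=.
  under eq_bigr do rewrite exchange_big /=.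
  rewrite exchange_big; apply: eq_bigr => l _ /=.
  under eq_bigr do rewrite exchange_big /=.
  rewrite exchange_big; apply: eq_bigr => p _ /=.
  under eq_bigr do rewrite exchange_big /=.
  rewrite exchange_big; apply: eq_bigr => q _ /=.
  rewrite -beta_flip scaler_sumr; apply: eq_bigr => b _.
  by rewrite scaler_sumr; apply: eq_bigr => k _.
rewrite mxE adj_ofE scaler_suml; apply: eq_bigr => m _.
rewrite mxE scaler_suml; apply: eq_bigr => l _.
rewrite (bigD1 j) //= [X in _ + X]big1 => [|p pj]; last first.
  by apply: big1 => q _; rewrite (negPf pj) scaler0.
rewrite (bigD1 m) //= big1 => [|q qm]; last by rewrite (negPf qm) andbF scaler0.
by rewrite !eqxx !addr0.
Qed.

End PreservedSpace.
End Fixed.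

(** * Orthogonal families, Gram-Schmidt, and the adjacency operator in an orthogonal basis *)

Section OrthogonalFamilies.
Variables (R : realType) (n : nat).
Local Notation C := (R[i]).
Local Notation M := 'M[C]_n.

(** Not normalised: N holds the squared norms, so that explicit bases need no division by square
    roots. *)
Definition orthogonal_family k (X : k.-tuple M) (N : 'I_k -> C) : Prop :=
  (forall i, N i != 0) /\
  forall i j, \tr (adjmx (tnth X i) *m tnth X j) = (i == j)%:R * N i.

Definition family_proj k (X : k.-tuple M) (N : 'I_k -> C) (y : M) : M :=
  \sum_i (\tr (adjmx (tnth X i) *m y) / N i) *: tnth X i.

Lemma mxtrace_lin (a y z : M) c : \tr (a *m (c *: y + z)) = c * \tr (a *m y) + \tr (a *m z).
Proof. by rewrite mulmxDr -scalemxAr mxtraceD mxtraceZ. Qed.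

Lemma mxtrace_sumr (a : M) I r (P : pred I) (F : I -> M) :
  \tr (a *m \sum_(i <- r | P i) F i) = \sum_(i <- r | P i) \tr (a *m F i).
Proof. by rewrite mulmx_sumr linear_sum. Qed.

Lemma mem_span_tuple k (X : k.-tuple M) i : tnth X i \in <<X>>%VS.
Proof. by apply: memv_span; apply: mem_tnth. Qed.

Lemma span_tuple_ind k (X : k.-tuple M) (Q : M -> Prop) :
  Q 0 -> (forall c x y, Q x -> Q y -> Q (c *: x + y)) ->
  (forall i, Q (tnth X i)) -> forall x, x \in <<X>>%VS -> Q x.
Proof.
move=> Q0 QL QX x /coord_span ->.
apply: big_ind => // [a b Qa Qb|i _]; first by rewrite -[a]scale1r; apply: QL.
by rewrite -[_ *: _]addr0; apply: QL; rewrite // -tnth_nth.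
Qed.

Section Family.
Variables (k : nat) (X : k.-tuple M) (N : 'I_k -> C).
Hypothesis orthX : orthogonal_family X N.

Lemma family_proj_is_proj : is_proj <<X>>%VS (family_proj X N).
Proof.
case: orthX => N0 XX; split.
- move=> c y z; rewrite /family_proj scaler_sumr -big_split /=.
  apply: eq_bigr => i _.
  by rewrite mxtrace_lin mulrDl scalerDl scalerA mulrA.
- by move=> y; apply: rpred_sum => i _; apply: rpredZ; apply: mem_span_tuple.
- move=> x y; pose Q x := \tr (adjmx x *m (y - family_proj X N y)) = 0.
  apply: (@span_tuple_ind _ X Q).
  + by rewrite /Q adjmx0 mul0mx mxtrace0.
  + move=> c u v; rewrite /Q adjmxD adjmxZ mulmxDl -scalemxAl mxtraceD mxtraceZ.
    by move=> -> ->; rewrite mulr0 addr0.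
  + move=> i; rewrite /Q mulmxBr linearB /= mxtrace_sumr (bigD1 i) //= big1.
      by rewrite -scalemxAr mxtraceZ XX eqxx mul1r divfK // addr0 subrr.
    by move=> j ji; rewrite -scalemxAr mxtraceZ XX eq_sym (negPf ji) mul0r mulr0.
Qed.

Lemma adj_of_family_proj x :
  adj_of (family_proj X N) x = \sum_i (N i)^-1 *: (tnth X i *m x *m adjmx (tnth X i)).
Proof.
apply/matrixP=> i j; rewrite adj_ofE summxE.
under [RHS]eq_bigr do rewrite mxE mxE mulr_sumr.
rewrite exchange_big; apply: eq_bigr => l _ /=.
rewrite /family_proj mulmx_suml summxE; apply: eq_bigr => t _.
by rewrite -scalemxAl mxE mxtrace_Mdelta [LHS]mulrC mulrA [LHS]mulrC.
Qed.

Lemma orthogonal_free : free X.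
Proof.
apply/freeP=> c c0 i; case: orthX => N0 XX.
have := congr1 (fun y => \tr (adjmx (tnth X i) *m y)) c0.
rewrite mulmx0 mxtrace0 mxtrace_sumr (bigD1 i) //= big1 => [|j ji].
  rewrite -scalemxAr mxtraceZ -tnth_nth XX eqxx mul1r addr0 => /eqP.
  by rewrite mulf_eq0 (negPf (N0 i)) orbF => /eqP.
by rewrite -scalemxAr mxtraceZ -tnth_nth XX eq_sym (negPf ji) mul0r mulr0.
Qed.

End Family.

Definition orthonormal_tuple k (X : k.-tuple M) : Prop :=
  forall i j, mx_inner (tnth X i) (tnth X j) = (i == j)%:R.

Lemma orthonormal_family k (X : k.-tuple M) : (0 < n)%N ->
  orthonormal_tuple X -> orthogonal_family X (fun=> n%:R).
Proof.
move=> n0 oX; split=> [_|i j]; first by rewrite pnatr_eq0 -lt0n.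
by rewrite -oX /mx_inner mulrC mulVKf // pnatr_eq0 -lt0n.
Qed.

Lemma mx_inner_norm (x : M) : x != 0 -> 0 < mx_inner x x.
Proof.
move=> x0; have n0 : (0 < n)%N.
  by apply: contraNltn x0; rewrite leqn0 => /eqP E; apply/eqP/matrixP => -[i lt_i]; exfalso; rewrite E in lt_i.
rewrite mulr_gt0 ?invr_gt0 ?ltr0n // lt_def; apply/andP; split.
  by apply: contraNneq x0 => /mxtrace_adj_self0 ->.
apply: sumr_ge0 => i _; rewrite mxE; apply: sumr_ge0 => j _.
by rewrite adjmxE mulrC; apply: mul_conjC_ge0.
Qed.

Lemma mx_inner_scale c (x : M) : mx_inner (c *: x) (c *: x) = (c^*)%C * c * mx_inner x x.
Proof.
rewrite /mx_inner adjmxZ -scalemxAl -scalemxAr !mxtraceZ; set t := \tr _.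
by rewrite [_ * (c * t)]mulrA mulrCA.
Qed.

Lemma mx_inner_conj (x y : M) : mx_inner y x = ((mx_inner x y)^*)%C.
Proof.
rewrite /mx_inner rmorphM /= -mxtrace_adj adjmxM adjmxK; congr (_ * _).
by rewrite fmorphV rmorph_nat.
Qed.

(** Gram-Schmidt by induction on the dimension: the head of a basis, minus its projection onto the
    span of the tail, is non-zero by freeness and gets normalised. *)
Lemma orthonormal_basis_dim k (S : {vspace M}) : (0 < n)%N -> \dim S = k ->
  exists X : k.-tuple M, basis_of S X /\ orthonormal_tuple X.
Proof.
move=> n0; elim: k S => [|k IH] S dS.
  exists [tuple]; split; last by case.
  by rewrite basisEdim dS /= andbT; move/eqP: dS; rewrite dimv_eq0 => /eqP ->; exact: sub0v.
have [v [s [sz bS]]] : exists v s, size s = k /\ basis_of S (v :: s).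
  have := vbasisP S; move: (vbasis S); rewrite dS => X.
  by case/tupleP: X => v s bS; exists v, s; rewrite size_tuple.
have fvs := basis_free bS.
have [X' [bX' oX']] : exists X : k.-tuple M, basis_of <<s>>%VS X /\ orthonormal_tuple X.
  apply: IH; rewrite -sz; apply/eqP; rewrite -/(free s).
  by move: fvs; rewrite free_cons => /andP[].
have sS x : x \in <<s>>%VS -> x \in S.
  by move=> xs; rewrite -(span_basis bS) span_cons -[x]add0r memv_add ?mem0v.
have orthX' := orthonormal_family n0 oX'.
have prj := family_proj_is_proj orthX'; rewrite (span_basis bX') in prj.
set P := family_proj _ _ in prj.
pose w := v - P v.
have vS : v \in S by apply: (basis_mem bS); rewrite mem_head.
have wS : w \in S by rewrite rpredB // sS // (proj_mem prj).
have w0 : w != 0.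
  apply: contraTneq fvs => /eqP; rewrite subr_eq0 free_cons => /eqP E.
  by rewrite negb_and negbK E (proj_mem prj).
have wp := mx_inner_norm w0.
pose c := (sqrtC (mx_inner w w))^-1.
have c0 : 0 < c by rewrite invr_gt0 sqrtC_gt0.
have oX : orthonormal_tuple [tuple of c *: w :: X'].
  have Xw j : mx_inner (tnth X' j) (c *: w) = 0.
    rewrite /mx_inner -scalemxAr mxtraceZ (proj_orth prj) ?mulr0 //.
    by rewrite -(span_basis bX') mem_span_tuple.
  move=> i j; case: (unliftP ord0 i) => [i'|] ->; case: (unliftP ord0 j) => [j'|] ->.
  - by rewrite !tnthS oX' (inj_eq lift_inj).
  - by rewrite tnthS tnth0 Xw eq_sym (negPf (neq_lift _ _)).
  - by rewrite tnthS tnth0 mx_inner_conj Xw conjc0 (negPf (neq_lift _ _)).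
  - rewrite tnth0 mx_inner_scale eqxx; have -> : c^* = c := geC0_conj (ltW c0).
    by rewrite -expr2 exprVn sqrtCK mulVf // gt_eqF.
exists [tuple of c *: w :: X']; split=> //.
rewrite basisEfree (orthogonal_free (orthonormal_family n0 oX)) /= size_tuple dS leqnn andbT.
rewrite span_cons subv_add (span_basis bX'); apply/andP; split.
  by rewrite -memvE rpredZ.
by apply/subvP.
Qed.

Lemma orthonormal_basis (S : {vspace M}) : (0 < n)%N ->
  exists X : (\dim S).-tuple M, basis_of S X /\ orthonormal_tuple X.
Proof. by move=> n0; apply: orthonormal_basis_dim. Qed.

Lemma orthonormal_basis_proj (S : {vspace M}) k (X : k.-tuple M) : (0 < n)%N ->
  basis_of S X -> orthonormal_tuple X -> is_proj S (family_proj X (fun=> n%:R)).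
Proof.
move=> n0 bX oX; have := family_proj_is_proj (orthonormal_family n0 oX).
by rewrite (span_basis bX).
Qed.

Lemma adj_of_ext (P P' : M -> M) : P =1 P' -> adj_of P =1 adj_of P'.
Proof.
by move=> PP x; apply: eq_bigr => b _; apply: eq_bigr => k _; rewrite PP.
Qed.

Lemma proj_exists (S : {vspace M}) : (0 < n)%N -> exists P, is_proj S P.
Proof.
move=> n0; have [X [bX oX]] := orthonormal_basis S n0.
by exists (family_proj X (fun=> n%:R)); apply: orthonormal_basis_proj.
Qed.

Lemma orthonormal_adj_of (S : {vspace M}) k (X : k.-tuple M) P : (0 < n)%N ->
  basis_of S X -> orthonormal_tuple X -> is_proj S P ->
  forall x, \sum_i tnth X i *m x *m adjmx (tnth X i) = n%:R *: adj_of P x.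
Proof.
move=> n0 bX oX pP x.
rewrite (adj_of_ext (proj_uniq pP (orthonormal_basis_proj n0 bX oX))).
rewrite adj_of_family_proj -scaler_sumr scalerA mulfV.
  by rewrite scale1r.
by rewrite pnatr_eq0 -lt0n.
Qed.

Lemma quantum_adjacency_exists (S : {vspace M}) : (0 < n)%N ->
  exists A, is_quantum_adjacency S A.
Proof.
move=> n0; have [X [bX oX]] := orthonormal_basis S n0.
by exists (fun x => \sum_i tnth X i *m x *m adjmx (tnth X i)), X.
Qed.

Lemma quantum_adjacency_adj_of (S : {vspace M}) A P : (0 < n)%N ->
  is_quantum_adjacency S A -> is_proj S P -> forall x, A x = n%:R *: adj_of P x.
Proof.
move=> n0 [X [bX oX AX]] pP x.
by rewrite AX (orthonormal_adj_of n0 bX oX pP).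
Qed.

End OrthogonalFamilies.

(** * Triviality from rigidity *)

Section Rigid.
Variables (R : realType) (n : nat).
Local Notation C := (R[i]).
Local Notation M := 'M[C]_n.
Implicit Types K : cqgAlg R.

Lemma amplifyE K (A : M -> M) (y : 'M[K]_n) p q :
  amplify A y p q = \sum_i \sum_j A (delta_mx i j) p q *: y i j.
Proof.
rewrite /amplify summxE; apply: eq_bigr => i _; rewrite summxE.
by apply: eq_bigr => j _; rewrite mxE.
Qed.

Lemma amplify_tens K (A : M -> M) (x : M) (a : K) :
  linear A -> amplify A (mx_tens x a) = mx_tens (A x) a.
Proof.
move=> linA; apply/matrixP=> p q; rewrite amplifyE mxE (linear_mxE linA) scaler_suml.
apply: eq_bigr => i _; rewrite scaler_suml; apply: eq_bigr => j _.
by rewrite mxE scalerA mulrC.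
Qed.

Lemma amplifyD K (A : M -> M) (y z : 'M[K]_n) :
  amplify A (y + z) = amplify A y + amplify A z.
Proof.
apply/matrixP=> p q; rewrite mxE !amplifyE -big_split; apply: eq_bigr => i _ /=.
by rewrite -big_split; apply: eq_bigr => j _ /=; rewrite mxE scalerDr.
Qed.

Lemma adj_of_linear (P : M -> M) : linear (adj_of P).
Proof.
move=> c x y; rewrite /adj_of scaler_sumr -big_split; apply: eq_bigr => b _ /=.
rewrite scaler_sumr -big_split; apply: eq_bigr => k _ /=.
by rewrite mulmxDr mulmxDl -scalemxAr -scalemxAl.
Qed.

Lemma quantum_adjacency_linear (S : {vspace M}) A : (0 < n)%N ->
  is_quantum_adjacency S A -> linear A.
Proof.
move=> n0 Aadj c x y; have [P pP] := proj_exists S n0.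
by rewrite !(quantum_adjacency_adj_of n0 Aadj pP) adj_of_linear scalerDr !scalerA mulrC.
Qed.

Lemma preserves_space_ext (S : {vspace M}) K (b c : M -> 'M[K]_n) :
  b =1 c -> preserves_space S b -> preserves_space S c.
Proof. by move=> bc h x xS; have [s sS e] := h x xS; exists s; rewrite // -bc. Qed.

Lemma preserves_adjacency_ext A K (b c : M -> 'M[K]_n) :
  b =1 c -> preserves_adjacency A b -> preserves_adjacency A c.
Proof. by move=> bc h x; rewrite -!bc. Qed.

Lemma Qut_trivial_of_gen (Q : cqgAlg R) (alpha : M -> 'M[Q]_n) (S : {vspace M}) P :
  (0 < n)%N -> is_Qut alpha -> self_adjoint_space S -> is_proj S P ->
  (forall x, gen (adj_of P) x) ->
  Qut_system_trivial alpha S /\ Qut_graph_trivial alpha S.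
Proof.
move=> n0 hQ Ssa pP gP.
have fixed_all K (beta : M -> 'M[K]_n) : is_action beta ->
    (forall x, fixed_mx beta x -> fixed_mx beta (adj_of P x)) ->
    forall x, beta x = mx_tens x 1.
  move=> ac fadj x; apply: (gen_min (F := fixed_mx beta)) (gP x) => //.
  - exact: fixed_mx1.
  - exact: fixed_mxM.
  - exact: fixed_mx_lin.
split.
- apply: largest_trivial => //.
  + exact: preserves_space_ext.
  + move=> x xS; exists [:: (x, 1)]; last by rewrite big_seq1.
    by move=> p; rewrite inE => /eqP ->.
  + move=> K beta ac pres; apply: fixed_all => // x.
    exact: (fixed_adj_of ac Ssa pP pres).
- have [A Aadj] := quantum_adjacency_exists S n0.
  have linA := quantum_adjacency_linear n0 Aadj.
  exists A => //; apply: largest_trivial => //.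
  + exact: preserves_adjacency_ext.
  + by move=> x; rewrite amplify_tens.
  + move=> K beta ac pres; apply: fixed_all => // x fx.
    have -> : adj_of P x = n%:R^-1 *: A x + 0.
      rewrite addr0 (quantum_adjacency_adj_of n0 Aadj pP) scalerA mulVf ?scale1r //.
      by rewrite pnatr_eq0 -lt0n.
    apply: fixed_mx_lin => //; first by rewrite /fixed_mx pres fx amplify_tens.
    by apply/matrixP=> i j; rewrite (beta0 ac) !mxE scale0r.
Qed.

End Rigid.

(** * The group with two elements and its actions by conjugation *)

(* The function algebra of the group with two elements, in terms of the
   indicators [e] of its points and the values [c]. *)
Section TwoPoints.
Variable R : realType.
Local Notation C := (R[i]).
Variables (H : algType C) (star : H -> H) (e : bool -> H) (c : bool -> H -> C).
Variables (counit : {lrmorphism H -> C^o}).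
Hypothesis decomp : forall a, a = c false a *: e false + c true a *: e true.
Hypothesis eM : forall x y, e x * e y = if x == y then e x else 0.
Hypothesis c_lin : forall b k x y, c b (k *: x + y) = k * c b x + c b y.
Hypothesis cM : forall b x y, c b (x * y) = c b x * c b y.
Hypothesis c1 : forall b, c b 1 = 1.
Hypothesis c_e : forall x y, c x (e y) = (x == y)%:R.
Hypothesis star_ax : is_star star.
Hypothesis star_e : forall b, star (e b) = e b.
Hypothesis c_star : forall b a, c b (star a) = ((c b a)^*)%C.
Hypothesis counitE : forall a, counit a = c false a.

(** The function (g, h) |-> a(gh), with [false] as the neutral element: [c false a] sits on the
    pairs with g = h, [c true a] on the others. *)
Definition Z2_comul (a : H) : seq (H * H) :=
  [:: (c false a *: e false, e false); (c false a *: e true, e true);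
      (c true a *: e false, e true); (c true a *: e true, e false)].

Lemma Z2_sum (V : nmodType) (F : H -> H -> V) (a : H) :
  \sum_(p <- Z2_comul a) F p.1 p.2 =
  F (c false a *: e false) (e false) + F (c false a *: e true) (e true) +
  F (c true a *: e false) (e true) + F (c true a *: e true) (e false).
Proof. by rewrite !big_cons big_nil addr0 !addrA. Qed.

Lemma Z2_comul_sum (V : lmodType C) (f : {bilinear H -> H -> V}) (a : H) :
  \sum_(p <- Z2_comul a) f p.1 p.2 =
  c false a *: (f (e false) (e false) + f (e true) (e true)) +
  c true a *: (f (e false) (e true) + f (e true) (e false)).
Proof. by rewrite Z2_sum !linearZl_LR !scalerDr !addrA. Qed.

Lemma Z2_cZ b k x : c b (k *: x) = k * c b x.
Proof.
have c0 : c b 0 = 0.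
  by have := c_lin b (-1) 0 0; rewrite scaler0 addr0 mulN1r addNr.
by rewrite -[k *: x]addr0 c_lin c0 addr0.
Qed.

Lemma Z2_starZ k x : star (k *: x) = (k^*)%C *: star x.
Proof.
have s0 : star 0 = 0.
  have := star_semilinear star_ax (-1) 0 0.
  by rewrite scaler0 addr0 rmorphN1 scaleN1r addNr.
by rewrite -[k *: x]addr0 (star_semilinear star_ax) s0 addr0.
Qed.

Lemma Z2_e1 : e false + e true = 1.
Proof. by rewrite [RHS]decomp !c1 !scale1r. Qed.

(** The antipode is the identity because each element of the group is its own inverse. *)
Lemma Z2_is_hopf : is_hopf_star star Z2_comul counit (idfun : {linear H -> H}).
Proof.
have sumE a : a = c false a *: e false + c true a *: e true by exact: decomp.
split=> //.
- move=> k a b V f; rewrite big_cat big_map /= Z2_comul_sum.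
  under eq_bigr do rewrite linearZl_LR.
  rewrite -scaler_sumr !Z2_comul_sum !c_lin; move: (f _ _ + f _ _) (f _ _ + f _ _) => U W.
  by rewrite !scalerDl scalerDr !scalerA addrACA.
- move=> V f; rewrite big_seq1 Z2_comul_sum /= !c1 !scale1r -Z2_e1 linearDl !linearDr /=.
  by rewrite addrACA [f (e true) _ + _]addrC.
- move=> a b V f; rewrite Z2_comul_sum.
  transitivity (\sum_(p <- Z2_comul a) \sum_(q <- Z2_comul b) f (p.1 * q.1) (p.2 * q.2));
    last by rewrite big_allpairs_dep.
  rewrite (Z2_sum (fun x y => \sum_(q <- Z2_comul b) f (x * q.1) (y * q.2))).
  rewrite !(Z2_sum (fun z t => f (_ * z) (_ * t))).
  rewrite -!scalerAl -!scalerAr !eM /= !scaler0 !linear0r !linear0l !addr0 !add0r.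
  rewrite !linearZl_LR !cM.
  by rewrite !scalerDr !scalerA !addrA.
- move=> a V f; rewrite big_map.
  rewrite (Z2_sum (fun x y => f (star x) (star y))) Z2_comul_sum !c_star.
  by rewrite !Z2_starZ !star_e !linearZl_LR !scalerDr !addrA.
- move=> a V f [fl1 fl2 fl3].
  have f0 y z : f 0 y z = 0.
    by have := fl1 y z (-1) 0 0; rewrite scaler0 addr0 scaleN1r addNr.
  have f0' x z : f x 0 z = 0.
    by have := fl2 x z (-1) 0 0; rewrite scaler0 addr0 scaleN1r addNr.
  have fZ k x y z : f (k *: x) y z = k *: f x y z.
    by rewrite -[k *: x]addr0 fl1 f0 addr0.
  have fZ' k x y z : f x (k *: y) z = k *: f x y z.
    by rewrite -[k *: y]addr0 fl2 f0' addr0.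
  rewrite !big_allpairs_dep /=.
  transitivity (\sum_(p <- Z2_comul a) \sum_(q <- Z2_comul p.1) f q.1 q.2 p.2) => //.
  transitivity (\sum_(p <- Z2_comul a) \sum_(q <- Z2_comul p.2) f p.1 q.1 q.2) => //.
  rewrite (Z2_sum (fun x y => \sum_(q <- Z2_comul x) f q.1 q.2 y)).
  rewrite (Z2_sum (fun x y => \sum_(q <- Z2_comul y) f x q.1 q.2)).
  rewrite !(Z2_sum (fun z t => f z t _)) !(Z2_sum (fun z t => f _ z t)).
  rewrite !Z2_cZ !c_e /= ?mulr1 ?mulr0 !fZ' !fZ !scale0r !scale1r !addr0 !add0r.
  by rewrite [LHS](AC (2*2*2*2) ((1*3)*(4*2)*(5*7)*(8*6))).
- move=> a; rewrite (Z2_sum (fun x y => counit x *: y)) !counitE !Z2_cZ !c_e /=.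
  by rewrite !mulr1 !mulr0 !scale0r !addr0 -sumE.
- move=> a; rewrite (Z2_sum (fun x y => counit y *: x)) !counitE !c_e /=.
  by rewrite !scale0r !scale1r !addr0 -sumE.
- move=> a; rewrite (Z2_sum (fun x y => x * y)) -!scalerAl !eM /= counitE.
  by rewrite !scaler0 !addr0 -scalerDr Z2_e1.
- move=> a; rewrite (Z2_sum (fun x y => x * y)) -!scalerAl !eM /= counitE.
  by rewrite !scaler0 !addr0 -scalerDr Z2_e1.
Qed.

Lemma Z2_span : spanned_by_unitary_coeffs star Z2_comul counit.
Proof.
(* The two characters of the group; they are one-dimensional unitary corepresentations and span the
   functions. *)
pose u (b : bool) : H := e false + (-1) ^+ b *: e true.
have cu b x : c x (u b) = if x then (-1) ^+ b else 1.
  by rewrite /u addrC c_lin !c_e; case: x; rewrite /= ?mulr1 ?mulr0 ?addr0 ?add0r.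
have su b : star (u b) = u b.
  by rewrite /u addrC (star_semilinear star_ax) !star_e rmorphXn rmorphN1 addrC.
have uu b : u b * u b = 1.
  rewrite [LHS]decomp !cM !cu -Z2_e1 mulr1 -signr_addb addbb expr0.
  by rewrite !scale1r.
have cor b : is_unitary_corep star Z2_comul counit (const_mx (u b) : 'M_1).
  split.
  - move=> i j V f; rewrite big_map big_enum big_ord1 !mxE Z2_comul_sum !cu.
    rewrite /u linearDl !linearDr /= !linearZl_LR !linearZr_LR /= scale1r.
    rewrite scalerA -signr_addb addbb expr0 scale1r scalerDr addrACA.
    by rewrite [X in _ + X]addrC addrACA [X in _ + X]addrC.
  - by move=> i j; rewrite mxE !ord1 counitE cu eqxx.
  - by apply/matrixP=> i j; rewrite !ord1 mxE big_ord1 !mxE su uu.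
  - by apply/matrixP=> i j; rewrite !ord1 mxE big_ord1 !mxE su uu.
move=> a; pose x := c false a; pose y := c true a.
exists [:: ((x + y) / 2%:R, u false); ((x - y) / 2%:R, u true)].
  move=> p; rewrite !inE => /orP[] /eqP -> /=.
  - by exists 1%N, (const_mx (u false)), ord0, ord0; rewrite mxE.
  - by exists 1%N, (const_mx (u true)), ord0, ord0; rewrite mxE.
rewrite !big_cons big_nil /= addr0 /u !scalerDr addrACA -(scalerDl (e false)) !scalerA -(scalerDl (e true)).
rewrite [LHS]decomp -/x -/y expr0 expr1 mulr1 mulrN1; congr (_ *: _ + _ *: _).
- by rewrite -mulrDl addrACA subrr addr0 -mulr2n -(mulr_natr x) mulfK // pnatr_eq0.
- by rewrite -mulrBl opprD opprK addrACA subrr add0r -mulr2n -(mulr_natr y) mulfK // pnatr_eq0.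
Qed.
End TwoPoints.

Lemma Z2_cqg_exists (R : realType) : exists (K : cqgAlg R) (e : bool -> K) (c : bool -> K -> R[i]),
  [/\ (forall x y, e x * e y = if x == y then e x else 0) /\ e false + e true = 1,
      forall b, cqg_star (e b) = e b,
      forall b k x y, c b (k *: x + y) = k * c b x + c b y,
      (forall x y, c x (e y) = (x == y)%:R) /\
      forall a, a = c false a *: e false + c true a *: e true
    & (forall a, cqg_counit K a = c false a) /\
      forall a (V : lmodType R[i]) (f : {bilinear K -> K -> V}),
        \sum_(p <- cqg_comul a) f p.1 p.2 =
        c false a *: (f (e false) (e false) + f (e true) (e true)) +
        c true a *: (f (e false) (e true) + f (e true) (e false))].
Proof.
pose C := R[i]; pose H : algType C := (C^o * C^o)%type.
pose e (b : bool) : H := if b then (0, 1) else (1, 0).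
pose c (b : bool) (a : H) : C := if b then a.2 else a.1.
pose star (a : H) : H := (((a.1 : C)^*)%C, ((a.2 : C)^*)%C).
pose counit : {lrmorphism H -> C^o} := fst.
have decomp a : a = c false a *: e false + c true a *: e true.
  case: a => x y; congr pair.
    by change (x = x * 1 + y * 0 :> C); rewrite mulr1 mulr0 addr0.
  by change (y = x * 0 + y * 1 :> C); rewrite mulr1 mulr0 add0r.
have eM x y : e x * e y = if x == y then e x else 0.
  by case: x; case: y; congr pair; rewrite /= ?mulr0 ?mul0r ?mulr1.
have c_lin b k x y : c b (k *: x + y) = k * c b x + c b y by case: b.
have cM b x y : c b (x * y) = c b x * c b y by case: b.
have c1 b : c b 1 = 1 by case: b.
have c_e x y : c x (e y) = (x == y)%:R by case: x; case: y; exact: erefl.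
have star_ax : is_star star.
  split.
  - by case=> x y; congr pair; exact: conjcK.
  - move=> k [x y] [z t]; rewrite /star; congr pair;
    exact: (etrans (rmorphD _ _ _) (congr1 (+%R^~ _) (rmorphM _ _ _))).
  - case=> x y [z t]; rewrite /star; congr pair;
    exact: (etrans (rmorphM _ _ _) (mulrC _ _)).
have star_e b : star (e b) = e b.
  by case: b; congr pair; (exact: conjc0 || exact: conjc1).
have c_star b a : c b (star a) = ((c b a)^*)%C by case: b.
have counitE a : counit a = c false a by [].
pose K : cqgAlg R := CQGAlg
  (Z2_is_hopf decomp eM c_lin cM c1 c_e star_ax star_e c_star counitE)
  (Z2_span decomp c_lin cM c1 c_e star_ax star_e counitE).
exists K, e, c; split=> //.
- split=> //; exact: (Z2_e1 decomp c1).
- by split=> // a V f; apply: Z2_comul_sum.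
Qed.

(** * Conjugation by a self-adjoint unitary as an action of the group with two elements *)

Section Conjugation.
Variables (R : realType) (n : nat).
Local Notation C := (R[i]).
Local Notation M := 'M[C]_n.
Variable u : M.
Hypotheses (u_sa : adjmx u = u) (uu : u *m u = 1%:M).

Lemma conj_conj x : u *m (u *m x *m u) *m u = x.
Proof. by rewrite !mulmxA uu mul1mx -mulmxA uu mulmx1. Qed.

Lemma conjM x y : (u *m x *m u) *m (u *m y *m u) = u *m (x *m y) *m u.
Proof. by rewrite !mulmxA -(mulmxA _ u u) uu mulmx1. Qed.

Lemma conj_delta_sum (x : M) i j :
  \sum_k \sum_l (u *m delta_mx k l *m u) i j * x k l = (u *m x *m u) i j.
Proof.
have L : linear (fun x : M => u *m x *m u).
  by move=> a y z; rewrite mulmxDr mulmxDl -scalemxAr -scalemxAl.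
rewrite (linear_mxE L); apply: eq_bigr => k _; apply: eq_bigr => l _.
by rewrite mulrC.
Qed.

Lemma id_delta_sum (x : M) i j : \sum_k \sum_l (delta_mx k l : M) i j * x k l = x i j.
Proof.
have L : linear (fun x : M => x) by [].
rewrite [RHS](linear_mxE L); apply: eq_bigr => k _; apply: eq_bigr => l _.
by rewrite mulrC.
Qed.

(** Conjugating P by u gives another orthogonal projection onto S, which must be P. *)
Lemma conj_proj (S : {vspace M}) P : is_proj S P ->
  (forall x, x \in S -> u *m x *m u \in S) ->
  forall x, P (u *m x *m u) = u *m P x *m u.
Proof.
move=> pP uS.
have pP' : is_proj S (fun x => u *m P (u *m x *m u) *m u).
  split.
  - move=> c x y; rewrite mulmxDr mulmxDl -scalemxAr -scalemxAl (proj_linear pP).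
    by rewrite mulmxDr mulmxDl -scalemxAr -scalemxAl.
  - by move=> y; apply: uS; apply: proj_mem pP _.
  - move=> x y xS; have := proj_orth pP (u *m y *m u) (uS x xS).
    rewrite !adjmxM u_sa => <-; rewrite -[in RHS]mulmxA [RHS]mxtrace_mulC.
    congr (\tr _).
    rewrite !mulmxBr !mulmxBl !mulmxA -!(mulmxA _ u u) uu !mulmx1.
    by [].
by move=> x; rewrite (proj_uniq pP pP') conj_conj.
Qed.

Lemma conj_deltaE (i j k l : 'I_n) : (u *m delta_mx i j *m u) k l = u k i * u j l.
Proof.
rewrite mxE (bigD1 j) //= big1 => [|m mj]; rewrite mulmx_deltaE ?eqxx ?mulr1 ?addr0 //.
by rewrite eq_sym (negPf mj) mulr0 mul0r.
Qed.

Lemma conj_adj_of P : linear P -> (forall x, P (u *m x *m u) = u *m P x *m u) ->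
  forall x, adj_of P (u *m x *m u) = u *m adj_of P x *m u.
Proof.
move=> linP uP x; set y := u *m x *m u.
(* The tensor of all e_bk (x) e_kb is invariant under simultaneous conjugation by u, so the matrix
   units in [adj_of] may be replaced by their conjugates. *)
transitivity (\sum_b \sum_k P (u *m delta_mx b k *m u) *m y *m (u *m delta_mx k b *m u)); last first.
  rewrite /adj_of mulmx_sumr mulmx_suml; apply: eq_bigr => b _.
  rewrite mulmx_sumr mulmx_suml; apply: eq_bigr => k _.
  by rewrite uP /y !conjM.
apply/matrixP=> i j; rewrite adj_ofE summxE.
under [RHS]eq_bigr do rewrite summxE.
have L : linear (fun z => P (u *m z *m u) *m y).
  move=> a z w; rewrite mulmxDr mulmxDl -scalemxAr -scalemxAl linP.
  by rewrite mulmxDl -scalemxAl.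
transitivity (\sum_l \sum_b \sum_k
    (u *m delta_mx j l *m u) b k * (P (u *m delta_mx b k *m u) *m y) i l).
  apply: eq_bigr => l _; rewrite -(linear_mxE L) conj_conj //.
rewrite exchange_big; apply: eq_bigr => b _ /=.
rewrite exchange_big; apply: eq_bigr => k _ /=.
rewrite [RHS]mxE; apply: eq_bigr => l _.
by rewrite !conj_deltaE mulrC [u b j * _]mulrC.
Qed.

(** With the two indicators for [e0] and [e1], the formula in the last hypothesis is the action of
    the two-element group by u. It makes K a quantum subgroup satisfying P, whose quotient map would
    factor through the scalars, although [e false] is not a scalar. *)
Lemma Ad_not_trivial (Q : cqgAlg R) (alpha : M -> 'M[Q]_n)
    (P : forall K : cqgAlg R, (M -> 'M[K]_n) -> Prop) :
  is_Qut alpha -> (exists x, u *m x *m u != x) ->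
  (forall (K : cqgAlg R) (b c : M -> 'M[K]_n), b =1 c -> P K b -> P K c) ->
  (forall (K : cqgAlg R) (e0 e1 : K),
     P K (fun x => mx_tens x e0 + mx_tens (u *m x *m u) e1)) ->
  ~ exists (H : cqgAlg R) (pi : {lrmorphism Q -> H}),
    largest_quantum_subgroup alpha P pi /\ cqg_trivial H.
Proof.
move=> [ac univ] [x0 ux0] Pext PC [H [pi [[_ _ largest] triv]]].
have [K [e [c [[eM e1] star_e c_lin [c_e decomp] [counitE comulE]]]]] := Z2_cqg_exists R.
pose beta (x : M) : 'M[K]_n := mx_tens x (e false) + mx_tens (u *m x *m u) (e true).
have betaE x i j : beta x i j = x i j *: e false + (u *m x *m u) i j *: e true.
  by rewrite !mxE.
have c0 b : c b 0 = 0.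
  by have := c_lin b (-1) 0 0; rewrite scaler0 addr0 mulN1r addNr.
have c_comb b (k l : C) : c b (k *: e false + l *: e true) = if b then l else k.
  rewrite c_lin -[l *: _]addr0 c_lin c0 !c_e.
  by case: b; rewrite /= ?mulr1 ?mulr0 ?addr0 ?add0r.
have act : is_action beta.
  split.
  - move=> k x y; rewrite /beta mulmxDr mulmxDl -scalemxAr -scalemxAl !mx_tensDl !mx_tensZl.
    by rewrite addrACA; congr (_ + _); apply/matrixP=> i j; rewrite !mxE scalerDr.
  - rewrite /beta mulmx1 uu; apply/matrixP=> i j; rewrite !mxE -scalerDr e1.
    by case: eqP => _; rewrite ?scale1r ?scale0r.
  - move=> x y; rewrite /beta mulmxDr !mulmxDl !mx_tensM !eM /= conjM.
    have t0 z : mx_tens z (0 : K) = 0 by apply/matrixP=> i j; rewrite !mxE scaler0.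
    by rewrite !t0 addr0 add0r.
  - move=> x; apply/matrixP=> i j; rewrite [RHS]mxE !betaE.
    rewrite (star_semilinear (hopf_star_star (cqg_hopf K))) cqg_starZ !star_e.
    rewrite -[u *m adjmx x *m u](_ : adjmx (u *m x *m u) = _) ?adjmxE //.
    by rewrite !adjmxM u_sa mulmxA.
  - move=> x i j V f; rewrite comulE big_map big_enum /= !betaE !c_comb.
    rewrite -(pair_big xpredT xpredT (fun k l => f (beta (delta_mx k l) i j) (beta x k l))) /=.
    under eq_bigr do under eq_bigr do rewrite !betaE linearDl !linearDr /=
       !linearZl_LR !linearZr_LR /= !scalerA.
    under eq_bigr do rewrite !big_split /= -!scaler_suml.
    rewrite !big_split /= -!scaler_suml !id_delta_sum !conj_delta_sum conj_conj.
    by rewrite !scalerDr [LHS](AC (2*2) ((1*3)*(4*2))).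
  - by move=> x; apply/matrixP=> i j; rewrite mxE betaE counitE c_comb.
  - move=> x; rewrite slice_tau /tau -scalerA; congr (_ *: _).
    under eq_bigr do rewrite betaE.
    rewrite big_split /= -!scaler_suml.
    have -> : \sum_i (u *m x *m u) i i = \tr x.
      by rewrite -/(\tr (u *m x *m u)) mxtrace_mulC mulmxA uu mul1mx.
    by rewrite -/(\tr x) -scalerDr e1.
have [rho [rhom rhoE _]] := univ _ _ act.
have [i [j ij]] : exists i j, x0 i j != (u *m x0 *m u) i j.
  have : ~~ [forall i, forall j, x0 i j == (u *m x0 *m u) i j].
    apply: contra ux0 => /forallP h; apply/eqP/matrixP=> i j.
    by apply/esym/eqP; have /forallP := h i; apply.
  rewrite negb_forall; move/existsP => [i' ]; rewrite negb_forall; move/existsP => [j ij].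
  by exists i', j.
have surj : quantum_subgroup rho.
  (* At an entry where [x0] and its conjugate differ, the action yields an element with distinct
     values at the two points; together with 1 it spans K. *)
  split=> // b; set s := x0 i j in ij; set t := (u *m x0 *m u) i j in ij.
  have rx : rho (alpha x0 i j) = s *: e false + t *: e true.
    by rewrite -betaE -rhoE mxE.
  have st0 : s - t != 0 by rewrite subr_eq0.
  pose k := (c false b - c true b) / (s - t).
  exists (k *: alpha x0 i j + (c true b - k * t) *: 1).
  rewrite linearP linearZ /= rmorph1 rx -e1 !scalerDr addrACA !scalerA -!scalerDl.
  rewrite [RHS]decomp; congr (_ *: _ + _ *: _); last by rewrite addrC subrK.
  by rewrite addrCA -mulrBr divfK // addrC subrK.
have := largest K rho surj; case.
  by apply: Pext (PC K (e false) (e true)) => x; rewrite rhoE.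
move=> g gm gE; have [b bE] := surj.2 (e false).
have [k kE] := triv (pi b).
have : e false = k *: e false + k *: e true.
  by rewrite -scalerDr e1 -bE gE kE linearZ rmorph1.
move=> E; have := congr1 (c false) E; have := congr1 (c true) E.
by rewrite !c_comb !c_e /= => <- /eqP; rewrite oner_eq0.
Qed.

End Conjugation.

(** * Dimensions without rigid systems *)

Section Flexible.
Variables (R : realType) (n : nat).
Local Notation C := (R[i]).
Local Notation M := 'M[C]_n.

Lemma normal_diagonalization (Y : M) : Y *m adjmx Y = adjmx Y *m Y ->
  exists (P : M) (l : 'rV[C]_n), P *m adjmx P = 1%:M /\ Y = adjmx P *m diag_mx l *m P.
Proof.
move=> normY; have adjE (x : M) : map_mx Num.conj x^T = adjmx x.
  by apply/matrixP=> i j; rewrite !mxE.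
have /orthomx_spectralP YE : Y \is normalmx by apply/normalmxP; rewrite adjE.
have uP := spectral_unitarymx Y.
exists (spectralmx Y), (spectral_diag Y); split.
  by rewrite -adjE; apply/unitarymxP.
by rewrite [LHS]YE (invmx_unitary uP) adjE.
Qed.

Lemma normal_commuting_involution (Y : M) : (1 < n)%N ->
  Y *m adjmx Y = adjmx Y *m Y ->
  exists u : M, [/\ adjmx u = u, u *m u = 1%:M, u *m Y = Y *m u
                  & exists x, u *m x *m u != x].
Proof.
move=> n1 /normal_diagonalization[P [lam [PP YE]]].
have PP' : adjmx P *m P = 1%:M by apply: mulmx1C.
pose i0 := Ordinal (ltnW n1); pose i1 := Ordinal n1.
(* In an eigenbasis of Y, a diagonal involution with both signs; it commutes with Y, and conjugation
   by it negates the matrix unit at (0, 1). *)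
pose D : M := diag_mx (\row_j if j == i0 then 1 else -1).
have DD : D *m D = 1%:M.
  rewrite /D mulmx_diag; apply/matrixP=> i j; rewrite !mxE.
  by case: (i == i0); rewrite ?mulr1 ?mulrNN ?mulr1.
have Dsa : adjmx D = D.
  apply/matrixP=> i j; rewrite /D adjmxE !mxE [j == i]eq_sym.
  case: (altP (i =P j)) => [->|_]; last by rewrite !mulr0n conjc0.
  by rewrite !mulr1n; case: (j == i0); rewrite ?rmorphN1 ?conjc1.
have conjP A B : (adjmx P *m A *m P) *m (adjmx P *m B *m P) = adjmx P *m (A *m B) *m P.
  by rewrite !mulmxA -(mulmxA _ P (adjmx P)) PP mulmx1.
exists (adjmx P *m D *m P); split.
- by rewrite !adjmxM adjmxK Dsa mulmxA.
- by rewrite conjP DD mulmx1.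
- rewrite YE !conjP /D !mulmx_diag; congr (_ *m diag_mx _ *m _).
  by apply/rowP=> j; rewrite !mxE mulrC.
- exists (adjmx P *m delta_mx i0 i1 *m P).
  have DeD : D *m delta_mx i0 i1 *m D = - delta_mx i0 i1.
    apply/matrixP=> k l; rewrite /D mul_diag_mx mul_mx_diag !mxE.
    case: (k == i0); case: (altP (l =P i1)) => [->|_] /=;
      by rewrite ?mulr0 ?mul0r ?oppr0 // ?mul1r ?mulrN1.
  rewrite !conjP DeD; apply/eqP => E.
  have := congr1 (fun x => P *m x *m adjmx P) E.
  rewrite !mulmxA PP !mul1mx -!mulmxA PP !mulmx1 => /matrixP /(_ i0 i1).
  rewrite !mxE !eqxx /= => /eqP; rewrite eq_sym -subr_eq0 opprK -mulr2n.
  by rewrite pnatr_eq0.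
Qed.

Lemma not_trivial_of_commutant (Q : cqgAlg R) (alpha : M -> 'M[Q]_n)
    (S : {vspace M}) (Y : M) : (1 < n)%N -> is_Qut alpha ->
  Y *m adjmx Y = adjmx Y *m Y ->
  (forall u, adjmx u = u -> u *m u = 1%:M -> u *m Y = Y *m u ->
     forall x, x \in S -> u *m x *m u \in S) ->
  ~ Qut_system_trivial alpha S /\ ~ Qut_graph_trivial alpha S.
Proof.
move=> n1 hQ normY hS; have n0 := ltnW n1.
have [u [usa uu uY ux]] := normal_commuting_involution n1 normY.
have {}hS := hS u usa uu uY.
split.
- apply: (Ad_not_trivial usa uu hQ ux) => [K b c|K e0 e1 x xS].
    exact: preserves_space_ext.
  exists [:: (x, e0); (u *m x *m u, e1)]; last by rewrite !big_cons big_nil addr0.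
  by move=> p; rewrite !inE => /orP[] /eqP -> //=; apply: hS.
- move=> [A Aadj]; apply: (Ad_not_trivial usa uu hQ ux) => [K b c|K e0 e1 x].
    exact: preserves_adjacency_ext.
  have [P pP] := proj_exists S n0.
  have AE := quantum_adjacency_adj_of n0 Aadj pP.
  have linA := quantum_adjacency_linear n0 Aadj.
  rewrite amplifyD !amplify_tens //; congr (_ + mx_tens _ _).
  rewrite !AE (conj_adj_of uu (proj_linear pP) (conj_proj usa uu pP hS)).
  by rewrite -scalemxAr -scalemxAl.
Qed.

(** A self-adjoint line is spanned by a Y whose adjoint is a multiple of Y, so Y is normal, and
    whatever commutes with Y preserves the span of 1 and Y. *)
Lemma not_trivial_dim1 (Q : cqgAlg R) (alpha : M -> 'M[Q]_n) (W : {vspace M}) :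
  (1 < n)%N -> is_Qut alpha -> self_adjoint_space W -> \dim W = 1%N ->
  ~ Qut_system_trivial alpha (<[1%:M]> + W)%VS /\
  ~ Qut_graph_trivial alpha (<[1%:M]> + W)%VS.
Proof.
move=> n1 hQ Wsa dW.
have [Y WY] : exists Y, W = <[Y]>%VS.
  have := vbasisP W; move: (vbasis W); rewrite dW => X bX.
  exists (tnth X ord0); rewrite -(span_basis bX) -span_seq1; congr (<<_>>%VS).
  by case/tupleP: {bX} X => x t; rewrite [t]tuple0.
have /vlineP[c Yc] : adjmx Y \in <[Y]>%VS by rewrite -WY; apply: Wsa; rewrite WY memv_line.
apply: (@not_trivial_of_commutant _ _ _ Y) => //.
  by rewrite Yc -scalemxAr -scalemxAl.
move=> u _ uu uY x /memv_addP[a /vlineP[k ->] [b]].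
rewrite WY => /vlineP[l ->] ->.
rewrite mulmxDr mulmxDl -!scalemxAr -!scalemxAl mulmx1 uu uY -mulmxA uu mulmx1.
by rewrite memv_add // memvZ ?memv_line.
Qed.

Lemma not_trivial_codim1 (Q : cqgAlg R) (alpha : M -> 'M[Q]_n) (S : {vspace M}) :
  (1 < n)%N -> is_Qut alpha -> self_adjoint_space S -> (\dim S).+1 = (n ^ 2)%N ->
  ~ Qut_system_trivial alpha S /\ ~ Qut_graph_trivial alpha S.
Proof.
move=> n1 hQ Ssa dS; have [P pP] := proj_exists S (ltnW n1).
have Pid := proj_id pP.
have [z zS] : exists z, z \notin S.
  have : ~~ (fullv <= S)%VS.
    apply/negP => /dimvS; rewrite dimvf /dim /= -mulnn in dS *.
    by rewrite -dS ltnn.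
  by move/subvPn => [z _ ?]; exists z.
pose Y := z - P z.
have Yorth x : x \in S -> \tr (adjmx x *m Y) = 0 by move=> xS; exact: (proj_orth pP z xS).
have Y0 : Y != 0 by apply: contraNneq zS => /subr0_eq ->; apply: proj_mem pP _.
have YY0 : \tr (adjmx Y *m Y) != 0 by apply: contraNneq Y0 => /mxtrace_adj_self0 ->.
have YS : Y \notin S by apply: contraNN YY0 => /Yorth ->.
have full x : exists s k, [/\ s \in S & x = s + k *: Y].
  have : x \in (S + <[Y]>)%VS.
    have -> : (S + <[Y]>)%VS = fullv; last by rewrite memvf.
    apply/eqP; rewrite eqEdim subvf /= dimvf dimv_disjoint_sum.
      by rewrite dim_vline; have -> : Y != 0 by []; rewrite addn1 dS /dim /= mulnn.
    apply/eqP; rewrite -subv0; apply/subvP => t /memv_capP[tS /vlineP[k tk]].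
    rewrite memv0; apply: contraTT tS => t0; rewrite tk.
    have k0 : k != 0 by apply: contraNneq t0 => k0; rewrite tk k0 scale0r.
    apply: contraNN YS => kY; by rewrite -[Y]scale1r -(mulVf k0) -scalerA memvZ.
  by move=> /memv_addP[s sS [t /vlineP[k ->] ->]]; exists s, k.
have Ymem x : \tr (adjmx Y *m x) = 0 -> x \in S.
  have [s [k [sS ->]]] := full x; rewrite mulmxDr -scalemxAr mxtraceD mxtraceZ.
  have -> : \tr (adjmx Y *m s) = 0.
    by rewrite -[adjmx Y *m s]adjmxK mxtrace_adj adjmxM adjmxK Yorth ?conjc0.
  rewrite add0r => /eqP; rewrite mulf_eq0 (negPf YY0) orbF => /eqP ->.
  by rewrite scale0r addr0.
have Yorth' x : x \in S -> \tr (adjmx Y *m x) = 0.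
  by move=> xS; rewrite -[adjmx Y *m x]adjmxK mxtrace_adj adjmxM adjmxK Yorth ?conjc0.
have [s [k [sS Yadj]]] := full (adjmx Y).
(* S is self-adjoint, so the adjoint of Y is orthogonal to S as well; its component in S vanishes
   and it is a multiple of Y. Thus Y is normal. *)
have s0 : s = 0.
  apply: mxtrace_adj_self0.
  have sY : \tr (adjmx s *m adjmx Y) = 0.
    by rewrite -adjmxM mxtrace_adj mxtrace_mulC -[s]adjmxK Yorth ?conjc0 //; apply: Ssa.
  by move: sY; rewrite Yadj mulmxDr -scalemxAr mxtraceD mxtraceZ Yorth // mulr0 addr0.
apply: (@not_trivial_of_commutant _ _ S Y) => //.
  by rewrite Yadj s0 add0r -scalemxAr -scalemxAl.
move=> u usa uu uY x xS; apply: Ymem.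
rewrite mulmxA mxtrace_mulC !mulmxA.
have -> : u *m adjmx Y *m u = adjmx Y.
  by rewrite Yadj s0 add0r -scalemxAr -scalemxAl uY -mulmxA uu mulmx1.
exact: Yorth'.
Qed.

End Flexible.

(** * Openness of rigidity *)

Section Openness.
Variables (R : realType) (n d : nat).
Local Notation C := (R[i]).
Local Notation M := 'M[C]_n.
Local Notation tup := (d.-tuple M).

Definition polyfun (f : tup -> C) : Prop :=
  exists p q : {mpoly R[#|real_coord_index n d|]},
  forall X, f X = (p.@[real_coords X] +i* q.@[real_coords X])%C.

Lemma polyfun_ext f g : f =1 g -> polyfun f -> polyfun g.
Proof. by move=> fg [p [q h]]; exists p, q => X; rewrite -fg. Qed.

Lemma polyfun_cst c : polyfun (fun=> c).
Proof.
exists (complex.Re c)%:MP, (complex.Im c)%:MP => X; rewrite !mevalC.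
by case: c.
Qed.

Lemma polyfunD f g : polyfun f -> polyfun g -> polyfun (fun X => f X + g X).
Proof.
move=> [p [q h]] [p' [q' h']]; exists (p + p'), (q + q') => X.
by rewrite h h' !mevalD.
Qed.

Lemma polyfunM f g : polyfun f -> polyfun g -> polyfun (fun X => f X * g X).
Proof.
move=> [p [q h]] [p' [q' h']]; exists (p * p' - q * q'), (p * q' + q * p') => X.
by rewrite h h' mevalB mevalD !mevalM.
Qed.

Lemma polyfun_conj f : polyfun f -> polyfun (fun X => ((f X)^*)%C).
Proof. by move=> [p [q h]]; exists p, (- q) => X; rewrite h mevalN. Qed.

Lemma polyfun_sum I r (P : pred I) (F : I -> tup -> C) :
  (forall i, polyfun (F i)) -> polyfun (fun X => \sum_(i <- r | P i) F i X).
Proof.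
move=> hF; elim: r => [|i r IH].
  by apply: polyfun_ext (polyfun_cst 0) => X; rewrite big_nil.
case Pi: (P i).
  by apply: polyfun_ext (polyfunD (hF i) IH) => X; rewrite big_cons Pi.
by apply: polyfun_ext IH => X; rewrite big_cons Pi.
Qed.

Lemma polyfun_prod I r (P : pred I) (F : I -> tup -> C) :
  (forall i, polyfun (F i)) -> polyfun (fun X => \prod_(i <- r | P i) F i X).
Proof.
move=> hF; elim: r => [|i r IH].
  by apply: polyfun_ext (polyfun_cst 1) => X; rewrite big_nil.
case Pi: (P i).
  by apply: polyfun_ext (polyfunM (hF i) IH) => X; rewrite big_cons Pi.
by apply: polyfun_ext IH => X; rewrite big_cons Pi.
Qed.

Lemma polyfun_entry l i j : polyfun (fun X => tnth X l i j).
Proof.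
pose k b : 'I_#|real_coord_index n d| := enum_rank (l, i, j, b).
exists 'X_(k false), 'X_(k true) => X; rewrite !mevalXU /real_coords !enum_rankK.
by case: (tnth X l i j).
Qed.

Definition polymx m p (F : tup -> 'M[C]_(m, p)) : Prop :=
  forall i j, polyfun (fun X => F X i j).

Lemma polymx_cst m p (A : 'M[C]_(m, p)) : polymx (fun=> A).
Proof. by move=> i j; apply: polyfun_cst. Qed.

Lemma polymxD m p (F G : tup -> 'M[C]_(m, p)) :
  polymx F -> polymx G -> polymx (fun X => F X + G X).
Proof.
by move=> hF hG i j; apply: polyfun_ext (polyfunD (hF i j) (hG i j)) => X; rewrite mxE.
Qed.

Lemma polymxZ m p f (F : tup -> 'M[C]_(m, p)) :
  polyfun f -> polymx F -> polymx (fun X => f X *: F X).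
Proof.
by move=> hf hF i j; apply: polyfun_ext (polyfunM hf (hF i j)) => X; rewrite mxE.
Qed.

Lemma polymxM m p q (F : tup -> 'M[C]_(m, p)) (G : tup -> 'M[C]_(p, q)) :
  polymx F -> polymx G -> polymx (fun X => F X *m G X).
Proof.
move=> hF hG i j.
apply: (polyfun_ext (f := fun X => \sum_k F X i k * G X k j)) => [X|].
  by rewrite mxE.
by apply: polyfun_sum => k; apply: polyfunM.
Qed.

Lemma polymx_sum m p I r (P : pred I) (F : I -> tup -> 'M[C]_(m, p)) :
  (forall i, polymx (F i)) -> polymx (fun X => \sum_(i <- r | P i) F i X).
Proof.
move=> hF i j; apply: (polyfun_ext (f := fun X => \sum_(k <- r | P k) F k X i j)) => [X|].
  by rewrite summxE.
by apply: polyfun_sum => k; apply: hF.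
Qed.

Lemma polymx_adj m p (F : tup -> 'M[C]_(m, p)) :
  polymx F -> polymx (fun X => adjmx (F X)).
Proof.
by move=> hF i j; apply: polyfun_ext (polyfun_conj (hF j i)) => X; rewrite adjmxE.
Qed.

Lemma polyfun_tr (F : tup -> M) : polymx F -> polyfun (fun X => \tr (F X)).
Proof. by move=> hF; apply: polyfun_sum => i; apply: hF. Qed.

Lemma polyfun_det m (F : tup -> 'M[C]_m) : polymx F -> polyfun (fun X => \det (F X)).
Proof.
move=> hF; apply: polyfun_sum => s; apply: polyfunM; first exact: polyfun_cst.
by apply: polyfun_prod => i; apply: hF.
Qed.

Lemma polymx_adjugate m (F : tup -> 'M[C]_m) :
  polymx F -> polymx (fun X => \adj (F X)).
Proof.
move=> hF i j.
apply: (polyfun_ext (f := fun X => (-1) ^+ (j + i) * \det (row' j (col' i (F X))))) => [X|].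
  by rewrite mxE /cofactor.
apply: polyfunM; first exact: polyfun_cst.
apply: polyfun_det => k l.
by apply: polyfun_ext (hF (lift j k) (lift i l)) => X; rewrite !mxE.
Qed.

Definition with_one (X : tup) : d.+1.-tuple M := cons_tuple 1%:M X.

Lemma polymx_with_one i : polymx (fun X => tnth (with_one X) i).
Proof.
case: (unliftP ord0 i) => [j|] ->.
  by move=> k l; apply: polyfun_ext (polyfun_entry j k l) => X; rewrite tnthS.
by move=> k l; apply: polyfun_ext (polyfun_cst ((1%:M : M) k l)) => X; rewrite tnth0.
Qed.

Definition gram k (Y : k.-tuple M) : 'M[C]_k :=
  \matrix_(i, j) \tr (adjmx (tnth Y i) *m tnth Y j).

(* [\det (gram Y)] times the orthogonal projection onto the span of [Y], which
   has no denominators. *)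
Definition gram_proj k (Y : k.-tuple M) (y : M) : M :=
  \sum_i \sum_j (\adj (gram Y) i j * \tr (adjmx (tnth Y j) *m y)) *: tnth Y i.

(** Normal equations: by orthogonality, the Gram matrix sends the coordinates of P y to the numbers
    [\tr (adjmx (tnth Y j) *m y)], and the adjugate inverts it up to the determinant. *)
Lemma gram_projE k (Y : k.-tuple M) P : is_proj <<Y>>%VS P ->
  forall y, gram_proj Y y = \det (gram Y) *: P y.
Proof.
move=> pP y; have := coord_span (proj_mem pP y).
set c := fun i => coord Y i (P y).
have -> : \sum_(i < k) coord Y i (P y) *: Y`_i = \sum_i c i *: tnth Y i.
  by apply: eq_bigr => i _; rewrite -tnth_nth.
move=> Py; have tY j : \tr (adjmx (tnth Y j) *m y) = \sum_i gram Y j i * c i.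
  have /eqP := proj_orth pP y (mem_span_tuple Y j).
  rewrite mulmxBr linearB /= subr_eq0 => /eqP ->.
  rewrite Py mxtrace_sumr; apply: eq_bigr => i _.
  by rewrite -scalemxAr mxtraceZ mxE mulrC.
rewrite Py scaler_sumr /gram_proj; apply: eq_bigr => i _.
rewrite -scaler_suml scalerA; congr (_ *: _).
under eq_bigr do rewrite tY mulr_sumr.
rewrite exchange_big /=.
have E l : \sum_j \adj (gram Y) i j * gram Y j l = \det (gram Y) * (i == l)%:R.
  have := congr1 (fun A : 'M_k => A i l) (mul_adj_mx (gram Y)).
  by rewrite !mxE mulr_natr.
under eq_bigr do (under eq_bigr do rewrite mulrA); rewrite /=.
under eq_bigr do rewrite -mulr_suml E.
rewrite (bigD1 i) //= eqxx mulr1 big1 ?addr0 // => l li.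
by rewrite eq_sym (negPf li) mulr0 mul0r.
Qed.

Lemma gram_det_free k (Y : k.-tuple M) : (\det (gram Y) != 0) = free Y.
Proof.
apply/idP/idP => [dG|/freeP fY].
  apply/freeP => c c0 i; set C := \col_i c i.
  have GC : gram Y *m C = 0.
    apply/matrixP=> j l; rewrite !mxE.
    transitivity (\tr (adjmx (tnth Y j) *m \sum_(i < k) c i *: Y`_i)); last first.
      by rewrite c0 mulmx0 mxtrace0.
    rewrite mxtrace_sumr; apply: eq_bigr => m _.
    by rewrite !mxE -scalemxAr mxtraceZ mulrC -tnth_nth.
  have uG : gram Y \in unitmx by rewrite unitmxE unitfE.
  have : C = 0 by rewrite -[C](mulKmx uG) GC mulmx0.
  by move=> /matrixP /(_ i ord0); rewrite !mxE.
apply/det0P => -[v v0 vG]; move/negP: v0; apply; apply/eqP/rowP => i.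
(* A left kernel vector v gives the combination of Y with conjugate coefficients; it is orthogonal
   to every member of Y, hence to itself. *)
have : ((v 0 i)^*)%C = 0.
  apply: (fY (fun i => ((v 0 i)^*)%C)); apply: mxtrace_adj_self0.
  set z := \sum_(i < k) _; rewrite {2}/z mxtrace_sumr big1 // => j _.
  rewrite -scalemxAr mxtraceZ /z adjmx_sum mulmx_suml linear_sum /=.
  have := congr1 (fun A : 'rV_k => A 0 j) vG; rewrite !mxE => h.
  rewrite -[RHS](mulr0 ((v 0 j)^*)%C) -[X in _ = _ * X]h; congr (_ * _); apply: eq_bigr => l _.
  by rewrite adjmxZ conjcK -scalemxAl mxtraceZ mxE -!tnth_nth.
by move=> /eqP; rewrite conjc_eq0 [RHS]mxE => /eqP.
Qed.

(** The open set that witnesses genericity on both sides. That 1 is outside W gives the span of 1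
    and W the dimension of an operator d-system. *)
Definition rigid_space (W : {vspace M}) : Prop :=
  1%:M \notin W /\
  exists2 P, is_proj (<[1%:M]> + W)%VS P & forall x, gen (adj_of P) x.

Definition word_mx (T : M -> M) (ws : 'I_(n * n) -> word R) : 'M[C]_(n * n) :=
  \matrix_k mxvec (eval T (ws k)).

(** Choose one word for each matrix unit; conversely n^2 independent values form a basis. Once the
    words are fixed, the determinant is polynomial in T. *)
Lemma genP (T : M -> M) :
  (forall x, gen T x) <-> exists ws, \det (word_mx T ws) != 0.
Proof.
split=> [gT|[ws dw] x].
  have := fin_all_exists (fun k : 'I_(n * n) => gT (vec_mx (delta_mx 0 k))).
  move=> [ws wsE]; exists ws.
  rewrite (_ : word_mx T ws = 1%:M) ?det1 ?oner_eq0 //.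
  apply/row_matrixP => k; rewrite rowK wsE vec_mxK.
  by rewrite row1.
have uW : word_mx T ws \in unitmx by rewrite unitmxE unitfE.
have : mxvec x = \sum_k (mxvec x *m invmx (word_mx T ws)) 0 k *: mxvec (eval T (ws k)).
  rewrite -[LHS](mulmxKV uW) mulmx_sum_row; apply: eq_bigr => k _.
  by rewrite rowK.
move=> /(congr1 vec_mx); rewrite mxvecK linear_sum => ->.
apply: gen_sum => k _; rewrite linearZ /= mxvecK; apply: genZ.
by exists (ws k).
Qed.

Lemma polymx_eval w : polymx (fun X : tup => eval (adj_of (gram_proj (with_one X))) w).
Proof.
elim: w => [|w IH|w1 IH1 w2 IH2|c w1 IH1 w2 IH2] /=.
- exact: polymx_cst.
- rewrite /adj_of; apply: polymx_sum => b; apply: polymx_sum => k.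
  apply: polymxM; last exact: polymx_cst.
  apply: polymxM => //; rewrite /gram_proj.
  apply: polymx_sum => i; apply: polymx_sum => j.
  apply: polymxZ; last exact: polymx_with_one.
  apply: polyfunM.
    apply: polymx_adjugate => {}i {}j.
    apply: (polyfun_ext (f := fun X => \tr (adjmx (tnth (with_one X) i) *m tnth (with_one X) j))).
      by move=> X; rewrite mxE.
    by apply: polyfun_tr; apply: polymxM; [apply: polymx_adj|]; apply: polymx_with_one.
  apply: polyfun_tr; apply: polymxM; last exact: polymx_cst.
  by apply: polymx_adj; apply: polymx_with_one.
- exact: polymxM.
- by apply: polymxD => //; apply: polymxZ => //; apply: polyfun_cst.
Qed.

(** The first factor tests the independence of 1 and X. When it is non-zero, [gram_proj] is a
    non-zero multiple of the projection, so the second factor tests rigidity itself. *)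
Definition rigidity_poly (ws : 'I_(n * n) -> word R) (X : tup) : C :=
  \det (gram (with_one X)) * \det (word_mx (adj_of (gram_proj (with_one X))) ws).

Lemma polyfun_rigidity ws : polyfun (rigidity_poly ws).
Proof.
apply: polyfunM; apply: polyfun_det.
  move=> i j.
  apply: (polyfun_ext (f := fun X => \tr (adjmx (tnth (with_one X) i) *m tnth (with_one X) j))).
    by move=> X; rewrite mxE.
  by apply: polyfun_tr; apply: polymxM; [apply: polymx_adj|]; apply: polymx_with_one.
move=> k l; case/mxvec_indexP: l => i j.
apply: polyfun_ext (polymx_eval (ws k) i j) => X.
by rewrite mxE mxvecE.
Qed.

Lemma rigid_spaceP (X : tup) : (0 < n)%N -> free X ->
  rigid_space <<X>>%VS <-> exists ws, rigidity_poly ws X != 0.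
Proof.
move=> n0 fX; have spanE : (<[1%:M]> + <<X>>)%VS = <<with_one X>>%VS.
  by rewrite [RHS]span_cons.
have freeE : free (with_one X) = (1%:M \notin <<X>>%VS).
  by rewrite [LHS]free_cons fX andbT.
have adjE P : is_proj <<with_one X>>%VS P -> forall x,
    adj_of (gram_proj (with_one X)) x = \det (gram (with_one X)) *: adj_of P x.
  move=> pP x; rewrite (adj_of_ext (gram_projE pP)) /adj_of scaler_sumr.
  apply: eq_bigr => b _; rewrite scaler_sumr; apply: eq_bigr => k _.
  by rewrite -!scalemxAl.
rewrite /rigid_space spanE /rigidity_poly; split.
  move=> [oneW [P pP gP]]; have dG : \det (gram (with_one X)) != 0.
    by rewrite gram_det_free freeE.
  have [|ws dw] := (genP (adj_of (gram_proj (with_one X)))).1.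
    move=> x; apply: (@gen_scaled _ _ _ (adj_of P) (\det (gram (with_one X)))^-1 _ _ (gP x)).
    by move=> y; rewrite (adjE P) // scalerA mulVf ?scale1r.
  by exists ws; rewrite mulf_neq0.
move=> [ws]; rewrite mulf_eq0 negb_or => /andP[dG dw]; split.
  by rewrite -freeE -gram_det_free.
have [P pP] := proj_exists <<with_one X>>%VS n0; exists P => // x.
have := (genP _).2 (ex_intro _ ws dw) x.
by apply: gen_scaled; apply: adjE.
Qed.

Lemma rigid_space_open : (0 < n)%N -> zariski_open_sa d rigid_space.
Proof.
(* A complex value is non-zero iff its real or its imaginary part is; the family consists of both
   parts of [rigidity_poly], for all choices of words. *)
move=> n0; exists (fun p => exists ws,
   (forall X, p.@[real_coords X] = complex.Re (rigidity_poly ws X)) \/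
   (forall X, p.@[real_coords X] = complex.Im (rigidity_poly ws X))).
move=> X _ fX; split.
  move=> /(rigid_spaceP n0 fX) [ws]; have [p [q pq]] := polyfun_rigidity ws.
  rewrite pq eq_complex negb_and /= => /orP[p0|q0].
  - by exists p => //; exists ws; left => Y; rewrite pq.
  - by exists q => //; exists ws; right => Y; rewrite pq.
move=> [p [ws pE] p0]; apply/(rigid_spaceP n0 fX); exists ws.
by apply: contraNneq p0 => r0; case: pE => ->; rewrite r0.
Qed.

End Openness.

(** * Complements *)

Section Complement.
Variables (R : realType) (n : nat).
Local Notation C := (R[i]).
Local Notation M := 'M[C]_n.

Lemma proj_adj (S : {vspace M}) P : self_adjoint_space S -> is_proj S P ->
  forall y, P (adjmx y) = adjmx (P y).
Proof.
move=> Ssa pP; have pP' : is_proj S (fun y => adjmx (P (adjmx y))).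
  split.
  - move=> c y z; rewrite adjmxD adjmxZ (proj_linear pP) adjmxD adjmxZ.
    by rewrite conjcK.
  - by move=> y; apply: Ssa; apply: proj_mem pP _.
  - move=> x y xS; have := proj_orth pP (adjmx y) (Ssa _ xS).
    rewrite adjmxK => h; rewrite -[adjmx x *m _]adjmxK mxtrace_adj adjmxM adjmxB !adjmxK.
    by rewrite mxtrace_mulC h conjc0.
by move=> y; rewrite -[LHS]adjmxK -(proj_uniq pP pP').
Qed.

Lemma adj_of_id (x : M) : adj_of id x = \tr x *: 1%:M.
Proof.
apply/matrixP=> i j; rewrite adj_ofE !mxE.
case: (altP (i =P j)) => [->|ij]; last first.
  rewrite mulr0 big1 // => k _; rewrite mxE big1 // => l _.
  by rewrite delta_mxE eq_sym (negPf ij) !mul0r.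
rewrite mulr1; apply: eq_bigr => k _; rewrite mxE (bigD1 k) //= big1 => [|l lk].
  by rewrite delta_mxE !eqxx !mul1r addr0.
by rewrite delta_mxE eqxx mul1r eq_sym (negPf lk) mul0r.
Qed.

Lemma mxtrace_delta (i j : 'I_n) : \tr (delta_mx i j : M) = (i == j)%:R.
Proof. by rewrite -[delta_mx i j]mulmx1 mxtrace_deltaM mxE eq_sym. Qed.

Lemma adj_of_trace (x : M) : adj_of (fun y => (\tr y / n%:R) *: 1%:M) x = n%:R^-1 *: x.
Proof.
apply/matrixP=> i j; rewrite adj_ofE mxE (bigD1 j) //= big1 => [|k kj].
  by rewrite -scalemxAl mul1mx mxE addr0 mxtrace_delta eqxx mul1r.
by rewrite -scalemxAl mul1mx mxE mxtrace_delta eq_sym (negPf kj) !mul0r.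
Qed.

Lemma one_mem_addv (W : {vspace M}) : 1%:M \in (<[1%:M]> + W)%VS.
Proof. by have := memv_add (memv_line (1%:M : M)) (mem0v W); rewrite addr0. Qed.

Lemma self_adjoint_add_one (W : {vspace M}) :
  self_adjoint_space W -> self_adjoint_space (<[1%:M]> + W)%VS.
Proof.
move=> Wsa x /memv_addP[a /vlineP[k ->] [w wW ->]].
by rewrite adjmxD adjmxZ adjmx1 memv_add ?Wsa // memvZ ?memv_line.
Qed.

Lemma dim_add_one (W : {vspace M}) : (0 < n)%N -> 1%:M \notin W ->
  \dim (<[1%:M]> + W)%VS = (\dim W).+1.
Proof.
move=> n0 W1; have one0 : 1%:M != 0 :> M.
  apply/eqP => /matrixP /(_ (Ordinal n0) (Ordinal n0)) /eqP.
  by rewrite !mxE eqxx oner_eq0.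
rewrite dimv_disjoint_sum ?dim_vline ?one0 //.
apply/eqP; rewrite -subv0; apply/subvP => t /memv_capP[/vlineP[k ->] tW].
rewrite memv0; apply: contraNT W1 => t0.
have k0 : k != 0 by apply: contraNneq t0 => ->; rewrite scale0r.
have <- : k^-1 *: (k *: 1%:M) = 1%:M :> M by rewrite scalerA mulVf ?scale1r.
exact: memvZ.
Qed.

Lemma rigid_complement d (W : {vspace M}) : (0 < n)%N ->
  grassmannian_sa d W -> rigid_space W ->
  exists2 W' : {vspace M}, grassmannian_sa (n ^ 2 - d.+1) W' & rigid_space W'.
Proof.
move=> n0 [Wsa dW] [W1 [P pP gP]].
have n0C : n%:R != 0 :> C by rewrite pnatr_eq0 -lt0n.
have Ssa := self_adjoint_add_one Wsa; have dS := dim_add_one n0 W1.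
have oneS := one_mem_addv W.
set S := (<[1%:M]> + W)%VS in pP Ssa dS oneS.
pose L : {linear M -> M} := HB.pack P (GRing.isLinear.Build C M M _ P (proj_linear pP)).
have LP x : linfun L x = P x by rewrite lfunE.
pose W' := lker (linfun L).
have W'P y : (y \in W') = (P y == 0) by rewrite memv_ker LP.
have trP y : \tr (P y) = \tr y.
  have := proj_orth pP y oneS; rewrite adjmx1 mul1mx linearB /= => /eqP.
  by rewrite subr_eq0 => /eqP.
have kerorth x w : x \in S -> P w = 0 -> \tr (adjmx w *m x) = 0.
  move=> xS Pw; rewrite -[adjmx w *m x]adjmxK mxtrace_adj adjmxM adjmxK.
  by have := proj_orth pP w xS; rewrite Pw subr0 => ->; rewrite conjc0.
exists W'.
  split; first by move=> y; rewrite !W'P (proj_adj Ssa pP) => /eqP ->; rewrite adjmx0.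
  have := limg_ker_dim (linfun L) fullv; rewrite capfv -/W' dimvf /dim /= => E.
  have -> : (n ^ 2 = n * n)%N by rewrite mulnn.
  rewrite -E; have -> : limg (linfun L) = S; last by rewrite dS dW addnK.
  apply/vspaceP => y; apply/idP/idP.
    by move=> /memv_imgP[x _ ->]; rewrite LP (proj_mem pP).
  by move=> yS; rewrite -[y](proj_id pP) // -LP memv_img ?memvf.
have tr1 : \tr (1%:M : M) = n%:R by rewrite mxtrace1.
split.
  rewrite W'P (proj_id pP oneS); apply/eqP => /matrixP /(_ (Ordinal n0) (Ordinal n0)) /eqP.
  by rewrite !mxE eqxx oner_eq0.
(* [y - P y] projects onto W', the orthogonal complement of S, and the last term onto the line of 1,
   which is orthogonal to W' since 1 lies in S. *)
pose P' y := y - P y + (\tr y / n%:R) *: 1%:M.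
exists P'.
  split.
  - move=> c y z; rewrite /P' (proj_linear pP) mxtraceD mxtraceZ mulrDl scalerDl.
    rewrite scalerDr scalerBr scalerA mulrA opprD.
    by rewrite [X in X + _ = _]addrACA [LHS]addrACA.
  - move=> y; rewrite /P' addrC memv_add // ?memvZ ?memv_line //.
    have PPy : P (P y) = P y := proj_id pP (proj_mem pP y).
    have PB : P (y - P y) = P y - P (P y) := linearB L _ _.
    by rewrite W'P PB PPy subrr.
  - move=> x y /memv_addP[a /vlineP[k ->] [w wW' ->]].
    move: wW'; rewrite W'P => /eqP Pw.
    have -> : y - P' y = P y - (\tr y / n%:R) *: 1%:M.
      by rewrite /P' opprD opprB addrA addrCA subrr addr0.
    rewrite mulmxBr linearB /= adjmxD adjmxZ adjmx1 !mulmxDl !mxtraceD.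
    rewrite -!scalemxAl !mul1mx -scalemxAr !mxtraceZ trP tr1 divfK // !kerorth //.
      by rewrite mulr0 !addr0 subrr.
    exact: proj_mem pP _.
have adjP' x : adj_of P' x = \tr x *: 1%:M - adj_of P x + n%:R^-1 *: x.
  rewrite -adj_of_id -adj_of_trace /adj_of -sumrB -big_split; apply: eq_bigr => b _ /=.
  rewrite -sumrB -big_split; apply: eq_bigr => k _ /=.
  by rewrite /P' mulmxDl mulmxBl mulmxDl mulmxBl.
move=> x; apply: (gen_min (F := gen (adj_of P'))) (gP x) => {x}.
- exact: gen1.
- move=> x gx.
  have -> : adj_of P x = (\tr x *: 1%:M + n%:R^-1 *: x) + (-1) *: adj_of P' x.
    by rewrite adjP' scaleN1r opprD opprB addrACA [X in X + _]addrC subrK subrr addr0.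
  by apply: genD; [apply: genD; apply: genZ => //; apply: gen1 | apply: genZ; apply: genT].
- exact: genM.
- exact: gen_lin.
Qed.

End Complement.

(** * Rigid systems from seeds *)

Section OrthogonalSeq.
Variables (R : realType) (n : nat).
Local Notation C := (R[i]).
Local Notation M := 'M[C]_n.

Definition sqnorm (y : M) : C := \tr (adjmx y *m y).

Lemma orthogonal_seq (s : seq M) :
  all (fun y => sqnorm y != 0) s ->
  pairwise (fun x y => \tr (adjmx x *m y) == 0) s ->
  orthogonal_family (in_tuple s) (fun i => sqnorm (tnth (in_tuple s) i)).
Proof.
move=> /allP s0 /(pairwiseP 0) ps; split=> [i|i j].
  by apply: s0; apply: mem_tnth.
have tr_sym (x y : M) : \tr (adjmx x *m y) = 0 -> \tr (adjmx y *m x) = 0.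
  by move=> h; rewrite -[adjmx y *m x]adjmxK mxtrace_adj adjmxM adjmxK h conjc0.
case: (altP (i =P j)) => [->|ij]; first by rewrite mul1r.
rewrite mul0r !(tnth_nth 0).
have [lt_ij|lt_ji|/val_inj eq_ij] := ltngtP i j.
- by apply/eqP/ps => //; rewrite inE.
- by apply/tr_sym/eqP/ps => //; rewrite inE.
- by rewrite eq_ij eqxx in ij.
Qed.

Lemma orthogonal_seq_adj_of (s : seq M) x :
  adj_of (family_proj (in_tuple s) (fun i => sqnorm (tnth (in_tuple s) i))) x =
  \sum_(y <- s) (sqnorm y)^-1 *: (y *m x *m adjmx y).
Proof.
rewrite adj_of_family_proj -(big_tuple _ _ (in_tuple s) xpredT
  (fun y => (sqnorm y)^-1 *: (y *m x *m adjmx y))) //.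
Qed.

(** The order of the indices encodes the type of the unit: [p.1 < p.2] gives the real symmetric one,
    [p.2 < p.1] the imaginary one, so each unit has exactly one ordered pair. *)
Definition hphase (p : 'I_n * 'I_n) : C := if (p.1 < p.2)%N then 1 else 'i.

Definition hunit (p : 'I_n * 'I_n) : M :=
  hphase p *: delta_mx p.1 p.2 + ((hphase p)^*)%C *: delta_mx p.2 p.1.

Lemma hphaseK p : hphase p * ((hphase p)^*)%C = 1.
Proof.
rewrite /hphase; case: ifP => _; first by rewrite conjc1 mulr1.
by rewrite -[X in _ * X]/(Num.conj 'i) conjCi mulrN -expr2 sqrCi opprK.
Qed.

Lemma hunit_adj p : adjmx (hunit p) = hunit p.
Proof. by rewrite /hunit adjmxD !adjmxZ !adjmx_delta conjcK addrC. Qed.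

Lemma hunitE p i j : hunit p i j =
  hphase p * ((p.1 == i) && (p.2 == j))%:R + ((hphase p)^*)%C * ((p.2 == i) && (p.1 == j))%:R.
Proof. by rewrite /hunit !mxE !(eq_sym i) !(eq_sym j). Qed.

Lemma hunit_trM p (x : M) :
  \tr (hunit p *m x) = hphase p * x p.2 p.1 + ((hphase p)^*)%C * x p.1 p.2.
Proof. by rewrite /hunit mulmxDl -!scalemxAl mxtraceD !mxtraceZ !mxtrace_deltaM. Qed.

Lemma hunit_sq p : p.1 != p.2 ->
  hunit p *m hunit p = delta_mx p.1 p.1 + delta_mx p.2 p.2.
Proof.
move=> p12; rewrite /hunit mulmxDl !mulmxDr -!scalemxAl -!scalemxAr.
rewrite !mul_delta_mx_cond !eqxx [p.2 == p.1]eq_sym (negPf p12) !mulr0n !mulr1n.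
by rewrite !scaler0 addr0 add0r !scalerA hphaseK mulrC hphaseK !scale1r.
Qed.

Lemma hunit_tr_sq p : p.1 != p.2 -> \tr (hunit p *m hunit p) = 2%:R.
Proof. by move=> p12; rewrite hunit_sq // mxtraceD !mxtrace_delta !eqxx. Qed.

(** Distinct units overlap only if q is p reversed; then one phase is 1 and the other ['i], and the
    trace is twice the real part of their product. *)
Lemma hunit_orth p q : p.1 != p.2 -> q.1 != q.2 -> p != q -> \tr (hunit p *m hunit q) = 0.
Proof.
case: p q => [i j] [k l] /= ij kl pq; rewrite hunit_trM !hunitE /=.
have h1 : (k == i) && (l == j) = false.
  by apply/negbTE; apply: contraNN pq => /andP[/eqP<- /eqP<-].
rewrite [(l == j) && _]andbC h1 !mulr0 addr0 add0r [(l == i) && _]andbC.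
have [/andP[/eqP -> /eqP ->]|_] := boolP ((k == j) && (l == i)); last by rewrite !mulr0 addr0.
rewrite !mulr1 /hphase /=; have conji : (('i : C)^*)%C = - 'i := conjCi C.
have [lt_ij|lt_ji|/val_inj eq_ij] := ltngtP i j; last by rewrite eq_ij eqxx in ij.
- by rewrite conjc1 !mul1r conji subrr.
- by rewrite conjc1 !mulr1 conji subrr.
Qed.

End OrthogonalSeq.

(** * From a diagonal matrix with distinct entries to all matrix units *)

Section DiagonalGeneration.
Variables (R : realType) (n : nat).
Local Notation C := (R[i]).
Local Notation M := 'M[C]_n.

(** Lagrange interpolation: the product of the factors [g j - g k] over k other than i vanishes at
    every diagonal position except i. *)
Lemma gen_delta (T : M -> M) (g : 'I_n -> C) i :
  injective g -> gen T (diag_mx (\row_j g j)) -> gen T (delta_mx i i).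
Proof.
move=> g_inj gT.
have gQ (r : seq 'I_n) : gen T (diag_mx (\row_j \prod_(k <- r) (g j - g k))).
  elim: r => [|k r IH].
    rewrite (_ : diag_mx _ = 1%:M); first exact: gen1.
    by rewrite -diag_const_mx; congr diag_mx; apply/rowP=> j; rewrite !mxE big_nil.
  rewrite (_ : diag_mx _ = (diag_mx (\row_j g j) + (- g k) *: 1%:M) *m
                           diag_mx (\row_j \prod_(k <- r) (g j - g k))).
    by apply: genM => //; apply: genD => //; apply: genZ; apply: gen1.
  rewrite scalemx1 -diag_const_mx -raddfD mulmx_diag; congr diag_mx; apply/rowP=> j.
  by rewrite !mxE big_cons.
pose r := [seq k <- enum 'I_n | k != i].
have ci : \prod_(k <- r) (g i - g k) != 0.
  rewrite prodf_seq_neq0; apply/allP => k; rewrite mem_filter => /andP[ki _] /=.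
  by rewrite subr_eq0 (inj_eq g_inj) eq_sym.
rewrite (_ : delta_mx i i = (\prod_(k <- r) (g i - g k))^-1 *:
    diag_mx (\row_j \prod_(k <- r) (g j - g k))); first exact: genZ.
apply/matrixP=> a b; rewrite !mxE; have [<-|ab] := altP (a =P b); last first.
  rewrite mulr0n mulr0; case: (altP (a =P i)) => [ai|//].
  by rewrite -ai [b == a]eq_sym (negPf ab).
rewrite andbb mulr1n; case: (altP (a =P i)) => [->|ai]; first by rewrite mulVf.
have ar : a \in r by rewrite mem_filter ai mem_enum.
have ur : uniq r by rewrite filter_uniq ?enum_uniq.
by rewrite [X in _ * X](bigD1_seq a ar ur) /= subrr mul0r mulr0.
Qed.

(** The links form a tree rooted at index 0; multiplying along branches connects each index with the
    root, and any two indices through it. *)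
Lemma gen_all (T : M -> M) :
  (forall i : 'I_n, gen T (delta_mx i i)) ->
  (forall i : 'I_n, (0 < i)%N -> exists2 j : 'I_n, (j < i)%N &
     gen T (delta_mx i j) /\ gen T (delta_mx j i)) ->
  forall x, gen T x.
Proof.
move=> gd link x; rewrite [x]matrix_sum_delta.
apply: gen_sum => i _; apply: gen_sum => j _; apply: genZ.
have n0 : (0 < n)%N := leq_ltn_trans (leq0n _) (ltn_ord i).
pose o := Ordinal n0.
have root m : forall k : 'I_n, (k < m)%N -> gen T (delta_mx k o) /\ gen T (delta_mx o k).
  elim: m => // m IH k km; have [k0|k0] := posnP k.
    by have -> : k = o by [apply: val_inj]; split; apply: gd.
  have [l lk [g1 g2]] := link k k0.
  have [h1 h2] := IH l (leq_trans lk km).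
  split.
    by have := genM g1 h1; rewrite mul_delta_mx.
  by have := genM h2 g2; rewrite mul_delta_mx.
have [g1 _] := root _ i (leqnn _); have [_ g2] := root _ j (leqnn _).
by have := genM g1 g2; rewrite mul_delta_mx.
Qed.

End DiagonalGeneration.

(** * Rigidity of a seed with Hermitian units adjoined *)

Section Seed.
Variables (R : realType) (n : nat).
Local Notation C := (R[i]).
Local Notation M := 'M[C]_n.

(* A pair of real symmetric matrices that spans, together with the identity, a
   rigid operator 2-system, robustly under adjoining Hermitian units: these
   shift the entries of [s] by half-integers. *)
Record seed (Z1 Z2 : 'M[R]_n) (N1 N2 : R) (s : 'I_n -> R) : Prop := {
  seed_sym1 : Z1^T = Z1;
  seed_sym2 : Z2^T = Z2;
  seed_tr1 : \tr Z1 = 0;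
  seed_tr2 : \tr Z2 = 0;
  seed_tr12 : \tr (Z1 *m Z2) = 0;
  seed_sq1 : \tr (Z1 *m Z1) = N1;
  seed_sq2 : \tr (Z2 *m Z2) = N2;
  seed_N1 : N1 != 0;
  seed_N2 : N2 != 0;
  seed_diag : N1^-1 *: (Z1 *m Z1) + N2^-1 *: (Z2 *m Z2) = diag_mx (\row_i s i);
  seed_inj : injective s;
  seed_close : forall i j, `|s i - s j| < 2%:R^-1;
  seed_link : forall i : 'I_n, (0 < i)%N -> exists j : 'I_n, (j < i)%N /\
    exists k, N1^-1 * (Z1 i k * Z1 j k) + N2^-1 * (Z2 i k * Z2 j k) != 0
}.

Section SeedRigid.
Variables (Z1 Z2 : 'M[R]_n) (N1 N2 : R) (s : 'I_n -> R) (F : seq ('I_n * 'I_n)).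
Hypothesis n0 : (0 < n)%N.
Hypothesis sd : seed Z1 Z2 N1 N2 s.
Hypothesis F_uniq : uniq F.
Hypothesis F_off : forall p, p \in F -> p.1 != p.2.
Hypothesis F_free : forall p, p \in F -> (p.1 < p.2)%N -> Z1 p.1 p.2 = 0 /\ Z2 p.1 p.2 = 0.

Local Notation cpx := (map_mx (real_complex R)).
Local Notation rc := (real_complex R).

Lemma adjmx_cpx (Z : 'M[R]_n) : Z^T = Z -> adjmx (cpx Z) = cpx Z.
Proof. by move=> {2}<-; apply/matrixP=> i j; rewrite adjmxE !mxE conjc_real. Qed.

Lemma mxtrace_cpx (Z : 'M[R]_n) : \tr (cpx Z) = rc (\tr Z).
Proof. by rewrite /mxtrace rmorph_sum; apply: eq_bigr => i _; rewrite mxE. Qed.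

Definition seed_seq : seq M := [:: 1%:M, cpx Z1, cpx Z2 & map (@hunit R n) F].

Lemma hunit_tr (p : 'I_n * 'I_n) : p.1 != p.2 -> \tr (hunit R p) = 0 :> C.
Proof.
move=> p12; rewrite -[hunit _ _]mulmx1 hunit_trM !mxE eq_sym (negPf p12).
by rewrite !mulr0 addr0.
Qed.

(** For an imaginary unit the two terms cancel by the symmetry of Z; only a real unit needs a
    vanishing entry. *)
Lemma hunit_cpx (p : 'I_n * 'I_n) (Z : 'M[R]_n) : Z^T = Z -> ((p.1 < p.2)%N -> Z p.1 p.2 = 0) ->
  \tr (hunit R p *m cpx Z) = 0.
Proof.
move=> Zsym Z0; rewrite hunit_trM !mxE.
have -> : Z p.2 p.1 = Z p.1 p.2 by rewrite -{1}Zsym mxE.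
rewrite /hphase; case: ifP => [/Z0 -> |_]; first by rewrite rmorph0 !mulr0 addr0.
have -> : (('i : C)^*)%C = - 'i := conjCi C.
by rewrite mulNr subrr.
Qed.

Lemma sqnorm1 : sqnorm (1%:M : M) = n%:R.
Proof. by rewrite /sqnorm adjmx1 mul1mx mxtrace1. Qed.

Lemma sqnorm_cpx (Z : 'M[R]_n) : Z^T = Z -> sqnorm (cpx Z) = rc (\tr (Z *m Z)).
Proof. by move=> Zs; rewrite /sqnorm adjmx_cpx // -map_mxM mxtrace_cpx. Qed.

Lemma sqnorm_hunit (p : 'I_n * 'I_n) : p.1 != p.2 -> sqnorm (hunit R p) = 2%:R.
Proof. by move=> p12; rewrite /sqnorm hunit_adj hunit_tr_sq. Qed.

Lemma seed_seq_orthogonal :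
  orthogonal_family (in_tuple seed_seq) (fun i => sqnorm (tnth (in_tuple seed_seq) i)).
Proof.
have [s1 s2 t1 t2 t12 q1 q2 N10 N20 _ _ _ _] := sd.
apply: orthogonal_seq.
  rewrite /= sqnorm1 (sqnorm_cpx s1) (sqnorm_cpx s2) q1 q2 pnatr_eq0 -lt0n n0 !fmorph_eq0 N10 N20 /=.
  by apply/allP => _ /mapP[p pF ->]; rewrite sqnorm_hunit ?F_off // pnatr_eq0.
rewrite /= adjmx1 (adjmx_cpx s1) (adjmx_cpx s2) !mul1mx -map_mxM !mxtrace_cpx t1 t2 t12 rmorph0 eqxx /=.
apply/and4P; split.
- by apply/allP => _ /mapP[p pF ->]; rewrite mul1mx hunit_tr ?F_off.
- apply/allP => _ /mapP[p pF ->]; rewrite mxtrace_mulC hunit_cpx // => lt_p.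
  by have [] := F_free pF lt_p.
- apply/allP => _ /mapP[p pF ->]; rewrite mxtrace_mulC hunit_cpx // => lt_p.
  by have [] := F_free pF lt_p.
- rewrite pairwise_map; have := F_uniq; rewrite uniq_pairwise.
  apply: (sub_in_pairwise (P := mem F)) => [p q pF qF /= pq|]; last exact/allP.
  by rewrite hunit_adj hunit_orth ?F_off.
Qed.

Definition seed_op (x : M) : M :=
  n%:R^-1 *: x + (rc N1^-1 *: (cpx Z1 *m x *m cpx Z1) +
  (rc N2^-1 *: (cpx Z2 *m x *m cpx Z2) + \sum_(p <- F) 2%:R^-1 *: (hunit R p *m x *m hunit R p))).

Lemma seed_opE x i j : seed_op x i j =
  n%:R^-1 * x i j + (rc N1^-1 * (cpx Z1 *m x *m cpx Z1) i j +
  (rc N2^-1 * (cpx Z2 *m x *m cpx Z2) i j +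
   2%:R^-1 * \sum_(p <- F) (hunit R p *m x *m hunit R p) i j)).
Proof.
have addE (A B : M) : (A + B) i j = A i j + B i j by rewrite mxE.
rewrite /seed_op !addE summxE mulr_sumr; congr (_ + (_ + (_ + _))).
- by rewrite [LHS]mxE.
- by rewrite [LHS]mxE.
- by rewrite [LHS]mxE.
- by apply: eq_bigr => p _; rewrite [LHS]mxE.
Qed.

Definition seed_proj : M -> M :=
  family_proj (in_tuple seed_seq) (fun i => sqnorm (tnth (in_tuple seed_seq) i)).

Lemma seed_projP : is_proj <<seed_seq>>%VS seed_proj.
Proof. exact: family_proj_is_proj seed_seq_orthogonal. Qed.

Lemma adj_of_seed_proj x : adj_of seed_proj x = seed_op x.
Proof.
have [s1 s2 _ _ _ q1 q2 _ _ _ _ _ _] := sd.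
rewrite orthogonal_seq_adj_of !big_cons big_map /seed_op !fmorphV.
rewrite sqnorm1 (sqnorm_cpx s1) (sqnorm_cpx s2) q1 q2 adjmx1 (adjmx_cpx s1) (adjmx_cpx s2).
rewrite mul1mx mulmx1.
congr (_ + (_ + (_ + _))); apply: eq_big_seq => p pF.
by rewrite hunit_adj (sqnorm_hunit (F_off pF)).
Qed.

(** The degree of i in the multigraph with edge list F. By [hunit_sq], an edge, of squared norm 2,
    adds 1/2 to [seed_op 1%:M] at each of its ends. *)
Definition seed_deg (i : 'I_n) : nat := \sum_(p <- F) ((p.1 == i) + (p.2 == i)).
Definition seed_val (i : 'I_n) : R := n%:R^-1 + s i + (seed_deg i)%:R / 2%:R.

Lemma seed_op1 : seed_op 1%:M = diag_mx (\row_i rc (seed_val i)).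
Proof.
have sdg := seed_diag sd.
apply/matrixP=> i j; rewrite seed_opE !mulmx1.
have E : N1^-1 * (Z1 *m Z1) i j + N2^-1 * (Z2 *m Z2) i j = s i *+ (i == j).
  have := congr1 (fun A : 'M[R]_n => A i j) sdg.
  by rewrite [RHS]mxE [in RHS]mxE => <-; rewrite [RHS]mxE; congr (_ + _); rewrite [RHS]mxE.
have cpxE a (Z : 'M[R]_n) : rc a * (cpx Z *m cpx Z) i j = rc (a * (Z *m Z) i j).
  by rewrite -map_mxM [X in _ * X]mxE [RHS]rmorphM.
rewrite !cpxE [X in _ + X]addrA -rmorphD E.
have -> : \sum_(p <- F) (hunit R p *m 1%:M *m hunit R p) i j = (seed_deg i)%:R *+ (i == j) :> C.
  rewrite /seed_deg natr_sum -sumrMnl; apply: eq_big_seq => p pF.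
  rewrite mulmx1 (hunit_sq _ (F_off pF)) !mxE !(eq_sym i) !(eq_sym j).
  have [<-|ij] := altP (i =P j).
    by rewrite mulr1n !andbb natrD.
  have -> : (p.1 == i) && (p.1 == j) = false.
    by apply/negbTE; apply: contraNN ij => /andP[/eqP<-].
  have -> : (p.2 == i) && (p.2 == j) = false.
    by apply/negbTE; apply: contraNN ij => /andP[/eqP<-].
  by rewrite addr0 mulr0n.
rewrite !mxE; case: (i == j); last by rewrite !mulr0n rmorph0 !mulr0 !addr0.
rewrite !mulr1n mulr1 /seed_val !rmorphD rmorphM fmorphV rmorph_nat fmorphV rmorph_nat.
by rewrite rmorph_nat addrA; congr (_ + _); rewrite mulrC.
Qed.

(** Different degrees shift two entries apart by at least 1/2, more than [seed_close] lets s
    compensate; equal degrees reduce to [seed_inj]. *)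
Lemma seed_val_inj : injective seed_val.
Proof.
move=> i j; rewrite /seed_val => E; apply: (seed_inj sd).
have := seed_close sd i j; rewrite ltr_norml => /andP[c1 c2].
have [lt|lt|eq_ij] := ltngtP (seed_deg i) (seed_deg j).
- have : (seed_deg i)%:R + 1 <= (seed_deg j)%:R :> R by rewrite natr1 ler_nat.
  lra.
- have : (seed_deg j)%:R + 1 <= (seed_deg i)%:R :> R by rewrite natr1 ler_nat.
  lra.
- by rewrite eq_ij in E; lra.
Qed.

(** A unit h contributes [h i k * h k j], and both factors are non-zero only if i and j are the same
    other end of its edge; so off the diagonal only the seed matrices are seen. *)
Lemma seed_op_delta (i j k : 'I_n) : i != j ->
  seed_op (delta_mx k k) i j = rc (N1^-1 * (Z1 i k * Z1 j k) + N2^-1 * (Z2 i k * Z2 j k)).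
Proof.
move=> ij; have [s1 s2 _ _ _ _ _ _ _ _ _ _ _] := sd.
have MdM (A B : M) : (A *m delta_mx k k *m B) i j = A i k * B k j.
  rewrite mxE (bigD1 k) //= big1 => [|l lk]; rewrite mulmx_deltaE ?eqxx ?mulr1 ?addr0 //.
  by rewrite eq_sym (negPf lk) mulr0 mul0r.
rewrite seed_opE [X in X + _](_ : _ = 0); last first.
  rewrite delta_mxE [k == _]eq_sym.
  by have [<-|] := altP (i =P k); rewrite ?mul0r ?mulr0 // (negPf ij) !mulr0.
rewrite add0r big1 => [|p _]; last first.
  rewrite MdM !hunitE; case: p => a b /=.
  have [ai|_] := eqVneq a i; have [ak|_] := eqVneq a k; have [bi|_] := eqVneq b i;
  have [bk|_] := eqVneq b k; have [aj|_] := eqVneq a j; have [bj|_] := eqVneq b j;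
  rewrite /= ?(mulr0, mul0r, addr0) //; by move: ij; subst; rewrite eqxx.
rewrite !MdM !mxE mulr0 addr0.
have -> : Z1 k j = Z1 j k by rewrite -{1}s1 mxE.
have -> : Z2 k j = Z2 j k by rewrite -{1}s2 mxE.
by rewrite rmorphD !rmorphM.
Qed.

Lemma seed_gen x : gen (adj_of seed_proj) x.
Proof.
have genop y : gen (adj_of seed_proj) y -> gen (adj_of seed_proj) (seed_op y).
  by rewrite -adj_of_seed_proj; apply: genT.
have gd i : gen (adj_of seed_proj) (delta_mx i i).
  apply: (@gen_delta _ _ _ (fun i => rc (seed_val i))).
    by move=> a b /fmorph_inj /seed_val_inj.
  by rewrite -seed_op1; apply: genop; apply: gen1.
apply: gen_all => // i i0; have [j [ji [k c0]]] := seed_link sd i0.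
exists j => //; have ij : i != j by apply: contraTneq ji => ->; rewrite ltnn.
(* Cutting with diagonal matrix units isolates a single entry; if it is non-zero, it yields e_ab. *)
have dOd a b : delta_mx a a *m seed_op (delta_mx k k) *m delta_mx b b
    = seed_op (delta_mx k k) a b *: delta_mx a b.
  apply/matrixP=> l m; rewrite mulmx_deltaE mxE (bigD1 a) //= big1 => [|q qa].
    by rewrite delta_mxE eqxx mulr1 addr0 [RHS]mxE delta_mxE mulrA [X in X * _]mulrC.
  by rewrite delta_mxE [a == q]eq_sym (negPf qa) mulr0 mul0r.
have genab (a b : 'I_n) : seed_op (delta_mx k k) a b != 0 ->
    gen (adj_of seed_proj) (delta_mx a b).
  move=> ab0; rewrite -[delta_mx a b]scale1r -(mulVf ab0) -scalerA -dOd.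
  by apply: genZ; apply: genM => //; apply: genM => //; apply: genop.
split; apply: genab.
  by rewrite seed_op_delta // fmorph_eq0.
have ji' : j != i by rewrite eq_sym.
by rewrite seed_op_delta // fmorph_eq0 [Z1 j k * _]mulrC [Z2 j k * _]mulrC.
Qed.

Lemma seed_rigid : exists2 W : {vspace M},
  grassmannian_sa (size F).+2 W & rigid_space W.
Proof.
pose t : seq M := [:: cpx Z1, cpx Z2 & map (@hunit R n) F].
have [s1 s2 _ _ _ _ _ _ _ _ _ _ _] := sd.
have fr : free (1%:M :: t) := orthogonal_free seed_seq_orthogonal.
move: (fr); rewrite free_cons => /andP[one_t free_t].
exists <<t>>%VS.
  split; last by move/eqP: free_t => ->; rewrite /= size_map.
  have : forall y, y \in t -> adjmx y \in <<t>>%VS.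
    move=> y yt; have -> : adjmx y = y; last exact: memv_span.
    move: yt; rewrite !inE => /or3P[/eqP->|/eqP->|/mapP[p _ ->]];
      by rewrite ?adjmx_cpx ?hunit_adj.
  move=> h x; apply: (@span_tuple_ind _ _ _ (in_tuple t) (fun x => adjmx x \in <<t>>%VS)).
  - by rewrite adjmx0 mem0v.
  - by move=> c y z hy hz; rewrite adjmxD adjmxZ rpredD // rpredZ.
  - by move=> i; apply: h; apply: mem_tnth.
split=> //; exists seed_proj; last exact: seed_gen.
by rewrite -span_cons; apply: seed_projP.
Qed.

End SeedRigid.
End Seed.

(** * Seeds *)

Section SmallSeeds.
Variable R : realType.

(* The path construction below needs [4 < n]: its diagonals are not orthogonal
   for [n = 3], and two entries of [s] differ by at least 1/2 for [n = 4]. *)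
Definition z3a (i j : nat) : R := match i, j with
  | 0, 0 => - 9%:R | 1, 1 => 9%:R | 0, 1 | 1, 0 => 12%:R | 0, 2 | 2, 0 => 20%:R | _, _ => 0 end.
Definition z3b (i j : nat) : R := match i, j with
  | 0, 0 => 16%:R | 1, 1 => - 16%:R | 0, 1 | 1, 0 => 12%:R | 1, 2 | 2, 1 => 15%:R | _, _ => 0 end.
Definition s3 (i : nat) : R := match i with 0 => 41%:R / 50%:R | 1 => 34%:R / 50%:R | _ => 25%:R / 50%:R end.

Ltac ord_cases i := case: i => [[|[|[|[|i]]]] //= ?].

(** Neither square is diagonal here: at (0, 2) and (1, 2) the squares have the entries -180, 240 and
    180, -240, which cancel because both squared norms are 1250. *)
Lemma seed3 : seed (\matrix_(i < 3, j < 3) z3a i j) (\matrix_(i < 3, j < 3) z3b i j)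
  1250%:R 1250%:R (fun i : 'I_3 => s3 i).
Proof.
split.
- by apply/matrixP=> i j; rewrite !mxE; ord_cases i; ord_cases j.
- by apply/matrixP=> i j; rewrite !mxE; ord_cases i; ord_cases j.
- by rewrite /mxtrace !big_ord_recl big_ord0 !mxE /=; ring.
- by rewrite /mxtrace !big_ord_recl big_ord0 !mxE /=; ring.
- by rewrite /mxtrace !big_ord_recl big_ord0 !mxE !big_ord_recl !big_ord0 !mxE /=; ring.
- by rewrite /mxtrace !big_ord_recl big_ord0 !mxE !big_ord_recl !big_ord0 !mxE /=; ring.
- by rewrite /mxtrace !big_ord_recl big_ord0 !mxE !big_ord_recl !big_ord0 !mxE /=; ring.
- by rewrite pnatr_eq0.
- by rewrite pnatr_eq0.
- apply/matrixP=> i j; rewrite !mxE !big_ord_recl !big_ord0 !mxE.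
  by ord_cases i; ord_cases j; rewrite /s3 /=; lra.
- move=> i j; ord_cases i; ord_cases j; rewrite /s3 => E; try (exfalso; lra); exact: val_inj.
- move=> i j; rewrite ltr_norml; ord_cases i; ord_cases j; rewrite /s3; lra.
- move=> i; ord_cases i => _.
  + exists ord0; split=> //; exists ord0; rewrite !mxE /=; apply/eqP; lra.
  + exists ord0; split=> //; exists ord0; rewrite !mxE /=; apply/eqP; lra.
Qed.

(** The block pattern of the path, with edges (0, 1), (2, 3) here and (1, 2) in [z4b]. The entries 2
    and -2 that [z4b] has at its unmatched vertices, instead of 0, bring the entries of s within 1/2
    of each other. *)
Definition z4a (i j : nat) : R := match i, j with
  | 0, 0 => - 1 | 1, 1 => 1 | 2, 2 => 1 | 3, 3 => - 1
  | 0, 1 | 1, 0 => 1 | 2, 3 | 3, 2 => 3%:R | _, _ => 0 end.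
Definition z4b (i j : nat) : R := match i, j with
  | 0, 0 => 2%:R | 1, 1 => 1 | 2, 2 => - 1 | 3, 3 => - 2%:R
  | 1, 2 | 2, 1 => 2%:R | _, _ => 0 end.
Definition s4 (i : nat) : R := match i with
  | 0 => 22%:R / 72%:R | 1 => 26%:R / 72%:R | 2 => 50%:R / 72%:R | _ => 46%:R / 72%:R end.

Lemma seed4 : seed (\matrix_(i < 4, j < 4) z4a i j) (\matrix_(i < 4, j < 4) z4b i j)
  24%:R 18%:R (fun i : 'I_4 => s4 i).
Proof.
split.
- by apply/matrixP=> i j; rewrite !mxE; ord_cases i; ord_cases j.
- by apply/matrixP=> i j; rewrite !mxE; ord_cases i; ord_cases j.
- by rewrite /mxtrace !big_ord_recl big_ord0 !mxE /=; ring.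
- by rewrite /mxtrace !big_ord_recl big_ord0 !mxE /=; ring.
- by rewrite /mxtrace !big_ord_recl big_ord0 !mxE !big_ord_recl !big_ord0 !mxE /=; ring.
- by rewrite /mxtrace !big_ord_recl big_ord0 !mxE !big_ord_recl !big_ord0 !mxE /=; ring.
- by rewrite /mxtrace !big_ord_recl big_ord0 !mxE !big_ord_recl !big_ord0 !mxE /=; ring.
- by rewrite pnatr_eq0.
- by rewrite pnatr_eq0.
- apply/matrixP=> i j; rewrite !mxE !big_ord_recl !big_ord0 !mxE.
  by ord_cases i; ord_cases j; rewrite /s4 /=; lra.
- move=> i j; ord_cases i; ord_cases j; rewrite /s4 => E; try (exfalso; lra); exact: val_inj.
- move=> i j; rewrite ltr_norml; ord_cases i; ord_cases j; rewrite /s4; lra.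
- move=> i; ord_cases i => _.
  + exists ord0; split=> //; exists ord0; rewrite !mxE /=; apply/eqP; lra.
  + exists (Ordinal (isT : (1 < 4)%N)); split=> //; exists (Ordinal (isT : (1 < 4)%N)); rewrite !mxE /=; apply/eqP; lra.
  + exists (Ordinal (isT : (2 < 4)%N)); split=> //; exists (Ordinal (isT : (2 < 4)%N)); rewrite !mxE /=; apply/eqP; lra.
Qed.

End SmallSeeds.

(** * Matchings of a path and the integers that control the diagonal of A(1) *)

Section PathCombinatorics.
Local Open Scope nat_scope.

(* The path [0 - 1 - ... - (n-1)] split into two matchings: [pair1] and [pair2]
   exchange the ends of the edges [(e, e+1)] with [e] even, resp. odd. *)
Definition pair1 (n i : nat) := if odd i then i.-1 else if i.+1 < n then i.+1 else i.
Definition pair2 (n i : nat) := if odd i then (if i.+1 < n then i.+1 else i) else i.-1.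

(** The k-th edge of either matching gets the weight n^2 + k. The base n^2 exceeds the squares of
    the later diagonal entries, at most n - 3 in absolute value, and k separates the vertices. *)
Definition weight1 (n i : nat) := if pair1 n i == i then 0 else n * n + i./2.
Definition weight2 (n i : nat) := if pair2 n i == i then 0 else n * n + i.-1./2.

Lemma pair1_lt n i : i < n -> pair1 n i < n.
Proof. rewrite /pair1; repeat case: ifP; lia. Qed.
Lemma pair2_lt n i : i < n -> pair2 n i < n.
Proof. rewrite /pair2; repeat case: ifP; lia. Qed.
Lemma pair1K n i : i < n -> pair1 n (pair1 n i) = i.
Proof.
rewrite /pair1 => lt_i; case: (boolP (odd i)) => oi; [|case: (boolP (i.+1 < n)) => lt_i1];
  repeat case: ifP; lia.
Qed.
Lemma pair2K n i : i < n -> pair2 n (pair2 n i) = i.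
Proof.
rewrite /pair2 => lt_i; case: (boolP (odd i)) => oi; [case: (boolP (i.+1 < n)) => lt_i1|];
  repeat case: ifP; lia.
Qed.
Lemma pair12 n i : i < n -> pair1 n i = pair2 n i -> pair1 n i = i.
Proof. rewrite /pair1 /pair2; repeat case: ifP; lia. Qed.

Lemma weight1_pair n i : i < n -> weight1 n (pair1 n i) = weight1 n i.
Proof. by move=> ltin; rewrite /weight1 pair1K //; rewrite /pair1; repeat case: ifP; lia. Qed.
Lemma weight2_pair n i : i < n -> weight2 n (pair2 n i) = weight2 n i.
Proof. by move=> ltin; rewrite /weight2 pair2K //; rewrite /pair2; repeat case: ifP; lia. Qed.

Lemma weight1_in n i : i.+1 < n -> weight1 n i = n * n + i./2.
Proof. rewrite /weight1 /pair1; repeat case: ifP; lia. Qed.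
Lemma weight2_in n i : 0 < i -> i.+1 < n -> weight2 n i = n * n + i.-1./2.
Proof. rewrite /weight2 /pair2; repeat case: ifP; lia. Qed.
Lemma weight2_0 n : weight2 n 0 = 0. Proof. by []. Qed.
Lemma weight_last n : 4 < n ->
  (weight1 n n.-1 = n * n + n.-2./2 /\ weight2 n n.-1 = 0) \/
  (weight1 n n.-1 = 0 /\ weight2 n n.-1 = n * n + n.-2./2).
Proof. rewrite /weight1 /weight2 /pair1 /pair2; repeat case: ifP; lia. Qed.
Lemma weight1_le n i : weight1 n i <= n * n + i.
Proof. rewrite /weight1; case: ifP; lia. Qed.
Lemma weight2_le n i : weight2 n i <= n * n + i.
Proof. rewrite /weight2; case: ifP; lia. Qed.
Lemma weight2_shift n i : i.+1 < n -> weight2 n i.+1 <= weight1 n i.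
Proof. rewrite /weight1 /weight2 /pair1 /pair2; repeat case: ifP; lia. Qed.

Definition total1 n := \sum_(i < n) weight1 n i.
Definition total2 n := \sum_(i < n) weight2 n i.

(** Compare vertex i + 1 in the second matching with vertex i in the first; vertex 0 is unmatched in
    the second. *)
Lemma total2_le n : 0 < n -> total2 n <= total1 n.
Proof.
case: n => // n _; rewrite /total2 /total1 big_ord_recl [X in _ <= X]big_ord_recr /=.
rewrite weight2_0 add0n; apply: leq_trans (leq_addr _ _).
by apply: leq_sum => i _; apply: weight2_shift; case: i.
Qed.

(** The edges (1, 2) and (3, 4) of the second matching have four ends of weight at least n^2. *)
Lemma total2_ge n : 4 < n -> 4 * (n * n) <= total2 n.
Proof.
case: n => [|[|[|[|[|n]]]]] // _; rewrite /total2 5!big_ord_recl /= /bump /= !add1n.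
set rest := \sum_(i < _) _; move: rest => rest.
have := @weight2_in n.+4.+1 1; have := @weight2_in n.+4.+1 2; have := @weight2_in n.+4.+1 3.
have : n.+4.+1 * n.+4.+1 <= weight2 n.+4.+1 4 by rewrite /weight2 /pair2 /=; lia.
move: (n.+4.+1 * n.+4.+1) => N h4 h3 h2 h1.
rewrite h1 // h2 // h3 //; lia.
Qed.

Lemma total1_le n : total1 n <= n * (n * n + n).
Proof.
rewrite -[X in X * _]card_ord -sum_nat_const; apply: leq_sum => i _.
by apply: leq_trans (weight1_le _ _) _; rewrite leq_add2l ltnW.
Qed.

(** The sum of the two weights of i, each divided by its total, with denominators cleared: the entry
    s i of the seed times [total1 n * total2 n]. *)
Definition level n i := weight1 n i * total2 n + weight2 n i * total1 n.

(** Along the path one of [i./2] and [i.-1./2] grows at each step and the other does not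
    decrease. *)
Lemma level_lt n i j : 4 < n -> i < j -> j < n.-1 -> level n i < level n j.
Proof.
move=> n4 ij jn; have n0 : 0 < n by lia.
have jn' : j.+1 < n by lia.
have in' : i.+1 < n by lia.
have := total2_ge n4; have := total2_le n0; rewrite /level.
move: (total1 n) (total2 n) => U V VU V4; rewrite !weight1_in //.
have V0 : 0 < V by nia.
rewrite (@weight2_in n j) //; last by lia.
have [->|i0] := posnP i; first by rewrite weight2_0; nia.
rewrite weight2_in //.
have h1 : i./2 <= j./2 by lia.
have h2 : i.-1./2 <= j.-1./2 by lia.
have h3 : i./2 < j./2 \/ i.-1./2 < j.-1./2 by lia.
move: (i./2) (j./2) (i.-1./2) (j.-1./2) h1 h2 h3 => a b c d h1 h2 h3.
by case: h3 => h3; nia.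
Qed.

(** The ends 0 and n - 1 lie on one edge each, so the last vertex breaks the monotony of [level_lt];
    its level falls into the gap between those of 0 and 1. *)
Lemma level_last n : 4 < n -> level n 0 < level n n.-1 < level n 1.
Proof.
move=> n4; have n0 : 0 < n by lia.
have := total1_le n; have := total2_ge n4; have := total2_le n0; rewrite /level.
move: (total1 n) (total2 n) => U V VU V4 UM.
rewrite (@weight1_in n 0) ?(@weight1_in n 1) ?(@weight2_in n 1) ?weight2_0 //; try lia.
have h1 : 0 < n.-2./2 by lia.
have h2 : 2 * (n.-2./2) <= n by lia.
have [[-> ->]|[-> ->]] := weight_last n4; move: (n.-2./2) h1 h2 => h h1 h2; rewrite /=.
  by apply/andP; split; nia.
(* Here the last edge belongs to the second matching, and (n^2 + h) U has to stay below n^2 (U + V);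
   the cubic upper bound on U and V >= 4 n^2 suffice. *)
have hU : h * U < n * n * V.
  have h3 : 2 * (h * U) <= n * n * (n * n + n) by have := leq_mul h2 UM; lia.
  have h4 : n <= n * n by nia.
  have h5 : 0 < n * n by nia.
  move: (n * n) h3 h4 h5 V4 => N h3 h4 h5 V4.
  by clear - h3 h4 h5 V4; nia.
by apply/andP; split; nia.
Qed.

Lemma level_ge n j : 4 < n -> j < n -> n * n * total2 n <= level n j.
Proof.
move=> n4 jn; have n0 : 0 < n by lia.
have [jn1|jn1] := ltnP j n.-1.
  by rewrite /level weight1_in ?mulnDl -?addnA ?leq_addr //; lia.
have -> : j = n.-1 by lia.
case/andP: (level_last n4) => h _; apply: leq_trans (ltnW h).
by rewrite /level weight1_in ?mulnDl -?addnA ?leq_addr //; lia.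
Qed.

(** The bound 1/2 of [seed_close]. With U, V the totals, levels lie between n^2 V and (n^2 + n)(U +
    V), so twice a difference is at most 2 n^2 U + 4 n U, which is below U V because V >= 4 n^2. *)
Lemma level_close n i j : 4 < n -> i < n -> j < n ->
  2 * level n i < 2 * level n j + total1 n * total2 n.
Proof.
move=> n4 lt_i lt_j; have n0 : 0 < n by lia.
have := level_ge n4 lt_j.
have := total2_ge n4; have := total2_le n0.
have : level n i <= (n * n + n) * (total1 n + total2 n).
  rewrite /level mulnDr addnC; apply: leq_add; apply: leq_mul => //.
    by apply: leq_trans (weight2_le _ _) _; lia.
  by apply: leq_trans (weight1_le _ _) _; lia.
move: (total1 n) (total2 n) (level n i) (level n j) => U V a b ha VU V4 hb.
have : n * 5 <= n * n by nia.
move: (n * n) V4 hb ha => N V4 hb ha hN.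
have : 2 * N * U + 4 * n * U < U * V by nia.
nia.
Qed.

Lemma level_inj n i j : 4 < n -> i < n -> j < n -> level n i = level n j -> i = j.
Proof.
move=> n4; wlog ij : i j / i < j.
  move=> W lt_i lt_j E; have [lt|lt|//] := ltngtP i j; first exact: W.
  by apply/esym/W.
move=> lt_i lt_j E; have [jn|jn] := ltnP j n.-1.
  by have := level_lt n4 ij jn; rewrite E ltnn.
have jE : j = n.-1 by lia.
have /andP[h0 h1] := level_last n4; rewrite jE in E ij.
have [i0|i0] := posnP i; first by move: h0; rewrite -E i0 ltnn.
have [i1|i1] := eqVneq i 1; first by move: h1; rewrite -E i1 ltnn.
have : level n 1 < level n i by apply: level_lt; lia.
by rewrite E => h2; lia.
Qed.

End PathCombinatorics.

(** * Symmetric matrices with prescribed diagonal and prescribed diagonal square *)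

Section PairMatrix.
Variables (R : realType) (n : nat).

(* Direct sum, along the orbits of an involution, of blocks
   [[p, alpha], [alpha, -p]], whose square is scalar. *)
Record pairing (f : 'I_n -> 'I_n) (p w : 'I_n -> R) : Prop := {
  pairingK : involutive f;
  pairing_p : forall i, p (f i) = - p i;
  pairing_w : forall i, w (f i) = w i;
  pairing_le : forall i, p i ^+ 2 <= w i;
  pairing_fix : forall i, f i = i -> w i = 0
}.

(** The off-diagonal entry for which the block of i squares to the scalar [w i]. *)
Definition pair_off (p w : 'I_n -> R) (i : 'I_n) : R := Num.sqrt (w i - p i ^+ 2).

Definition pair_mx f (p w : 'I_n -> R) : 'M[R]_n :=
  \matrix_(i, j) (p i *+ (i == j) + pair_off p w i *+ (j == f i)).

Section Pairing.
Variables (f : 'I_n -> 'I_n) (p w : 'I_n -> R).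
Hypothesis hf : pairing f p w.
Local Notation al := (pair_off p w).
Local Notation Z := (pair_mx f p w).

Lemma pair_off_pair i : al (f i) = al i.
Proof. by rewrite /pair_off (pairing_w hf) (pairing_p hf) sqrrN. Qed.

Lemma pair_p_fix i : f i = i -> p i = 0.
Proof.
move=> fi; have := pairing_p hf i; rewrite fi => /eqP; rewrite -subr_eq0 opprK -mulr2n.
by rewrite mulrn_eq0 => /eqP.
Qed.

Lemma pair_off_fix i : f i = i -> al i = 0.
Proof.
by move=> fi; rewrite /pair_off (pairing_fix hf fi) pair_p_fix // expr0n subrr sqrtr0.
Qed.

Lemma pair_mx_sym : Z^T = Z.
Proof.
apply/matrixP=> i j; rewrite !mxE [j == i]eq_sym; have [->|ij] := eqVneq i j => //=.
rewrite !mulr0n !add0r; have -> : (i == f j) = (j == f i).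
  by apply/eqP/eqP => ->; rewrite (pairingK hf).
by have [->|_] := eqVneq j (f i); rewrite // pair_off_pair.
Qed.

Lemma pair_mx_row i (g : 'I_n -> R) : \sum_k Z i k * g k = p i * g i + al i * g (f i).
Proof.
transitivity (\sum_k (p i * g k *+ (k == i) + al i * g k *+ (k == f i))).
  apply: eq_bigr => k _; rewrite mxE mulrDl [i == k]eq_sym.
  by rewrite -!mulrnAl.
rewrite big_split /=; congr (_ + _).
  by rewrite (bigD1 i) //= eqxx mulr1n big1 ?addr0 // => k /negPf ->; rewrite mulr0n.
by rewrite (bigD1 (f i)) //= eqxx mulr1n big1 ?addr0 // => k /negPf ->; rewrite mulr0n.
Qed.

Lemma pair_mx_tr : \tr Z = 0.
Proof.
have S0 : \sum_i p i = 0.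
  have E : \sum_i p i = - \sum_i p i.
    rewrite [LHS](reindex_inj (inv_inj (pairingK hf))) -sumrN /=.
    by apply: eq_bigr => i _; rewrite (pairing_p hf).
  by apply/eqP; rewrite -[_ == 0](mulrn_eq0 _ 2) mulr2n {1}E addNr.
rewrite -[RHS]S0; apply: eq_bigr => i _; rewrite mxE eqxx mulr1n.
by have [/esym/pair_off_fix ->|_] := eqVneq i (f i); rewrite ?mul0rn ?mulr0n addr0.
Qed.

Lemma pair_mx_sq : Z *m Z = diag_mx (\row_i w i).
Proof.
apply/matrixP=> i j; rewrite mxE pair_mx_row !mxE pair_off_pair (pairing_p hf) (pairingK hf).
have al2 : al i * al i = w i - p i ^+ 2.
  by rewrite -expr2 sqr_sqrtr // subr_ge0 (pairing_le hf).
rewrite [f i == j]eq_sym [i == j]eq_sym.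
have [ji|ji] := eqVneq j i; have [jf|jf] := eqVneq j (f i); rewrite /= ?mulr1n ?mulr0n.
- have fi : f i = i by rewrite -jf.
  by rewrite pair_off_fix // pair_p_fix // (pairing_fix hf fi) !mul0r addr0.
- by rewrite add0r addr0 al2 -expr2 addrC subrK.
- by rewrite add0r addr0 mulrN mulrC subrr.
- by rewrite !addr0 !mulr0 addr0.
Qed.

Lemma pair_mx_diag i : Z i i = p i.
Proof.
rewrite mxE eqxx mulr1n.
by have [/esym/pair_off_fix ->|_] := eqVneq i (f i); rewrite ?mul0rn ?mulr0n addr0.
Qed.

Lemma pair_mx_off i j : i != j -> j != f i -> Z i j = 0.
Proof. by move=> /negPf ij /negPf jf; rewrite mxE ij jf addr0. Qed.

Lemma pair_mx_pair i : f i != i -> Z (f i) i = al i.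
Proof. by move=> /negPf fi; rewrite mxE fi (pairingK hf) eqxx pair_off_pair add0r. Qed.

End Pairing.

(** The two matchings have no common edge, so only the diagonals meet in the trace. *)
Lemma pair_mx_tr2 f g p q w v : pairing f p w -> pairing g q v ->
  (forall i, f i = g i -> f i = i) ->
  \tr (pair_mx f p w *m pair_mx g q v) = \sum_i p i * q i.
Proof.
move=> hf hg fg; apply: eq_bigr => i _.
rewrite mxE (pair_mx_row f p w i (fun k => pair_mx g q v k i)) (pair_mx_diag hg).
have [fi|fi] := eqVneq (f i) i; first by rewrite (pair_off_fix hf fi) mul0r addr0.
rewrite pair_mx_off ?mulr0 ?addr0 //; apply: contraNneq fi => E.
by apply/eqP/fg; rewrite {2}E (pairingK hg).
Qed.

End PairMatrix.

(** * The seed built on the path *)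

Section PathSeed.
Variables (R : realType) (n : nat).
Hypothesis n4 : (4 < n)%N.

Definition path_f1 (i : 'I_n) : 'I_n := Ordinal (pair1_lt (ltn_ord i)).
Definition path_f2 (i : 'I_n) : 'I_n := Ordinal (pair2_lt (ltn_ord i)).

(* The entry [n - 3] makes the two diagonals orthogonal. *)
Definition path_p1 (i : nat) : R :=
  if pair1 n i == i then 0 else
  if i == 0%N then - (n - 3)%:R else if i == 1%N then (n - 3)%:R else (-1) ^+ i.
Definition path_p2 (i : nat) : R := if pair2 n i == i then 0 else (-1) ^+ i.+1.

(** Strict at matched vertices, so that the off-diagonal entries of the blocks do not vanish and can
    serve as links. *)
Lemma sqr_path_p1 i : (i < n)%N -> path_p1 i != 0 \/ (0 < weight1 n i)%N ->
  path_p1 i ^+ 2 < (weight1 n i)%:R.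
Proof.
move=> lt_i; rewrite /path_p1 /weight1; case: (pair1 n i == i); first by rewrite eqxx => -[].
move=> _; have b : ((n - 3)%:R ^+ 2 : R) < (n * n + i./2)%:R.
  by rewrite -natrX ltr_nat; nia.
case: ifP => _; first by rewrite sqrrN.
case: ifP => _ //; rewrite sqrr_sign (_ : 1 = 1%:R) // ltr_nat; nia.
Qed.

Lemma sqr_path_p2 i : (i < n)%N -> path_p2 i != 0 \/ (0 < weight2 n i)%N ->
  path_p2 i ^+ 2 < (weight2 n i)%:R.
Proof.
move=> lt_i; rewrite /path_p2 /weight2; case: (pair2 n i == i); first by rewrite eqxx => -[].
by move=> _; rewrite sqrr_sign (_ : 1 = 1%:R) // ltr_nat; nia.
Qed.

Lemma signr_flip a b : odd a = ~~ odd b -> (-1) ^+ a = - (-1) ^+ b :> R.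
Proof.
have E c : (-1) ^+ c = if odd c then -1 else 1 :> R by rewrite -signr_odd; case: (odd c).
by rewrite !E => ->; case: (odd b); rewrite ?opprK.
Qed.

Lemma path_pairing1 : pairing path_f1 (fun i => path_p1 i) (fun i : 'I_n => (weight1 n i)%:R).
Proof.
split.
- by move=> i; apply: val_inj; rewrite /= pair1K.
- move=> i; have lt_i := ltn_ord i; rewrite /= /path_p1 pair1K // [i == _ :> nat]eq_sym.
  case: (boolP (pair1 n i == i :> nat)) => [_|]; first by rewrite oppr0.
  case: (boolP (val i == 0%N)) => [/eqP i0|i0].
    have -> : pair1 n i = 1%N by rewrite /pair1 i0 /=; case: ifP; lia.
    by rewrite opprK.
  case: (boolP (val i == 1%N)) => [/eqP i1|i1]; first by rewrite /pair1 i1.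
  move=> fi; have i2 : (1 < i)%N by move: i0 i1; rewrite /=; case: (nat_of_ord i) => [|[]].
  have [E1 E2] : pair1 n i != 0%N /\ pair1 n i != 1%N.
    by clear - i2; rewrite /pair1; move: (nat_of_ord i) i2 => k k2; repeat case: ifP; lia.
  rewrite (negPf E1) (negPf E2); apply: signr_flip.
  by clear - i2 fi; move: fi i2; rewrite /pair1; move: (nat_of_ord i) => k; repeat case: ifP; lia.
- by move=> i; rewrite /= weight1_pair.
- move=> i; have [w0|w0] := posnP (weight1 n i).
    move: w0; rewrite /path_p1 /weight1; case: ifP => // _; first by rewrite expr0n.
    by nia.
  by apply/ltW/sqr_path_p1 => //; right.
- by move=> i /(congr1 val) /= fi; rewrite /weight1 fi eqxx.
Qed.

Lemma path_pairing2 : pairing path_f2 (fun i => path_p2 i) (fun i : 'I_n => (weight2 n i)%:R).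
Proof.
split.
- by move=> i; apply: val_inj; rewrite /= pair2K.
- move=> i; have lt_i := ltn_ord i; rewrite /= /path_p2 pair2K // [i == _ :> nat]eq_sym.
  case: (boolP (pair2 n i == i :> nat)) => [_|fi]; first by rewrite oppr0.
  apply: signr_flip; rewrite /=.
  by clear - fi; move: fi; rewrite /pair2; move: (nat_of_ord i) => k; repeat case: ifP; lia.
- by move=> i; rewrite /= weight2_pair.
- move=> i; have [w0|w0] := posnP (weight2 n i).
    move: w0; rewrite /path_p2 /weight2; case: ifP => // _; first by rewrite expr0n.
    by nia.
  by apply/ltW/sqr_path_p2 => //; right.
- by move=> i /(congr1 val) /= fi; rewrite /weight2 fi eqxx.
Qed.

(** Vertex 1 contributes n - 3, each of the n - 3 vertices from 2 to n - 2 contributes -1, and each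
    end is unmatched on one side. *)
Lemma path_orthogonal : \sum_(i < n) path_p1 i * path_p2 i = 0 :> R.
Proof.
have E i : (i < n)%N -> path_p1 i * path_p2 i =
   if i == 1%N then (n - 3)%:R else if (1 < i < n.-1)%N then -1 else 0 :> R.
  move=> lt_i; rewrite /path_p1 /path_p2.
  case: (boolP (i == 1%N)) => [/eqP ->|i1].
    have -> : (pair1 n 1 == 1) = false by [].
    have -> : (pair2 n 1 == 1) = false by rewrite /pair2 /=; case: ifP; lia.
    by rewrite /= expr2 mulrNN !mulr1.
  case: (boolP (1 < i < n.-1)%N) => h.
    have -> : (pair1 n i == i) = false by rewrite /pair1; repeat case: ifP; lia.
    have -> : (pair2 n i == i) = false by rewrite /pair2; repeat case: ifP; lia.
    have -> : (i == 0%N) = false by lia.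
    by rewrite exprS mulrCA -expr2 sqrr_sign mulr1.
  case: (altP (pair1 n i =P i)) => f1; first by rewrite mul0r.
  case: (altP (pair2 n i =P i)) => f2; first by rewrite mulr0.
  exfalso; move: f1 f2 h; rewrite /pair1 /pair2; repeat case: ifP; lia.
rewrite (eq_bigr _ (fun (i : 'I_n) _ => E i (ltn_ord i))) {E}.
case: n n4 => [|[|[|m]]] // _; rewrite 2!big_ord_recl big_ord_recr /= add0r.
rewrite /bump /= !add1n ltnn addr0.
under eq_bigr => i _ do rewrite !add1n /= !ltnS ltn_ord.
by rewrite sumr_const card_ord -addn3 addnK mulNrn subrr.
Qed.

Lemma path_seed : exists s, seed (pair_mx path_f1 (fun i => path_p1 i) (fun i => (weight1 n i)%:R))
  (pair_mx path_f2 (fun i => path_p2 i) (fun i => (weight2 n i)%:R))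
  (total1 n)%:R (total2 n)%:R s.
Proof.
have h1 := path_pairing1; have h2 := path_pairing2.
have n0 : (0 < n)%N by lia.
have V0 : (0 < total2 n)%N by have := total2_ge n4; nia.
have U0 : (0 < total1 n)%N := leq_trans V0 (total2_le n0).
have U0R : (total1 n)%:R != 0 :> R by rewrite pnatr_eq0 -lt0n.
have V0R : (total2 n)%:R != 0 :> R by rewrite pnatr_eq0 -lt0n.
pose s (i : 'I_n) : R := (total1 n)%:R^-1 * (weight1 n i)%:R + (total2 n)%:R^-1 * (weight2 n i)%:R.
have sE i : s i = (level n i)%:R / ((total1 n)%:R * (total2 n)%:R).
  by rewrite /s /level natrD !natrM; field; rewrite U0R V0R.
have UV0 : 0 < (total1 n)%:R * (total2 n)%:R :> R by rewrite mulr_gt0 ?ltr0n.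
exists s; split.
- exact: pair_mx_sym h1.
- exact: pair_mx_sym h2.
- exact: pair_mx_tr h1.
- exact: pair_mx_tr h2.
- rewrite (pair_mx_tr2 h1 h2) ?path_orthogonal // => i E; apply: val_inj.
  exact: pair12 (ltn_ord i) (congr1 val E).
- by rewrite (pair_mx_sq h1) mxtrace_diag /total1 natr_sum; apply: eq_bigr => i _; rewrite mxE.
- by rewrite (pair_mx_sq h2) mxtrace_diag /total2 natr_sum; apply: eq_bigr => i _; rewrite mxE.
- exact: U0R.
- exact: V0R.
- rewrite (pair_mx_sq h1) (pair_mx_sq h2); apply/matrixP=> i j; rewrite !mxE.
  by case: (i == j); rewrite ?mulr0n ?mulr0 ?addr0 // !mulr1n.
- move=> i j; rewrite !sE => /(mulIf (invr_neq0 (lt0r_neq0 UV0))) /eqP.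
  by rewrite eqr_nat => /eqP E; apply: val_inj; exact: level_inj n4 (ltn_ord i) (ltn_ord j) E.
- move=> i j; rewrite !sE -mulrBl normrM normfV (gtr0_norm UV0) ltr_pdivrMr //.
  rewrite ltr_norml; apply/andP; split.
  + have := level_close n4 (ltn_ord j) (ltn_ord i).
    rewrite -(ltr_nat R) natrD !natrM => h; lra.
  + have := level_close n4 (ltn_ord i) (ltn_ord j).
    rewrite -(ltr_nat R) natrD !natrM => h; lra.
(* Link i to i - 1 by the matching that contains this edge, with k = i: the entry is a diagonal
   times an off-diagonal entry of one block, and the other matrix has no entry on this edge. *)
- move=> i i0; have lt_i := ltn_ord i; have [oi|ei] := boolP (odd i).
    exists (path_f1 i); rewrite /= /pair1 oi; split; first by lia.
    have fi : path_f1 i != i by rewrite -val_eqE /= /pair1 oi; lia.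
    exists i; rewrite (pair_mx_diag h1) (pair_mx_pair h1 fi).
    rewrite (pair_mx_off _ _ fi) ?mulr0 ?addr0; last first.
      by rewrite -val_eqE /= /pair2 /pair1 oi; repeat case: ifP; lia.
    have p0 : path_p1 i != 0.
      rewrite /path_p1; have -> : (pair1 n i == i) = false by move: fi; rewrite -val_eqE /= => /negPf.
      have -> : (i == 0 :> nat)%N = false by rewrite eqn0Ngt i0.
      by case: ifP => _; rewrite ?signr_eq0 // pnatr_eq0; lia.
    rewrite !mulf_neq0 ?invr_neq0 // /pair_off sqrtr_eq0 -ltNge subr_gt0.
    by apply: sqr_path_p1 => //; left.
  exists (path_f2 i); rewrite /= /pair2 (negPf ei); split; first by lia.
  have fi : path_f2 i != i by rewrite -val_eqE /= /pair2 (negPf ei); lia.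
  exists i; rewrite (pair_mx_diag h2) (pair_mx_pair h2 fi).
  rewrite [pair_mx path_f1 _ _ (path_f2 i) i](pair_mx_off _ _ fi) ?mulr0 ?add0r; last first.
    by rewrite -val_eqE /= /pair2 /pair1 (negPf ei); repeat case: ifP; lia.
  have p0 : path_p2 i != 0.
    rewrite /path_p2; have -> : (pair2 n i == i) = false by move: fi; rewrite -val_eqE /= => /negPf.
    by rewrite signr_eq0.
  rewrite !mulf_neq0 ?invr_neq0 // /pair_off sqrtr_eq0 -ltNge subr_gt0.
  by apply: sqr_path_p2 => //; left.
Qed.

Lemma path_free (j : 'I_n) (i : 'I_n) : (i.+1 < j)%N ->
  pair_mx path_f1 (fun i => path_p1 i) (fun i => (weight1 n i)%:R) i j = 0 /\
  pair_mx path_f2 (fun i => path_p2 i) (fun i => (weight2 n i)%:R) i j = 0.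
Proof.
move=> ij; have ij' : i != j by rewrite -val_eqE neq_ltn (ltnW ij).
split; apply: pair_mx_off => //; rewrite -val_eqE /=.
  by move: (nat_of_ord i) (nat_of_ord j) ij => a b ab; rewrite /pair1; repeat case: ifP; lia.
by move: (nat_of_ord i) (nat_of_ord j) ij => a b ab; rewrite /pair2; repeat case: ifP; lia.
Qed.

End PathSeed.

(** * Existence of rigid systems *)

Section Existence.
Variable R : realType.
Local Notation C := (R[i]).

(** The units used as F: all imaginary ones, and for the path seeds also the real ones in row 0 that
    are not on the path. *)
Definition free_units (n : nat) (p : 'I_n * 'I_n) : bool :=
  (p.2 < p.1)%N || [&& (4 < n)%N, p.1 == 0%N :> nat & (1 < p.2)%N].

Definition unit_seq (n : nat) := [seq p <- enum {: 'I_n * 'I_n} | free_units p].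

Lemma size_unit_seq n :
  size (unit_seq n) = (\sum_(i < n) \sum_(j < n) (free_units (i, j) : nat))%N.
Proof.
rewrite size_filter -sum1_count big_mkcond big_enum /= pair_big /=.
by apply: eq_bigr => -[i j] _ /=; case: free_units.
Qed.

Lemma sum_ltn_ord n (i : 'I_n) : (\sum_(j < n) (j < i : nat) = i)%N.
Proof.
transitivity (\sum_(j < i) 1)%N; last by rewrite sum1_card card_ord.
rewrite (big_ord_widen n (fun=> 1%N)) ?(ltnW (ltn_ord i)) // [RHS]big_mkcond /=.
by apply: eq_bigr => j _; case: ltnP.
Qed.

(** There are n(n - 1)/2 imaginary units and, for 4 < n, n - 2 real ones. From n = 7 on, the
    imaginary ones alone would be too few. *)
Lemma size_unit_seq_ge n d : (2 < n)%N -> (2 <= d)%N -> (2 * d <= n ^ 2 - 1)%N ->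
  (d - 2 <= size (unit_seq n))%N.
Proof.
move=> n2 d2 dn; rewrite size_unit_seq.
have tri : (2 * \sum_(i < n) i = n * n.-1)%N.
  rewrite -(big_mkord xpredT id) bin2_sum mul2n bin2 even_halfK // oddM.
  by case: (n) => //= m; rewrite andNb.
have imag : (\sum_(i < n) i <= \sum_(i < n) \sum_(j < n) (free_units (i, j) : nat))%N.
  apply: leq_sum => i _; rewrite -[X in (X <= _)%N](sum_ltn_ord i); apply: leq_sum => j _.
  by rewrite /free_units /=; case: (j < i)%N.
have [n4|n4] := leqP n 4; first by rewrite -mulnn in dn; nia.
case: n n2 dn tri imag n4 => [|[|[|n]]] // _ dn tri imag n4.
have real : (n.+1 <= \sum_(j < n.+3) (free_units (ord0, j) : nat))%N.
  rewrite 2!big_ord_recl /= /free_units /= n4 /bump /= !add0n.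
  by rewrite -[X in (X <= _)%N]card_ord -sum1_card; apply: leq_sum => j _.
have rest : (\sum_(i < n.+2) bump 0 i <= \sum_(i < n.+2) \sum_(j < n.+3) (free_units (lift ord0 i, j) : nat))%N.
  apply: leq_sum => i _; rewrite -[X in (X <= _)%N](sum_ltn_ord (lift ord0 i)).
  by apply: leq_sum => j _; rewrite /free_units /=; case: (j < _)%N.
rewrite [X in (_ <= X)%N]big_ord_recl; apply: leq_trans (leq_add real rest).
move: tri; rewrite big_ord_recl add0n; set S := (\sum_(i < n.+2) _)%N => tri.
by rewrite -mulnn in dn; nia.
Qed.

Lemma rigid_exists_half n d : (2 < n)%N -> (2 <= d)%N -> (2 * d <= n ^ 2 - 1)%N ->
  exists2 W : {vspace 'M[C]_n}, grassmannian_sa d W & rigid_space W.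
Proof.
move=> n2 d2 dn; pose F := take (d - 2) (unit_seq n).
have sF : (size F).+2 = d.
  by rewrite size_takel ?size_unit_seq_ge // -addn2 subnK.
have uF : uniq F by rewrite take_uniq // filter_uniq ?enum_uniq.
have FE p : p \in F -> free_units p.
  by move=> /mem_take; rewrite mem_filter => /andP[].
have Foff p : p \in F -> p.1 != p.2.
  by move=> /FE; rewrite -val_eqE neq_ltn /= => /orP[->|/and3P[_ /eqP -> /ltnW ->]]; rewrite ?orbT.
have Fimag p : (n <= 4)%N -> p \in F -> (p.1 < p.2)%N = false.
  move=> n4 /FE /orP[lt_p|/and3P[n4' _ _]]; last by rewrite ltnNge n4 in n4'.
  by apply/negbTE; rewrite -leqNgt ltnW.
have Freal p : p \in F -> (p.1 < p.2)%N -> (p.1.+1 < p.2)%N.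
  move=> /FE /orP[lt_p|/and3P[_ /eqP -> //]] lt_p'.
  by have := ltn_trans lt_p lt_p'; rewrite ltnn.
suff [Z1 [Z2 [N1 [N2 [s [sd Fz]]]]]] : exists (Z1 Z2 : 'M[R]_n) N1 N2 s,
    seed Z1 Z2 N1 N2 s /\
    forall p, p \in F -> (p.1 < p.2)%N -> Z1 p.1 p.2 = 0 /\ Z2 p.1 p.2 = 0.
  by rewrite -sF; apply: seed_rigid sd uF Foff Fz; lia.
have [n4|n4] := leqP n 4; last first.
  have [s sd] := path_seed R n4; do 5 eexists; split; first exact: sd.
  by move=> p pF lt_p; exact: (@path_free R n n4 p.2 p.1 (Freal _ pF lt_p)).
have [n3|n3] := eqVneq n 3.
  move: F sF uF FE Foff Fimag Freal; rewrite n3 => F _ _ _ _ Fimag _.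
  do 5 eexists; split; first exact: seed3.
  by move=> p pF; rewrite Fimag.
have n4' : n = 4 by lia.
move: F sF uF FE Foff Fimag Freal; rewrite n4' => F _ _ _ _ Fimag _.
do 5 eexists; split; first exact: seed4.
by move=> p pF; rewrite Fimag.
Qed.

Lemma rigid_exists n d : (2 < n)%N -> (2 <= d)%N -> (d + 3 <= n ^ 2)%N ->
  exists2 W : {vspace 'M[C]_n}, grassmannian_sa d W & rigid_space W.
Proof.
move=> n2 d2 dn; have [h|h] := leqP (2 * d) (n ^ 2 - 1); first exact: rigid_exists_half.
(* The complement has d replaced by n^2 - d - 1, an involution that exchanges the two halves of the
   range 2 <= d <= n^2 - 3. *)
have [|||W Wd Wr] := @rigid_exists_half n (n ^ 2 - d.+1); try lia.
have [W' Wd' Wr'] := rigid_complement (ltnW (ltnW n2)) Wd Wr.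
by exists W' => //; have -> : d = (n ^ 2 - (n ^ 2 - d.+1).+1)%N by lia.
Qed.

Lemma generically_rigid n d (P : {vspace 'M[C]_n} -> Prop) :
  (2 < n)%N -> (2 <= d)%N -> (d + 3 <= n ^ 2)%N ->
  (forall S Pr, self_adjoint_space S -> is_proj S Pr ->
     (forall x, gen (adj_of Pr) x) -> P S) ->
  generically d P.
Proof.
move=> n2 d2 dn PS; have n0 : (0 < n)%N := ltnW (ltnW n2).
exists (@rigid_space R n); split.
- exact: rigid_space_open.
- exact: rigid_exists.
- move=> W [Wsa dW] [W1 [Pr pPr gPr]].
  have Ssa := self_adjoint_add_one Wsa.
  split; last exact: PS Ssa pPr gPr.
  split; last by rewrite dim_add_one // dW.
  by split; [exact: one_mem_addv | exact: Ssa].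
Qed.

Lemma not_generically n d (P : {vspace 'M[C]_n} -> Prop) :
  (forall W, grassmannian_sa d W -> operator_dsystem d (<[1%:M]> + W)%VS ->
     ~ P (<[1%:M]> + W)%VS) -> ~ generically d P.
Proof.
by move=> nP [U [_ [W Wd UW] h]]; have [Sd PS] := h W Wd UW; apply: nP Wd Sd PS.
Qed.

End Existence.

Theorem corollary1p9 (R : realType) (n d : nat) (Q : cqgAlg R)
    (alpha : 'M[R[i]%C]_n -> 'M[Q]_n) (hQ : is_Qut alpha)
    (hd : (1 <= d <= n ^ 2 - 2)%N) :
  generically d (Qut_system_trivial alpha) <->
  generically d (Qut_graph_trivial alpha).
Proof.
case/andP: hd => d1 dn.
(* Truncated subtraction makes n^2 - 2 equal to 0 for n <= 1, against 1 <= d. *)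
have n1 : (1 < n)%N by case: n {alpha hQ} dn => [|[|n]] //; lia.
have n2_ge : (4 <= n ^ 2)%N by rewrite -mulnn; nia.
have [d_eq|d_ne] := eqVneq d 1%N.
  have none (W : {vspace 'M[R[i]%C]_n}) : grassmannian_sa d W -> _ := fun Wd =>
    not_trivial_dim1 n1 hQ Wd.1 (etrans Wd.2 d_eq).
  by split=> g; exfalso; move: g; apply: not_generically => W Wd _; have [] := none W Wd.
have [d_eq|d_ne'] := eqVneq d (n ^ 2 - 2)%N.
  have none (W : {vspace 'M[R[i]%C]_n}) (Sd : operator_dsystem d (<[1%:M]> + W)%VS) :=
    not_trivial_codim1 n1 hQ Sd.1.2.
  have dS (W : {vspace 'M[R[i]%C]_n}) (Sd : operator_dsystem d (<[1%:M]> + W)%VS) :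
      (\dim (<[1%:M]> + W)).+1 = (n ^ 2)%N.
    by rewrite Sd.2 d_eq; lia.
  by split=> g; exfalso; move: g; apply: not_generically => W _ Sd;
    have [] := none W Sd (dS W Sd).
have d2 : (2 <= d)%N by lia.
have dn3 : (d + 3 <= n ^ 2)%N by lia.
(* For n = 2 the only values of d are 1 and 2 = n^2 - 2, both already treated. *)
have n2 : (2 < n)%N by rewrite ltn_neqAle n1 andbT; apply: contraTneq dn3 => <-; lia.
have n0 := ltnW n1.
by split=> _; apply: generically_rigid => // S P Ssa pP gP;
  have [] := Qut_trivial_of_gen n0 hQ Ssa pP gP.
Qed.
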